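(* Let $\Omega \subset \mathbb{R}^N$ be open and bounded, let $d \in \mathbb{N}$, fix numbers $p_1,\dots,p_d \in (\frac{2N}{N+2},2]$ with $p_i>1$ for all $i$, and let $g=(g_1,\dots,g_d)\colon \mathbb{R}^d \to \mathbb{R}^d$ be locally Lipschitz continuous. Then there exist $\lambda_0 > 0$ and a family $(u_\lambda)_{\lambda\in(-\lambda_0,\lambda_0)}$ in $W^{1,p}_0(\Omega;\mathbb{R}^d)\cap L^\infty(\Omega;\mathbb{R}^d)$ such that: (i) for every $\lambda \in (-\lambda_0,\lambda_0)$ the function $u=u_\lambda=(u_1,\dots,u_d)$ is a solution of the system \[ \left\{ \begin{aligned} -\Delta_{p_i} u_i & = \lambda g_i(u_1,\dots,u_d) && \text{on } \Omega, \\ u_i & = 0 && \text{on } \partial\Omega, \end{aligned} \right. \qquad i=1,\dots,d; \tag{S} \] in particular $g(u_\lambda) \in L^\infty(\Omega;\mathbb{R}^d) \subset W^{-1,p'}(\Omega;\mathbb{R}^d)$, so that the notion of an (energy) solution applies; (ii) the mapping $\lambda \mapsto u_\lambda$ is Lipschitz continuous from $(-\lambda_0,\lambda_0)$ to $L^\infty(\Omega;\mathbb{R}^d) \cap W^{1,p}_0(\Omega;\mathbb{R}^d)$, i.e. with respect to the norms of both spaces; (iii) there exist $\varepsilon > 0$ and $\lambda_1 \in (0,\lambda_0)$ such that for all $\lambda \in (-\lambda_1,\lambda_1)$ the function $u_\lambda$ is the only solution $u$ of (S) that satisfies $\|u\|_\infty \le \varepsilon$.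
   Context: Here $W^{1,p}_0(\Omega;\mathbb{R}^d)$ denotes the space of functions $u=(u_1,\dots,u_d)$ with $u_i \in W^{1,p_i}_0(\Omega)$ for each $i$ (with the product norm), and $W^{-1,p'}(\Omega;\mathbb{R}^d)$ denotes its dual, i.e. the product of the spaces $W^{-1,p_i'}(\Omega)$, $\frac1{p_i}+\frac1{p_i'}=1$. The $p$-Laplace operator is formally $\Delta_p u = \operatorname{div}(|\nabla u|^{p-2}\nabla u)$, and solutions are understood in the weak (energy) sense: a function $u\in W^{1,p}_0(\Omega;\mathbb{R}^d)\cap L^\infty(\Omega;\mathbb{R}^d)$ is a solution of (S) if for every $i=1,\dots,d$ \[ \int_\Omega |\nabla u_i|^{p_i-2}\nabla u_i\cdot\nabla v = \int_\Omega \lambda\, g_i(u_1,\dots,u_d)\, v \quad\text{for all } v\in W^{1,p_i}_0(\Omega), \] where $|\nabla u_i|^{p_i-2}\nabla u_i$ is taken to be $0$ where $\nabla u_i=0$. No regularity of $\partial\Omega$ and no growth condition on $g$ is assumed. *)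

(* Defs.v *)
From HB Require Import structures.
From mathcomp Require Import all_boot all_order all_algebra.
From mathcomp Require Import all_classical all_reals all_analysis.
From mathcomp Require Import measurable_realfun ess_sup_inf.

Set Implicit Arguments.
Unset Strict Implicit.
Unset Printing Implicit Defensive.
Import Order.TTheory GRing.Theory Num.Theory.
Import numFieldNormedType.Exports.
Local Open Scope classical_set_scope.
Local Open Scope ring_scope.

(* Row vectors carry the Borel sigma-algebra. *)
Section borel.
Context {R : realType} (n : nat).

HB.instance Definition _ := @isMeasurable.Build
  (sigma_display (@open 'rV[R]_n)) 'rV[R]_n <<s @open 'rV[R]_n >>
  (@sigma_algebra0 _ setT _) (@sigma_algebraC _ _)
  (@sigma_algebra_bigcup _ setT _).

Lemma open_measurable_rV (U : set 'rV[R]_n) : open U -> measurable U.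
Proof. by move=> oU; exact: sub_sigma_algebra. Qed.

Lemma continuous_measurable_rV (f : 'rV[R]_n -> R) :
  continuous f -> measurable_fun setT f.
Proof.
move=> /continuousP cf; apply: (measurability _ (RGenOpens.measurableE R)).
move=> _ [_ [a [b ->] <-]]; rewrite setTI; apply: open_measurable_rV.
exact/cf/interval_open.
Qed.

Lemma measurable_rVP d (T : measurableType d) (f : T -> 'rV[R]_n) :
  measurable_fun setT f <->
  forall i, measurable_fun setT (fun x => f x ord0 i).
Proof.
split=> [mf i|mf].
  apply: (@measurableT_comp _ _ _ _ _ _ (fun v : 'rV[R]_n => v ord0 i)) => //.
  by apply: continuous_measurable_rV; exact: coord_continuous.
have mball (c : 'rV[R]_n) (e : R) : measurable (f @^-1` ball c e).
  have [e0|e0] := ltP 0 e; last first.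
    rewrite (_ : _ @^-1` _ = set0)//; apply/seteqP; split=> // x [].
    by rewrite ltNge e0.
  rewrite (_ : _ @^-1` _ =
      \bigcap_(i in [set: 'I_n]) ((fun x => f x ord0 i) @^-1` ball (c ord0 i) e)).
    apply: fin_bigcap_measurable => [|i _]; first exact: finite_finset.
    by rewrite -[X in measurable X]setTI; apply: mf => //; exact: measurable_ball.
  apply/seteqP; split=> [x [_ xb] i _|x xb]; first exact: xb.
  by split=> // i j; rewrite (ord1 i); exact: xb.
apply: (@measurability _ _ _ _ setT f (@open 'rV[R]_n)) => // _ [U oU <-]; rewrite setTI.
pose B (qk : 'rV[rat]_n * nat) :=
  ball (map_mx ratr qk.1 : 'rV[R]_n) (qk.2.+1%:R^-1 : R).
rewrite (_ : U = \bigcup_qk (if `[< B qk `<=` U >] then B qk else set0)).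
  rewrite preimage_bigcup; apply: countable_bigcupT_measurable => // qk.
  by case: ifPn => _; [exact: mball|rewrite preimage_set0].
apply/seteqP; split=> [x Ux|x [qk _]]; last first.
  by case: ifPn => [/asboolP|]//; exact.
have /nbhs_ballP[e /= e0 eU] : nbhs x U by exact: open_nbhs_nbhs.
have [k ke] : exists k, k.+1%:R^-1 < e / 2.
  exists (Num.truncn (e / 2)^-1).
  by rewrite invf_plt ?posrE ?divr_gt0// truncnS_gt.
have /choice[q qx] : forall i, exists q : rat, `|x ord0 i - ratr q| < k.+1%:R^-1.
  move=> i; have : x ord0 i < x ord0 i + k.+1%:R^-1 by rewrite ltrDl invr_gt0.
  move=> /rat_in_itvoo[q]; rewrite in_itv/= => /andP[q1 q2]; exists q.
  by rewrite distrC gtr0_norm ?subr_gt0// ltrBlDl.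
have Bx : B (\row_i q i, k) x.
  by split=> [|i j]; rewrite ?invr_gt0//= !mxE (ord1 i) /ball/= distrC.
exists (\row_i q i, k) => //; rewrite ifT//; apply/asboolP => y By.
apply/eU/(ball_split (ball_sym (le_ball (ltW ke) Bx))).
exact: (le_ball (ltW ke)) By.
Qed.

End borel.

Section lebesgue_rV.
Context {R : realType}.

Definition rV_cons n (xv : R * 'rV[R]_n) : 'rV[R]_n.+1 :=
  \row_i oapp (xv.2 ord0) xv.1 (unlift ord0 i).

Lemma rV_cons0 n xv : @rV_cons n xv ord0 ord0 = xv.1.
Proof. by rewrite mxE unlift_none. Qed.

Lemma rV_consS n xv j : @rV_cons n xv ord0 (lift ord0 j) = xv.2 ord0 j.
Proof. by rewrite mxE liftK. Qed.

Lemma measurable_rV_cons n : measurable_fun setT (@rV_cons n).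
Proof.
apply/measurable_rVP => i; case: (unliftP ord0 i) => [j|] ->.
  under eq_fun do rewrite rV_consS.
  by move/measurable_rVP : (@measurable_snd _ _ R 'rV[R]_n); exact.
under eq_fun do rewrite rV_cons0.
exact: measurable_fst.
Qed.

Section step.
Variables (n : nat) (m : {sigma_finite_measure set 'rV[R]_n -> \bar R}).
Local Open Scope ereal_scope.

(* Product of the Lebesgue measure on the first coordinate with [m]. *)
Definition lebesgue_step : set 'rV[R]_n.+1 -> \bar R :=
  pushforward (@lebesgue_measure R \x m) (@rV_cons n).

HB.instance Definition _ := Measure.copy lebesgue_step
  (measure_function_pushforward__canonical__measure_function_Measure (@lebesgue_measure R \x m) (@measurable_rV_cons n)).


Let lebesgue_step_sigma_finite : sigma_finite setT lebesgue_step.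
Proof.
have /sigma_finiteP[F [FT ndF Foo]] := sigma_finiteT (@lebesgue_measure R).
have /sigma_finiteP[G [GT ndG Goo]] := sigma_finiteT m.
pose uncons (v : 'rV[R]_n.+1) := (v ord0 ord0, \row_j v ord0 (lift ord0 j)).
have consK : cancel (@rV_cons n) uncons.
  move=> [x v]; rewrite /uncons rV_cons0; congr pair.
  by apply/rowP => j; rewrite mxE rV_consS.
have muncons : measurable_fun setT uncons.
  apply: measurable_fun_pair.
    by apply: continuous_measurable_rV; exact: coord_continuous.
  apply/measurable_rVP => j; under eq_fun do rewrite mxE.
  by apply: continuous_measurable_rV; exact: coord_continuous.
exists (fun k => uncons @^-1` (F k `*` G k)).
  apply/seteqP; split=> // v _.
  have [k _ Fk] : (\bigcup_k F k) (uncons v).1 by rewrite -FT.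
  have [l _ Gl] : (\bigcup_k G k) (uncons v).2 by rewrite -GT.
  exists (maxn k l) => //; split.
    by move: Fk; exact/subsetPset/ndF/leq_maxl.
  by move: Gl; exact/subsetPset/ndG/leq_maxr.
move=> k; have [mF Fk] := Foo k; have [mG Gk] := Goo k; split.
  by rewrite -[X in measurable X]setTI; apply: muncons => //; exact: measurableX.
rewrite /lebesgue_step /pushforward -comp_preimage.
rewrite (_ : _ \o _ = id) ?preimage_id; last exact/funext.
by rewrite product_measure1E// lte_mul_pinfty// ge0_fin_numE.
Qed.

HB.instance Definition _ := Measure_isSigmaFinite.Build _ _ _ lebesgue_step
  lebesgue_step_sigma_finite.

End step.

Fixpoint lebesgue_rV n : {sigma_finite_measure set 'rV[R]_n -> \bar R} :=
  match n with
  | 0 => @dirac _ 'rV[R]_0 0 R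
  | n'.+1 => lebesgue_step (lebesgue_rV n')
  end.

Lemma measurable_box n (A : 'I_n -> set R) : (forall i, measurable (A i)) ->
  measurable [set v : 'rV[R]_n | forall i, A i (v ord0 i)].
Proof.
move=> mA; rewrite (_ : mkset _ =
    \bigcap_(i in setT) ((fun v : 'rV[R]_n => v ord0 i) @^-1` A i)).
  apply: fin_bigcap_measurable => [|i _]; first exact: finite_finset.
  rewrite -[X in measurable X]setTI.
  by apply: (continuous_measurable_rV (@coord_continuous R _ _ ord0 i)).
by apply/seteqP; split=> v vA i; [move=> _; exact: vA|exact: (vA i I)].
Qed.

Lemma lebesgue_rV_box n (A : 'I_n -> set R) : (forall i, measurable (A i)) ->
  lebesgue_rV n [set v | forall i, A i (v ord0 i)] =
  (\prod_(i < n) lebesgue_measure (A i))%E.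
Proof.
elim: n A => [|n IH] A mA.
  rewrite big_ord0 (_ : [set _ | _] = setT) /=; first exact: diracT.
  by apply/seteqP; split=> // v _ [].
have mA' : measurable
    [set v : 'rV[R]_n | forall i, (A \o lift ord0) i (v ord0 i)].
  by apply: measurable_box => i; exact: mA.
rewrite big_ord_recl -(IH (A \o lift ord0)); last by move=> i; exact: mA.
rewrite -[RHS](product_measure1E lebesgue_measure _ (mA ord0) mA').
congr (_ \x _)%E; apply/seteqP; split=> -[x v] /=.
  move=> h; split; first by have := h ord0; rewrite rV_cons0.
  by move=> i; have := h (lift ord0 i); rewrite rV_consS.
by move=> [Ax Av] i; case: (unliftP ord0 i) => [j|] ->;
  rewrite ?rV_cons0 ?rV_consS.
Qed.

End lebesgue_rV.
Arguments lebesgue_rV R n : clear implicits.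

Section sobolev.
Context {R : realType} {N : nat}.
Local Notation E := 'rV[R]_N.
Local Notation leb := (lebesgue_rV R N).
Implicit Types (Om : set E) (f h u v phi : E -> R) (G : E -> E) (p : R).

Definition partial (j : 'I_N) f : E -> R := 'D_(delta_mx ord0 j) f.

Definition smooth f := forall (s : seq 'I_N) (x : E),
  differentiable (foldr partial f s) x.

Definition tsupport f := closure [set x | f x != 0].

Definition test_function Om : set (E -> R) :=
  [set phi | [/\ smooth phi, compact (tsupport phi) & tsupport phi `<=` Om]].

(* Functions on [Om] are represented by functions on the whole space whose values
   outside [Om] are irrelevant: [f \_ Om] is the extension of [f] by 0. *)
Definition Lp Om (p : \bar R) : set (E -> R) := [set f | f \_ Om \in Lfun leb p].

Definition Lp_norm Om (p : \bar R) f : \bar R := 'N[leb]_p [EFin \o (f \_ Om)].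

Definition dot n (x y : 'rV[R]_n) : R := \sum_(j < n) x ord0 j * y ord0 j.

(* Euclidean norm; the library norm on ['rV[R]_n] is the maximum norm. *)
Definition enorm n (x : 'rV[R]_n) : R := Num.sqrt (dot x x).

Definition component n (w : E -> 'rV[R]_n) (i : 'I_n) : E -> R :=
  fun x => w x ord0 i.

Definition loc_integrable Om f := forall K : set E,
  compact K -> K `<=` Om -> leb.-integrable K (EFin \o f).

(* Local integrability cannot be dropped: the real-valued integral of a
   non-integrable function is a junk value. *)
Definition is_weak_gradient Om u G := forall j : 'I_N,
  loc_integrable Om (component G j) /\
  forall phi, test_function Om phi ->
    \int[leb]_(x in Om) (u x * partial j phi x) =
    - \int[leb]_(x in Om) (component G j x * phi x).

(* Unique up to equality almost everywhere on [Om] when it exists. *)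
Definition weak_gradient Om u : E -> E := get (is_weak_gradient Om u).

Definition W1p Om p : set (E -> R) :=
  [set u | [/\ Lp Om p%:E u,
    is_weak_gradient Om u (weak_gradient Om u) &
    forall j, Lp Om p%:E (component (weak_gradient Om u) j)]].

Definition W1p_norm Om p u : \bar R :=
  (Lp_norm Om p%:E u + Lp_norm Om p%:E (@enorm N \o weak_gradient Om u))%E.

(* Closure of the test functions in [W1p Om p]. *)
Definition W1p0 Om p : set (E -> R) :=
  [set u | W1p Om p u /\
    forall e : R, 0 < e ->
      exists2 phi, test_function Om phi & (W1p_norm Om p (u \- phi)%R < e%:E)%E].

(* W^{-1,p'}(Om): the bounded linear functionals on [W1p0 Om p]. *)
Definition W1p0_dual Om p : set ((E -> R) -> R) :=
  [set F | (forall (a : R) u v, W1p0 Om p u -> W1p0 Om p v ->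
      F (a \*o u \+ v) = a * F u + F v) /\
    exists C : R, forall v, W1p0 Om p v ->
      (`|F v|%:E <= C%:E * W1p_norm Om p v)%E].

Definition pairing Om h : (E -> R) -> R :=
  fun v => \int[leb]_(x in Om) (h x * v x).

(* [p_flux p 0 = 0] for every [p], also when [p < 2]. *)
Definition p_flux p (z : E) : E := (enorm z `^ (p - 2)) *: z.

Section system.
Context {d : nat}.
Implicit Types (q : 'I_d -> R) (w : E -> 'rV[R]_d) (g : 'rV[R]_d -> 'rV[R]_d).

Definition W1p0_vec Om q : set (E -> 'rV[R]_d) :=
  [set w | forall i, W1p0 Om (q i) (component w i)].

Definition W1p0_vec_norm Om q w : \bar R :=
  (\sum_(i < d) W1p_norm Om (q i) (component w i))%E.

Definition Linfty_vec Om : set (E -> 'rV[R]_d) :=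
  [set w | forall i, Lp Om +oo (component w i)].

(* With the maximum norm on ['rV[R]_d], this is the largest of the essential
   suprema of the components. *)
Definition Linfty_vec_norm Om w : \bar R := Lp_norm Om +oo (Num.norm \o w).

Definition locally_lipschitz g := forall y : 'rV[R]_d,
  exists2 U, nbhs y U & [lipschitz g z | z in U].

Definition solution Om q g (lam : R) : set (E -> 'rV[R]_d) :=
  [set w | [/\ W1p0_vec Om q w, Linfty_vec Om w &
    forall (i : 'I_d) v, W1p0 Om (q i) v ->
      \int[leb]_(x in Om) dot (p_flux (q i) (weak_gradient Om (component w i) x))
                             (weak_gradient Om v x) =
      \int[leb]_(x in Om) (lam * component (g \o w) i x * v x)]].

End system.
End sobolev.

(* Main.v *)
(* Each equation -Delta_p u = f with f bounded has an energy solution S(f), the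
   minimiser of |grad u|_p^p / p - (integral of f u).  The solution operator S is
   Lipschitz continuous from L^oo to L^oo, and to W^{1,p}_0, on bounded sets of L^oo,
   although the p-Laplace operator is degenerate: if |f1 - f2| <= delta, the
   difference w of the solutions has gradient D with
     integral of K^(p-2) |D|^2 over {w > k} <= c delta |(w - k)^+|_1,
   where K = |grad u1| + |grad u2| is bounded in L^p.  By Hoelder and a Faber-Krahn
   inequality in L^1 this gives (h - k) |{w > h}| <= c delta |{w > k}|^b with
   b = 2/N + 2 - 2/p, and b > 1 exactly when p > 2N/(N+2); Stampacchia's iteration
   then yields |w| <= C delta.  Hence for small lambda the map u |-> S(lambda g(u)) is
   a contraction in L^oo, after composing g with the projection onto the unit box,
   where g is bounded and Lipschitz continuous.

   Hoelder's inequality is replaced by pointwise Young inequalities with a free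
   parameter, so that only integrals of p-th powers occur.  Test functions near a
   level k are t |-> (t - k) exp (- e / (t - k)), which keep compositions smooth. *)

(* For p < 2 the map x |-> |x|^(p-2) x is only Hoelder continuous, but its inverse is locally
   Lipschitz: the weight (|x| + |z|)^(p-2) in the monotonicity inequality is small only where the
   gradients are large. A bound on the energy of the solutions, uniform over right-hand sides
   bounded by M, pays for removing the weight; the price is a factor a^(2 - 2/p) in place of a for a
   level set of measure a. Clipping g gives all right-hand sides one bound, hence the solution
   operator one Lipschitz constant; for small lambda the fixed points have sup norm at most 1/4,
   where the clipping is not felt. Existence, Lipschitz dependence and uniqueness then come from the
   same estimate. The weak gradient of the statement is a choice among functions that agree almost
   everywhere, so it is additive only up to null sets. The analysis therefore works with pairs (u,
   G) of a function and an explicit gradient in the closure of the test functions, and returns to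
   the chosen gradient only when the system is read off. *)
Require Import Defs.
From mathcomp Require Import all_boot all_order all_algebra.
From mathcomp Require Import all_classical all_reals all_analysis.
From mathcomp Require Import measurable_realfun ess_sup_inf ring lra.
Set Implicit Arguments.
Unset Strict Implicit.
Unset Printing Implicit Defensive.
Import Order.TTheory GRing.Theory Num.Theory.
Import numFieldNormedType.Exports.
Local Open Scope classical_set_scope.
Local Open Scope ring_scope.

(** * Lebesgue measure on row vectors *)

Section lebesgue_rV_theory.
Context {R : realType}.

(** Uniqueness of the Lebesgue measure: its image under a translation has the same values on
    half-open intervals. *)
Lemma ge0_integral_shift1 (f : R -> \bar R) (a : R) :
  measurable_fun setT f -> (forall x, 0 <= f x)%E ->
  (\int[lebesgue_measure]_x f (x + a)%R = \int[lebesgue_measure]_x f x)%E.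
Proof.
move=> mf f0.
have ma : measurable_fun setT ((fun x => x + a) : measurableTypeR R -> measurableTypeR R).
  by apply: measurable_funD => //; exact: measurable_cst.
pose mu := measure_function_pushforward__canonical__measure_function_Measure
  (@lebesgue_measure R) ma.
have muE A : measurable A -> lebesgue_measure A = mu A.
  move=> mA; apply: (lebesgue_measure_unique (mu := mu)) => // _ [[x y] _ <-] /=.
  rewrite /pushforward.
  rewrite (_ : _ @^-1` _ = `](x - a), (y - a)]%classic); last first.
    by apply/seteqP; split=> z /=; rewrite !in_itv/= ltrBlDr lerBrDr.
  rewrite !lebesgue_measure_itv/= !lte_fin ltrD2r; case: ifP => // _.
  by rewrite -!EFinD; congr EFin; ring.
transitivity (\int[mu]_x f x)%E; last first.
  by apply: eq_measure_integral => A mA _; exact/esym/muE.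
by rewrite (@ge0_integral_pushforward _ _ _ _ _ _ ma).
Qed.

Lemma ge0_integral_lebesgue_rVS n (f : 'rV[R]_n.+1 -> \bar R) :
  measurable_fun setT f -> (forall x, 0 <= f x)%E ->
  (\int[lebesgue_rV R n.+1]_x f x =
   \int[lebesgue_measure]_x \int[lebesgue_rV R n]_v f (rV_cons (x, v)))%E.
Proof.
move=> mf f0.
rewrite [LHS](@ge0_integral_pushforward _ _ (measurableTypeR R * 'rV[R]_n)%type
  _ R (@rV_cons R n) (@measurable_rV_cons R n) _ setT f measurableT mf)//.
rewrite [LHS](@fubini_tonelli1 _ _ (measurableTypeR R) _ R (@lebesgue_measure R)
  (lebesgue_rV R n) (f \o @rV_cons R n))//=.
by apply: measurableT_comp => //; exact: measurable_rV_cons.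
Qed.

Lemma rV_consD n (x y : R) (v w : 'rV[R]_n) :
  rV_cons (x + y, v + w) = rV_cons (x, v) + rV_cons (y, w).
Proof.
apply/rowP => i; rewrite [RHS]mxE; case: (unliftP ord0 i) => [j|] ->.
  by rewrite !rV_consS /= mxE.
by rewrite !rV_cons0.
Qed.

Lemma rV_consE n (h : 'rV[R]_n.+1) :
  h = rV_cons (h ord0 ord0, \row_j h ord0 (lift ord0 j)).
Proof.
apply/rowP => i; case: (unliftP ord0 i) => [j|] ->.
  by rewrite rV_consS mxE.
by rewrite rV_cons0.
Qed.

Lemma measurable_shift_rV n (h : 'rV[R]_n) : measurable_fun setT (fun x : 'rV[R]_n => x + h).
Proof.
apply/measurable_rVP => i; under eq_fun do rewrite mxE.
apply: measurable_funD; last exact: measurable_cst.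
by apply: continuous_measurable_rV; exact: coord_continuous.
Qed.

(** Induction on the dimension: Tonelli's theorem separates the first coordinate, and [rV_cons]
    turns a shift into one shift per factor. *)
Lemma ge0_integral_shift n (f : 'rV[R]_n -> \bar R) (h : 'rV[R]_n) :
  measurable_fun setT f -> (forall x, 0 <= f x)%E ->
  (\int[lebesgue_rV R n]_x f (x + h)%R = \int[lebesgue_rV R n]_x f x)%E.
Proof.
elim: n f h => [|n IH] f h mf f0.
  by apply: eq_integral => x _; congr f; apply/rowP => -[].
have mfc : measurable_fun setT (fun xv : R * 'rV[R]_n => f (rV_cons xv)).
  by apply: measurableT_comp => //; exact: measurable_rV_cons.
have mfh : measurable_fun setT (fun x : 'rV[R]_n.+1 => f (x + h)).
  by apply: measurableT_comp => //; exact: measurable_shift_rV.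
rewrite (ge0_integral_lebesgue_rVS mfh (fun x => f0 _)) (ge0_integral_lebesgue_rVS mf f0) {mfh}.
rewrite (rV_consE h); set a := h ord0 ord0; set w := \row_j _.
under eq_integral => x _.
  under eq_integral => v _ do rewrite -rV_consD.
  rewrite (IH (fun v => f (rV_cons (x + a, v))))//; last first.
    exact: (measurableT_comp mfc (measurable_pair1 _)).
  over.
rewrite (ge0_integral_shift1 (f := fun x => (\int[lebesgue_rV R n]_v f (rV_cons (x, v)))%E))//.
  by apply: (measurable_fun_fubini_tonelli_F (fun xv : R * 'rV[R]_n => f (rV_cons xv))).
by move=> x; apply: integral_ge0.
Qed.

Lemma box_rV_measurable n (a b : 'rV[R]_n) :
  measurable [set x : 'rV[R]_n | forall i, x ord0 i \in `]a ord0 i, b ord0 i[].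
Proof.
have := @measurable_box R n (fun i => `]a ord0 i, b ord0 i[%classic).
by apply => i; exact: measurable_itv.
Qed.

Lemma entry_le_norm n (x : 'rV[R]_n) i : `|x ord0 i| <= `|x|.
Proof.
rewrite [leRHS]/Num.norm /= mx_normrE; apply/bigmax_geP; right => /=.
by exists (ord0, i).
Qed.

Lemma lebesgue_rV_bounded n (A : set 'rV[R]_n) :
  measurable A -> bounded_set A -> (lebesgue_rV R n A < +oo)%E.
Proof.
move=> mA [M [Mr HM]].
pose B := [set v : 'rV[R]_n | forall i, `[- (M + 1), M + 1]%classic (v ord0 i)].
have AB : A `<=` B.
  move=> x Ax i /=; have := HM (M + 1) _ x Ax; rewrite ltrDl ltr01 => /(_ isT).
  rewrite in_itv/= -ler_norml => h; apply: le_trans h.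
  exact: entry_le_norm.
have mB : measurable B.
  by have := @measurable_box R n (fun=> `[- (M + 1), M + 1]%classic); apply => i; exact: measurable_itv.
apply: (@le_lt_trans _ _ (lebesgue_rV R n B)); first by apply: le_measure; rewrite ?inE.
rewrite /B (lebesgue_rV_box (A := fun=> _))//.
rewrite ltey_eq; apply/orP; left.
elim/big_ind : _ => //= [x y xf yf|i _]; first exact: fin_numM.
by rewrite lebesgue_measure_itv /=; case: ifP => _; rewrite -?EFinD.
Qed.

Lemma ball_rV_box n (x : 'rV[R]_n) (e : R) : 0 < e -> ball x e =
  [set y : 'rV[R]_n | forall i, y ord0 i \in `](x - const_mx e) ord0 i, (x + const_mx e) ord0 i[].
Proof.
move=> e0; apply/seteqP; split=> [y [_ xy] i|y xy].
  have := xy ord0 i; rewrite /ball/= !mxE in_itv/= ltr_distlC => /andP[? ?].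
  by apply/andP; split.
split=> // i j; rewrite (ord1 i); have := xy j.
by rewrite /ball/= !mxE in_itv/= ltr_distlC.
Qed.

(** Rational corners keep the family countable. The condition on the closed box is there because
    closed boxes are compact, so that local integrability on U applies to each of them. *)
Lemma open_bigcup_box n (U : set 'rV[R]_n) : open U ->
  U = \bigcup_(ab in [set ab : 'rV[rat]_n * 'rV[rat]_n |
      [set x : 'rV[R]_n | forall i, x ord0 i \in `[(ratr (ab.1 ord0 i)), (ratr (ab.2 ord0 i))]] `<=` U])
    [set x : 'rV[R]_n | forall i, x ord0 i \in `](ratr (ab.1 ord0 i)), (ratr (ab.2 ord0 i))[].
Proof.
move=> oU; apply/seteqP; split=> [x Ux|x [ab /= abU xab]]; last first.
  by apply: abU => i; apply: subset_itv_oo_cc; exact: xab.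
have /nbhs_ballP[e /= e0 eU] : nbhs x U by exact: open_nbhs_nbhs.
have /choice[a ha] : forall i, exists q : rat, x ord0 i - e < ratr q < x ord0 i.
  by move=> i; have := @rat_in_itvoo R (x ord0 i - e) (x ord0 i);
    rewrite ltrBlDr ltrDl => /(_ e0) [q]; rewrite in_itv; exists q.
have /choice[b hb] : forall i, exists q : rat, x ord0 i < ratr q < x ord0 i + e.
  by move=> i; have := @rat_in_itvoo R (x ord0 i) (x ord0 i + e);
    rewrite ltrDl => /(_ e0) [q]; rewrite in_itv; exists q.
exists (\row_i a i, \row_i b i) => /= [y yab|i]; last first.
  by rewrite !mxE in_itv/=; have /andP[_ ->] := ha i; have /andP[-> _] := hb i.
apply: eU; rewrite ball_rV_box// => i; have := yab i; rewrite !mxE !in_itv/= => /andP[h1 h2].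
have /andP[h3 _] := ha i; have /andP[_ h4] := hb i.
by rewrite (lt_le_trans h3 h1) (le_lt_trans h2 h4).
Qed.

(** Open boxes are stable under intersection, so this presentation of the sigma-algebra suits the
    Dynkin argument in [integral_in_box_eq0]. *)
Lemma measurable_rV_generated n : @measurable _ 'rV[R]_n =
  <<s [set B | exists a b : 'rV[R]_n,
     B = [set x : 'rV[R]_n | forall i, x ord0 i \in `]a ord0 i, b ord0 i[]] >>.
Proof.
apply/seteqP; split; last first.
  apply: smallest_sub; first exact: sigma_algebra_measurable.
  by move=> _ [a [b ->]]; exact: box_rV_measurable.
apply: smallest_sub; first exact: smallest_sigma_algebra.
set G := (X in <<s X >>); move=> U /open_bigcup_box ->.
suff : @measurable _ (g_sigma_algebraType G) (\bigcup_(ab in [set ab : 'rV[rat]_n * 'rV[rat]_n |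
      [set x : 'rV[R]_n | forall i, x ord0 i \in `[(ratr (ab.1 ord0 i)), (ratr (ab.2 ord0 i))]] `<=` U])
    [set x : 'rV[R]_n | forall i, x ord0 i \in `](ratr (ab.1 ord0 i)), (ratr (ab.2 ord0 i))[]) by [].
rewrite bigcup_mkcond; apply: countable_bigcupT_measurable => [|[a b]]; first exact: countableP.
case: ifPn => _; last exact: measurable0.
 apply: sub_sigma_algebra.
by exists (map_mx ratr a), (map_mx ratr b); apply/seteqP; split=> x h i; have := h i; rewrite !mxE.
Qed.

End lebesgue_rV_theory.

(** * Inequalities for the p-energy, 1 < p <= 2 *)

Section scalar_inequalities.
Context {R : realType}.
Implicit Types (p q x y r s t K D : R).

(** Young's inequality for the product of x^q and 1, with the exponents 1/q and 1/(1 - q). *)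
Lemma bernoulli_powR q x : 0 <= x -> 0 < q <= 1 -> x `^ q <= 1 + q * (x - 1).
Proof.
move=> x0 /andP[q0]; rewrite le_eqVlt => /predU1P[->|q1].
  by rewrite powRr1//; lra.
have q1' : 0 < 1 - q by lra.
have := @conjugate_powR R (x `^ q) 1 q^-1 (1 - q)^-1 (powR_ge0 _ _) ler01.
rewrite !invr_gt0 !invrK => /(_ q0 q1'); rewrite -powRrM mulfV ?gt_eqF// powRr1//.
rewrite powR1 mulr1 mul1r => h; apply: le_trans (h _) _; last by rewrite le_eqVlt; apply/orP; left; apply/eqP; ring.
by rewrite addrC subrK.
Qed.

Lemma powRS x p : 0 <= x -> 0 < p -> x `^ p = x `^ (p - 1) * x.
Proof. by move=> x0 p0; rewrite mulrC mulr_powRB1. Qed.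

Lemma powRS1 x p : 0 <= x -> 1 < p -> x `^ (p - 1) = x `^ (p - 2) * x.
Proof.
move=> x0 p1; rewrite [LHS]powRS ?subr_gt0//.
by rewrite (_ : p - 1 - 1 = p - 2)//; ring.
Qed.

Lemma powRS2 x p : 0 <= x -> 1 < p -> x `^ p = x `^ (p - 2) * x ^+ 2.
Proof.
move=> x0 p1; rewrite (powRS x0) ?(lt_trans _ p1)// (powRS x0) ?subr_gt0//.
by rewrite (_ : p - 1 - 1 = p - 2); [rewrite -mulrA|ring].
Qed.

Lemma le_powRN p x y : p <= 0 -> 0 < x <= y -> y `^ p <= x `^ p.
Proof.
move=> p0 /andP[x0 xy]; have y0 := lt_le_trans x0 xy.
move: p0; rewrite -(opprK p) oppr_le0; move: (- p) => q q0.
rewrite !powRN lef_pV2 ?posrE ?powR_gt0//.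
by apply: ge0_ler_powR => //; rewrite ?nnegrE ltW.
Qed.

Lemma is_derive_eqfun (f g : R -> R) x df dg : f =1 g -> df = dg ->
  is_derive x 1 f df -> is_derive x 1 g dg.
Proof. by move=> /funext -> ->. Qed.

(* On [0, K], s^p / p - (p - 1) / 2 * K^(p-2) * s^2 is convex. *)
Lemma powR_strong_convex p K r s : 1 < p <= 2 -> 0 <= r <= K -> 0 <= s <= K ->
  r `^ p / p + r `^ (p - 1) * (s - r) + (p - 1) / 2 * K `^ (p - 2) * (s - r) ^+ 2
    <= s `^ p / p.
Proof.
move=> /andP[p1 p2] /andP[r0 rK] /andP[s0 sK].
have p0 : 0 < p by lra.
set c := K `^ (p - 2).
have c0 : 0 <= c by exact: powR_ge0.
have cle x : 0 <= x <= K -> c * x ^+ 2 <= x `^ p.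
  move=> /andP[]; rewrite le_eqVlt => /predU1P[<-|x0 xK].
    by rewrite expr0n/= mulr0 powR_ge0.
  rewrite (powRS2 (ltW x0) p1) ler_wpM2r ?sqr_ge0//; apply: le_powRN; first lra.
  by rewrite x0.
have pi : 2^-1 <= p^-1 by rewrite lef_pV2 ?posrE.
have ppi : p * p^-1 = 1 by rewrite mulfV// gt_eqF.
(* Powers are differentiated at positive points, so r = 0 and s = 0 are settled by hand first. *)
move: r0; rewrite le_eqVlt => /predU1P[r0|r0].
  rewrite -r0 !powR0 ?gt_eqF ?subr_gt0// !mul0r !add0r subr0.
  have := cle s; rewrite s0 sK => /(_ isT) h.
  have s2 : 0 <= s ^+ 2 by exact: sqr_ge0.
  have : 0 <= c * s ^+ 2 by exact: mulr_ge0.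
  set X := c * _ in h * => X0; rewrite -mulrA -/X.
  apply: (@le_trans _ _ (X / p)); last by rewrite ler_pM2r ?invr_gt0.
  by rewrite mulrC ler_wpM2l//; lra.
move: s0; rewrite le_eqVlt => /predU1P[s0|s0].
  rewrite -s0 powR0 ?gt_eqF// mul0r sub0r sqrrN mulrN -(powRS (ltW r0) p0).
  have := cle r; rewrite (ltW r0) rK => /(_ isT).
  rewrite -mulrA -/c; set X := c * _ => h.
  have h1 : 0 <= (r `^ p - X) * (p - 1) by rewrite mulr_ge0 ?subr_ge0//; lra.
  have h2 : 0 <= r `^ p * ((p^-1 - 2^-1) * (p - 1)).
    by rewrite mulr_ge0 ?powR_ge0// mulr_ge0//; lra.
  have h3 : r `^ p * (p * p^-1) = r `^ p by rewrite ppi mulr1.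
  nra.
have [->|rs] := eqVneq s r; first by rewrite subrr expr0n/= !mulr0 !addr0.
pose f x := x `^ p / p - (p - 1) / 2 * c * x ^+ 2.
pose df x := x `^ (p - 1) - (p - 1) * c * x.
have fdf x : 0 < x -> is_derive x 1 f (df x).
  move=> x0; rewrite /f /df.
  have h1 := @is_derive1_powR R p x x0.
  have h2 := is_deriveX 2 (@is_derive_id R R^o x 1).
  apply: is_derive_eqfun (is_deriveB (is_deriveZ p^-1 h1) (is_deriveZ ((p - 1) / 2 * c) h2)).
    by move=> y; congr (_ - _); exact: mulrC.
  by rewrite /GRing.scale/= expr1; field; rewrite gt_eqF.
(* With u = x / y, Bernoulli's inequality for u^(p-1) gives y^(p-1) - x^(p-1) >= (p-1) y^(p-2) (y -
   x), and y^(p-2) >= K^(p-2) since y <= K. *)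
have dfm x y : 0 < x -> x <= y -> y <= K -> df x <= df y.
  move=> x0 xy yK; have y0 := lt_le_trans x0 xy; rewrite /df.
  pose u := x / y.
  have u0 : 0 <= u by rewrite divr_ge0// ltW.
  have u1 : u <= 1 by rewrite ler_pdivrMr// mul1r.
  have xE : x = u * y by rewrite divfK// gt_eqF.
  have := @bernoulli_powR (p - 1) u u0.
  rewrite subr_gt0 p1 lerBlDr => /(_ p2).
  rewrite xE (powRM _ u0 (ltW y0)).
  have cB : c * y <= y `^ (p - 1).
    rewrite (powRS (ltW y0)) ?subr_gt0// (_ : p - 1 - 1 = p - 2); last ring.
    by rewrite ler_pM2r//; apply: le_powRN; [lra|rewrite y0].
  have : 0 <= y `^ (p - 1) by exact: powR_ge0.
  set U := u `^ _; set B := y `^ _ in cB * => B0 h.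
  have h1 : 0 <= (1 + (p - 1) * (u - 1) - U) * B by rewrite mulr_ge0// subr_ge0.
  have h2 : 0 <= (p - 1) * ((1 - u) * (B - c * y)).
    by rewrite mulr_ge0//; [lra|rewrite mulr_ge0// subr_ge0].
  lra.
have key : df r * (s - r) <= f s - f r.
  have itv_cts x y : 0 < x -> {within `[x, y], continuous f}.
    move=> x0; apply: derivable_within_continuous => z; rewrite in_itv/= => /andP[xz _].
    by case: (fdf z (lt_le_trans x0 xz)).
  have oo_der x y z : 0 < x -> z \in `]x, y[ -> is_derive z 1 f (df z).
    by rewrite in_itv/= => x0 /andP[xz _]; apply: fdf; exact: lt_trans xz.
  have [h|h] := ltP r s.
    have [z] := MVT h (oo_der r s ^~ r0) (itv_cts _ _ r0).
    rewrite in_itv/= => /andP[rz zs] ->; rewrite ler_pM2r ?subr_gt0//.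
    by apply: dfm => //; rewrite ltW// (lt_le_trans zs).
  have {}h : s < r by rewrite lt_neqAle rs.
  have [z] := MVT h (oo_der s r ^~ s0) (itv_cts _ _ s0).
  rewrite in_itv/= => /andP[rz zs] e.
  rewrite -(opprB (f r)) e -mulrN opprB ler_nM2r ?subr_lt0//.
  by apply: (dfm z r (lt_trans s0 rz) (ltW zs) rK).
by move: key; rewrite /f /df; lra.
Qed.

(** Stands in for Hoelder's inequality between D^p and the weighted square K^(p-2) D^2. If D <= s K
    the first term suffices; otherwise D^(p-2) <= (s K)^(p-2), because p - 2 <= 0. *)
Lemma powR_split_p p K D s : 1 < p <= 2 -> 0 < s -> 0 <= D <= K ->
  D `^ p <= s `^ p * K `^ p + s `^ (p - 2) * (K `^ (p - 2) * D ^+ 2).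
Proof.
move=> /andP[p1 p2] s0 /andP[D0 DK]; have K0 := le_trans D0 DK.
have [h|h] := leP D (s * K).
  rewrite -(powRM _ (ltW s0) K0); apply: ler_wpDr; last first.
    by apply: ge0_ler_powR => //; rewrite ?nnegrE ?mulr_ge0//; lra.
  by rewrite !mulr_ge0 ?powR_ge0 ?sqr_ge0.
apply: ler_wpDl; first by rewrite mulr_ge0 ?powR_ge0.
have Dp : 0 < D by rewrite (le_lt_trans _ h)// mulr_ge0// ltW.
rewrite mulrA -(powRM _ (ltW s0) K0) (powRS2 D0 p1) ler_wpM2r ?sqr_ge0//.
apply: le_powRN; first lra.
by rewrite mulr_gt0//= ?ltW// (lt_le_trans Dp).
Qed.

(** Arithmetic-geometric mean inequality for s K^(2-p) and K^(p-2) D^2 / (4 s), whose product is D^2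
    / 4. *)
Lemma powR_split_1 p K D s : 1 < p <= 2 -> 0 < s -> 0 <= D <= K ->
  D <= s * K `^ (2 - p) + K `^ (p - 2) * D ^+ 2 / (4 * s).
Proof.
move=> /andP[p1 p2] s0 /andP[D0 DK].
have [K0|K0] := ltP 0 K; last first.
  by rewrite (le_trans (le_trans DK K0))// addr_ge0 ?divr_ge0 ?mulr_ge0 ?powR_ge0 ?sqr_ge0// ltW.
rewrite -(opprB p 2) powRN; set c := K `^ _.
have c0 : 0 < c by exact: powR_gt0.
rewrite -subr_ge0 [X in 0 <= X](_ : _ = (2 * s - c * D) ^+ 2 / (4 * s * c)).
  by rewrite divr_ge0 ?sqr_ge0// !mulr_ge0// ltW.
by field; rewrite !gt_eqF.
Qed.

(** Serves to integrate K^(2-p) over a level set: values of K below t are charged to the measure of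
    the set, values above t to the energy. *)
Lemma powR_split_2p p K t : 1 < p <= 2 -> 0 < t -> 0 <= K ->
  K `^ (2 - p) <= t `^ (2 - p) + t `^ (2 - 2 * p) * K `^ p.
Proof.
move=> /andP[p1 p2] t0 K0; have [h|h] := leP K t.
  apply: ler_wpDr; first by rewrite mulr_ge0 ?powR_ge0.
  by apply: ge0_ler_powR => //; rewrite ?nnegrE//; lra.
have Kp := lt_trans t0 h.
apply: ler_wpDl; first exact: powR_ge0.
rewrite (_ : 2 - p = (2 - 2 * p) + p); last ring.
rewrite powRD; last by rewrite implybE (gt_eqF Kp) orbT.
rewrite ler_wpM2r ?powR_ge0//; apply: le_powRN; first lra.
by rewrite t0 ltW.
Qed.

(** On a set of finite measure this bounds the L^1 norm by the energy; a small t makes the first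
    term small, a large t the second. *)
Lemma le_powR_p p x t : 1 < p -> 0 < t -> 0 <= x ->
  x <= t + t `^ (1 - p) * x `^ p.
Proof.
move=> p1 t0 x0; have [h|h] := leP x t.
  by apply: ler_wpDr => //; rewrite mulr_ge0 ?powR_ge0.
have xp := lt_trans t0 h.
apply: ler_wpDl; first exact: ltW.
rewrite -[X in X <= _]powRr1// [X in x `^ X <= _](_ : _ = (1 - p) + p); last ring.
rewrite powRD; last by rewrite implybE (gt_eqF xp) orbT.
rewrite ler_wpM2r ?powR_ge0//; apply: le_powRN; first lra.
by rewrite t0 ltW.
Qed.

(** Depending on whether t y <= x or not, one of the two terms alone suffices, so no conjugate
    exponent appears. *)
Lemma powR_young p x y t : 1 < p -> 0 < t -> 0 <= x -> 0 <= y ->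
  x `^ (p - 1) * y <= t^-1 * x `^ p + t `^ (p - 1) * y `^ p.
Proof.
move=> p1 t0 x0 y0; have p0 : 0 < p by lra.
have [h|h] := leP (t * y) x.
  apply: ler_wpDr; first by rewrite mulr_ge0 ?powR_ge0.
  rewrite (powRS x0 p0) mulrCA ler_wpM2l ?powR_ge0//.
  by rewrite mulrC ler_pdivlMr// mulrC.
apply: ler_wpDl; first by rewrite mulr_ge0 ?powR_ge0 ?invr_ge0 ?(ltW t0).
rewrite (powRS y0 p0) mulrA ler_wpM2r// -(powRM _ (ltW t0) y0).
by apply: ge0_ler_powR; rewrite ?nnegrE ?mulr_ge0// ltW// subr_gt0.
Qed.

Lemma powR_addl p x y : 1 < p <= 2 -> 0 <= x -> 0 <= y ->
  (x + y) `^ p <= 4 * (x `^ p + y `^ p).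
Proof.
move=> /andP[p1 p2]; wlog xy : x y / x <= y => [H|x0 y0].
  move=> x0 y0; have [/H|/ltW/H h] := leP x y; first exact.
  by rewrite addrC [X in _ * X]addrC h.
apply: (@le_trans _ _ ((2 * y) `^ p)).
  by apply: ge0_ler_powR; rewrite ?nnegrE ?addr_ge0 ?mulr_ge0//; lra.
rewrite powRM//; apply: ler_pM; rewrite ?powR_ge0//.
  apply: (@le_trans _ _ (2 `^ 2)); last by rewrite (powR_mulrn 2)//; lra.
  by apply: ler_powR => //; lra.
by rewrite lerDr powR_ge0.
Qed.

End scalar_inequalities.

(** * Euclidean geometry of row vectors and the flux map *)

Section vectors.
Context {R : realType} {n : nat}.
Implicit Types (x y z : 'rV[R]_n) (a p : R).

Lemma dotC x y : dot x y = dot y x.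
Proof. by apply: eq_bigr => j _; rewrite mulrC. Qed.

Lemma dotDl x y z : dot (x + y) z = dot x z + dot y z.
Proof. by rewrite -big_split; apply: eq_bigr => j _; rewrite mxE mulrDl. Qed.

Lemma dotZl a x y : dot (a *: x) y = a * dot x y.
Proof. by rewrite /dot mulr_sumr; apply: eq_bigr => j _; rewrite mxE mulrA. Qed.

Lemma dotNl x y : dot (- x) y = - dot x y.
Proof. by rewrite -scaleN1r dotZl mulN1r. Qed.

Lemma dotBl x y z : dot (x - y) z = dot x z - dot y z.
Proof. by rewrite dotDl dotNl. Qed.

Lemma dotDr x y z : dot z (x + y) = dot z x + dot z y.
Proof. by rewrite dotC dotDl !(dotC z). Qed.

Lemma dotZr a x y : dot x (a *: y) = a * dot x y.
Proof. by rewrite dotC dotZl dotC. Qed.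

Lemma dotBr x y z : dot z (x - y) = dot z x - dot z y.
Proof. by rewrite dotC dotBl !(dotC z). Qed.

Lemma dot0l x : dot 0 x = 0.
Proof. by rewrite -(scale0r 0) dotZl mul0r. Qed.

Lemma dot0r x : dot x 0 = 0.
Proof. by rewrite dotC dot0l. Qed.

Lemma dot_ge0 x : 0 <= dot x x.
Proof. by apply: sumr_ge0 => j _; rewrite -expr2 sqr_ge0. Qed.

Lemma enorm_ge0 x : 0 <= enorm x.
Proof. exact: sqrtr_ge0. Qed.

Lemma sqr_enorm x : enorm x ^+ 2 = dot x x.
Proof. by rewrite sqr_sqrtr// dot_ge0. Qed.

Lemma enorm0 : enorm (0 : 'rV[R]_n) = 0.
Proof. by rewrite /enorm dot0l sqrtr0. Qed.

Lemma entry_le_enorm x j : `|x ord0 j| <= enorm x.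
Proof.
rewrite -sqrtr_sqr /enorm ler_wsqrtr// /dot (bigD1 j)//= -expr2 lerDl.
by apply: sumr_ge0 => i _; rewrite -expr2 sqr_ge0.
Qed.

Lemma enorm_eq0 x : enorm x = 0 -> x = 0.
Proof.
move=> x0; apply/rowP => j; rewrite mxE; apply/eqP; rewrite -normr_le0 -x0.
exact: entry_le_enorm.
Qed.

Lemma cauchy_schwarz x y : `|dot x y| <= enorm x * enorm y.
Proof.
have [y0|y0] := eqVneq (dot y y) 0.
  have -> : y = 0 by apply: enorm_eq0; rewrite /enorm y0 sqrtr0.
  by rewrite dot0r normr0 mulr_ge0 ?enorm_ge0.
have yy : 0 < dot y y by rewrite lt_neqAle eq_sym y0 dot_ge0.
rewrite -(@ler_pXn2r _ 2) ?nnegrE ?mulr_ge0 ?enorm_ge0//.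
rewrite exprMn !sqr_enorm real_normK ?num_real//.
have := dot_ge0 (x - (dot x y / dot y y) *: y).
rewrite dotBl !dotBr !dotZl !dotZr (dotC y x) => h.
have : 0 <= dot y y * (dot x x - dot x y / dot y y * dot x y).
  rewrite mulr_ge0 ?dot_ge0//; apply: le_trans h _.
  by rewrite le_eqVlt; apply/orP; left; apply/eqP; field; rewrite gt_eqF.
rewrite (_ : _ * _ = dot x x * dot y y - dot x y ^+ 2); first by rewrite subr_ge0.
by field; rewrite gt_eqF.
Qed.

Lemma enormD x y : enorm (x + y) <= enorm x + enorm y.
Proof.
rewrite -(@ler_pXn2r _ 2) ?nnegrE ?addr_ge0 ?enorm_ge0//.
rewrite sqr_enorm sqrrD !sqr_enorm dotDl !dotDr (dotC y x).
have := le_trans (ler_norm _) (cauchy_schwarz x y); lra.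
Qed.

Lemma enormZ a x : enorm (a *: x) = `|a| * enorm x.
Proof. by rewrite /enorm dotZl dotZr mulrA -expr2 sqrtrM ?sqr_ge0// sqrtr_sqr. Qed.

Lemma enormN x : enorm (- x) = enorm x.
Proof. by rewrite -scaleN1r enormZ normrN1 mul1r. Qed.

Lemma enormB x y : enorm (x - y) <= enorm x + enorm y.
Proof. by rewrite (le_trans (enormD _ _))// enormN. Qed.

Lemma enormC x y : enorm (x - y) = enorm (y - x).
Proof. by rewrite -enormN opprB. Qed.

Lemma enorm_le_sum x : enorm x <= \sum_j `|x ord0 j|.
Proof.
have s0 : 0 <= \sum_j `|x ord0 j| by exact: sumr_ge0.
rewrite -(@ler_pXn2r _ 2) ?nnegrE ?enorm_ge0// sqr_enorm expr2 mulr_sumr.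
apply: ler_sum => j _; rewrite (le_trans (ler_norm _))// normrM.
by rewrite ler_wpM2r// (bigD1 j)//= lerDl sumr_ge0.
Qed.

Lemma p_flux0 p : p_flux p (0 : 'rV[R]_n) = 0.
Proof. by rewrite /p_flux scaler0. Qed.

Lemma enorm_p_flux p x : 1 < p -> enorm (p_flux p x) = enorm x `^ (p - 1).
Proof.
move=> p1; rewrite /p_flux enormZ ger0_norm ?powR_ge0//.
by rewrite powRS1 ?enorm_ge0.
Qed.

Lemma dot_p_flux p x : 1 < p -> dot (p_flux p x) x = enorm x `^ p.
Proof. by move=> p1; rewrite /p_flux dotZl -sqr_enorm [RHS](powRS2 (enorm_ge0 x)). Qed.

(* z |-> |z|^p / p - (p - 1) / 2 * K^(p-2) |z|^2 is a convex nondecreasing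
   function of the norm on the ball of radius K = |x| + |z|. *)
Lemma enorm_strong_convex p x z : 1 < p <= 2 ->
  enorm z `^ p / p + dot (p_flux p z) (x - z)
    + (p - 1) / 2 * (enorm x + enorm z) `^ (p - 2) * enorm (x - z) ^+ 2
  <= enorm x `^ p / p.
Proof.
move=> /andP[p1 p2]; set K := enorm x + enorm z.
have xK : 0 <= enorm x <= K by rewrite enorm_ge0 lerDl enorm_ge0.
have zK : 0 <= enorm z <= K by rewrite enorm_ge0 lerDr enorm_ge0.
have p12 : 1 < p <= 2 by rewrite p1.
apply: le_trans (powR_strong_convex p12 zK xK).
rewrite -!addrA lerD2l sqr_enorm dotBl !dotBr (dotC z x) -!sqr_enorm.
rewrite /p_flux !dotZl -sqr_enorm.
have := le_trans (ler_norm _) (cauchy_schwarz z x); rewrite (dotC z x).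
set c := K `^ _.
have [z0|z0] := eqVneq z 0.
  by rewrite z0 dot0r enorm0 => _; rewrite [0 `^ (p - 1)]powR0 ?gt_eqF ?subr_gt0//; lra.
have nz : 0 < enorm z.
  by rewrite lt_neqAle enorm_ge0 andbT eq_sym; apply: contra z0 => /eqP/enorm_eq0 ->.
have cz : c <= enorm z `^ (p - 2).
  by apply: le_powRN; [lra|rewrite nz; case/andP: zK].
have c0 : 0 <= c by exact: powR_ge0.
rewrite (powRS1 (enorm_ge0 z) p1).
move: cz; set r := enorm z; set s := enorm x; set e := r `^ _; set t := dot x z => cz ts.
(* The scalar inequality for the norms misses exactly the Cauchy-Schwarz defect |x| |z| - x.z times
   |z|^(p-2) - (p-1) K^(p-2), and both factors are nonnegative. *)
have h : 0 <= (r * s - t) * (e - (p - 1) * c).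
  rewrite mulr_ge0 ?subr_ge0//; apply: le_trans cz.
  by rewrite -[leRHS]mul1r ler_wpM2r//; lra.
lra.
Qed.

(** Add [enorm_strong_convex] for the pair in both orders: the energies cancel and each order
    contributes half of the factor p - 1. *)
Lemma p_flux_monotone p x z : 1 < p <= 2 ->
  (p - 1) * ((enorm x + enorm z) `^ (p - 2) * enorm (x - z) ^+ 2)
  <= dot (p_flux p x - p_flux p z) (x - z).
Proof.
move=> p12; have := enorm_strong_convex x z p12; have := enorm_strong_convex z x p12.
rewrite (enormC z x) (addrC (enorm z)) -(opprB x z) dotC dotNl dotC dotBl; lra.
Qed.

(** For |z| <= |x| the difference is |x|^(p-2) (x - z) plus a multiple of z. The first part costs 2
    |x - z|^(p-1), because |x - z| <= 2 |x|, and the second |x - z|^(p-1), because |x| - |z| <= |x -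
    z|. *)
Lemma p_flux_hoelder p x z : 1 < p <= 2 ->
  enorm (p_flux p x - p_flux p z) <= 3 * enorm (x - z) `^ (p - 1).
Proof.
wlog zx : x z / enorm z <= enorm x => [H p12|/andP[p1 p2]].
  have [/H|/ltW/H h] := leP (enorm z) (enorm x); first exact.
  by rewrite enormC (enormC x); exact: h.
have p10 : 0 <= p - 1 by lra.
have p20 : p - 2 <= 0 by lra.
have [z0|z0] := eqVneq z 0.
  rewrite z0 p_flux0 !subr0 enorm_p_flux//.
  have := powR_ge0 (enorm x) (p - 1); lra.
have nz : 0 < enorm z.
  by rewrite lt_neqAle enorm_ge0 andbT eq_sym; apply: contra z0 => /eqP/enorm_eq0 ->.
have nx := lt_le_trans nz zx.
have [xz|xz] := eqVneq (x - z) 0.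
  have -> : x = z by apply/eqP; rewrite -subr_eq0 xz.
  by rewrite !subrr enorm0 mulr_ge0 ?powR_ge0.
have nxz : 0 < enorm (x - z).
  by rewrite lt_neqAle enorm_ge0 andbT eq_sym; apply: contra xz => /eqP/enorm_eq0 ->.
have -> : p_flux p x - p_flux p z =
    enorm x `^ (p - 2) *: (x - z) + (enorm x `^ (p - 2) - enorm z `^ (p - 2)) *: z.
  by rewrite /p_flux scalerBr scalerBl addrA subrK.
apply: le_trans (enormD _ _) _; rewrite !enormZ ger0_norm ?powR_ge0//.
have ez : enorm x `^ (p - 2) <= enorm z `^ (p - 2).
  by apply: le_powRN => //; rewrite nz.
rewrite ler0_norm ?subr_le0// opprB mulrBl.
have A1 : enorm x `^ (p - 2) * enorm (x - z) <= 2 * enorm (x - z) `^ (p - 1).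
  have le2 : enorm (x - z) / 2 <= enorm x.
    by rewrite ler_pdivrMr//; have := enormB x z; lra.
  apply: (@le_trans _ _ ((enorm (x - z) / 2) `^ (p - 2) * enorm (x - z))).
    rewrite ler_wpM2r ?enorm_ge0//; apply: le_powRN => //.
    by rewrite divr_gt0.
  rewrite (powRM _ (ltW nxz)) ?invr_ge0// mulrAC.
  rewrite [X in _ <= _ * X](powRS1 (ltW nxz) p1) [leLHS]mulrC ler_wpM2r//.
    by rewrite mulr_ge0 ?powR_ge0// ltW.
  rewrite -powR_inv1// -powRrM mulN1r opprB.
  apply: (@le_trans _ _ (2 `^ 1)); last by rewrite powRr1.
  by apply: ler_powR; move: p1; clear; lra.
have A2 : enorm z `^ (p - 2) * enorm z - enorm x `^ (p - 2) * enorm z <=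
    enorm (x - z) `^ (p - 1).
  rewrite -(powRS1 (enorm_ge0 z) p1).
  have h1 : enorm z `^ (p - 1) <= enorm x `^ (p - 1).
    by apply: ge0_ler_powR; rewrite ?nnegrE ?enorm_ge0.
  have h2 : enorm x - enorm z <= enorm (x - z).
    by rewrite lerBlDr (le_trans _ (enormD _ _))// subrK.
  rewrite (powRS1 (enorm_ge0 x) p1) in h1.
  apply: (@le_trans _ _ (enorm x `^ (p - 2) * (enorm x - enorm z))); first by move: h1; clear; lra.
  have [->|d0] := eqVneq (enorm x - enorm z) 0; first by rewrite mulr0 powR_ge0.
  have dp : 0 < enorm x - enorm z by rewrite lt_neqAle eq_sym d0 subr_ge0.
  apply: (@le_trans _ _ ((enorm x - enorm z) `^ (p - 1))); last first.
    by apply: ge0_ler_powR; rewrite ?nnegrE ?enorm_ge0 ?(ltW dp).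
  rewrite [leRHS](powRS1 (ltW dp) p1) ler_wpM2r ?(ltW dp)//.
  by apply: le_powRN => //; rewrite dp/= gerBl enorm_ge0.
by move: A1 A2; clear; lra.
Qed.

End vectors.

(** * Smooth functions and test functions *)

Section smooth_functions.
Context {R : realType} {N : nat}.
Local Notation E := 'rV[R]_N.
Implicit Types (f g : E -> R) (j : 'I_N) (x : E).

(** [smooth] speaks of all iterated partial derivatives. Once the partial derivatives of the
    functions in B are generated by B, the whole algebra is closed under [partial]; sums, products
    and compositions are all treated by a suitable B. *)
Inductive generated (B : set (E -> R)) : (E -> R) -> Prop :=
| gen_base f : B f -> generated B f
| gen_cst c : generated B (cst c)
| gen_add f g : generated B f -> generated B g -> generated B (f + g)
| gen_mul f g : generated B f -> generated B g -> generated B (f * g).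

Lemma partialD j f g : (forall x, differentiable f x) -> (forall x, differentiable g x) ->
  partial j (f + g) = partial j f + partial j g.
Proof.
by move=> df dg; apply/funext => x; rewrite /partial deriveD//; exact: diff_derivable.
Qed.

Lemma partialM j f g : (forall x, differentiable f x) -> (forall x, differentiable g x) ->
  partial j (f * g) = f * partial j g + g * partial j f.
Proof.
by move=> df dg; apply/funext => x; rewrite /partial deriveM//; exact: diff_derivable.
Qed.

Lemma partial_cst j (c : R) : partial j (cst c : E -> R) = cst 0.
Proof. by apply/funext => x; exact: derive_cst. Qed.

Lemma partialZ j (c : R) f : (forall x, differentiable f x) ->
  partial j (fun x => c * f x) = fun x => c * partial j f x.
Proof.
move=> df; apply/funext => x.
by rewrite /partial (deriveZ c (diff_derivable (df x))).
Qed.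

Lemma partial_comp (t : R -> R) (t' : R) j f x : differentiable f x ->
  is_derive (f x) 1 t t' -> partial j (t \o f) x = t' * partial j f x.
Proof.
move=> df [dt <-].
have dt' : differentiable t (f x) by apply/derivable1_diffP.
rewrite /partial !deriveE//; last exact: differentiable_comp.
by rewrite diff_comp//= deriv1E// /GRing.scale/= mul1r mulrC.
Qed.

Lemma generated_smooth (B : set (E -> R)) :
  (forall f, B f -> (forall x, differentiable f x) /\
    forall j, generated B (partial j f)) ->
  forall f, generated B f -> smooth f.
Proof.
move=> HB.
have H f : generated B f -> (forall x, differentiable f x) /\
    forall j, generated B (partial j f).
  elim => [g /HB//|c|g h Bg [dg pg] Bh [dh ph]|g h Bg [dg pg] Bh [dh ph]].
  - by split => [x|j]; [exact: differentiable_cst|rewrite partial_cst; exact: gen_cst].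
  - split => [x|j]; first exact: differentiableD.
    by rewrite partialD//; exact: gen_add.
  - split => [x|j]; first exact: differentiableM.
    by rewrite partialM//; apply: gen_add; apply: gen_mul.
move=> f Bf s; have : generated B (foldr partial f s).
  by elim: s => //= j s /H[_]; exact.
by case/H.
Qed.

Lemma smooth_differentiable f : smooth f -> forall x, differentiable f x.
Proof. by move=> sf x; exact: (sf [::]). Qed.

Lemma smooth_partial j f : smooth f -> smooth (partial j f).
Proof. by move=> sf s x; have := sf (rcons s j) x; rewrite foldr_rcons. Qed.

Let smooth_gen f : generated (@smooth R N) f -> smooth f.
Proof.
apply: generated_smooth => {}f sf; split=> [|j]; first exact: smooth_differentiable.
exact/gen_base/smooth_partial.
Qed.

Lemma smooth_cst (c : R) : smooth (cst c : E -> R).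
Proof. exact/smooth_gen/gen_cst. Qed.

Lemma smoothD f g : smooth f -> smooth g -> smooth (f + g).
Proof. by move=> sf sg; apply: smooth_gen; apply: gen_add; exact: gen_base. Qed.

Lemma smoothM f g : smooth f -> smooth g -> smooth (f * g).
Proof. by move=> sf sg; apply: smooth_gen; apply: gen_mul; exact: gen_base. Qed.

Lemma smooth_prod (I : Type) (r : seq I) (F : I -> E -> R) :
  (forall i, smooth (F i)) -> smooth (\prod_(i <- r) F i).
Proof.
move=> sF; elim/big_ind : _ => //; first exact: smooth_cst.
exact: smoothM.
Qed.

Lemma smooth_coord i : smooth (fun x : E => x ord0 i).
Proof.
apply: (@generated_smooth [set f | exists i, f = fun x : E => x ord0 i]).
  move=> _ [{}i ->]; split=> [x|j]; first exact: differentiable_coord.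
  rewrite (_ : partial _ _ = cst ((i == j)%:R)); first exact: gen_cst.
  apply/funext => x; rewrite /partial.
  have := @derive_mx R E 1 N id x (delta_mx ord0 j) (@derivable_id _ _ _ _).
  by rewrite derive_id => /matrixP/(_ ord0 i); rewrite !mxE eqxx.
by apply: gen_base; exists i.
Qed.

(** The outer function comes with the sequence of its derivatives: by the chain rule the functions
    [t n \o f] and the smooth functions together generate an algebra closed under [partial]. *)
Lemma smooth_comp (t : nat -> R -> R) f :
  (forall n (s : R), is_derive s 1 (t n) (t n.+1 s)) -> smooth f -> smooth (t 0%N \o f).
Proof.
move=> dt sf; pose B := [set g | smooth g \/ exists n, g = t n \o f].
apply: (@generated_smooth B); last by apply: gen_base; right; exists 0%N.
move=> g [sg|[n ->]].
  split=> [|j]; first exact: smooth_differentiable.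
  by apply: gen_base; left; exact: smooth_partial.
have df := smooth_differentiable sf.
split=> [x|j].
  apply: differentiable_comp => //; apply/derivable1_diffP.
  by case: (dt n (f x)).
rewrite (_ : partial _ _ = (t n.+1 \o f) * partial j f).
  apply: gen_mul; apply: gen_base; first by right; exists n.+1.
  by left; exact: smooth_partial.
by apply/funext => x; rewrite (partial_comp _ (df x) (dt n (f x))).
Qed.

Lemma smooth_continuous f : smooth f -> continuous f.
Proof. by move=> sf x; apply: differentiable_continuous; exact: smooth_differentiable. Qed.

End smooth_functions.

(** * Smooth functions built from exp (- 1 / s) *)

Section exp_inverse.
Context {R : realType}.
Implicit Types (P : {poly R}) (s y : R).

(** The polynomial factor in 1/s makes the family closed under differentiation: P becomes X^2 (P -
    P'). *)
Definition exp_inv P s : R := if 0 < s then P.[s^-1] * expR (- s^-1) else 0.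

Lemma exprn_expRN n y : 0 <= y -> y ^+ n * expR (- y) <= n`!%:R.
Proof.
move=> y0; rewrite expRN ler_pdivrMr ?expR_gt0//.
case: n => [|n]; first by rewrite expr0 fact0 mul1r -expR0 ler_expR.
have := expR_ge1Dxn n y0.
have f0 : 0 < n.+1`!%:R :> R by rewrite ltr0n fact_gt0.
move=> h; rewrite mulrC -ler_pdivrMr//; apply: le_trans h.
by rewrite lerDr.
Qed.

Lemma exp_inv_bounded P : exists2 C : R, 0 <= C & forall s, `|exp_inv P s| <= C.
Proof.
exists (\sum_(i < size P) `|P`_i| * i`!%:R).
  by apply: sumr_ge0 => i _; rewrite mulr_ge0.
move=> s; rewrite /exp_inv; case: ifPn => s0; last first.
  by rewrite normr0; apply: sumr_ge0 => i _; rewrite mulr_ge0.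
have y0 : 0 <= s^-1 by rewrite invr_ge0 ltW.
rewrite normrM (ger0_norm (expR_ge0 _)) horner_coef.
apply: (@le_trans _ _ ((\sum_(i < size P) `|P`_i| * s^-1 ^+ i) * expR (- s^-1))).
  rewrite ler_wpM2r ?expR_ge0// (le_trans (ler_norm_sum _ _ _))//.
  apply: ler_sum => i _; rewrite normrM (@ger0_norm _ (s^-1 ^+ i))//.
  exact: exprn_ge0.
rewrite mulr_suml; apply: ler_sum => i _; rewrite -mulrA ler_wpM2l//.
exact: exprn_expRN.
Qed.

(** The bound for X^2 P, multiplied by s^2. Quadratic decay at 0 is what makes the extension by 0
    differentiable there. *)
Lemma exp_inv_sqr_bounded P : exists2 C : R, 0 <= C & forall s, `|exp_inv P s| <= C * s ^+ 2.
Proof.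
have [C C0 HC] := exp_inv_bounded ('X^2 * P); exists C => // s.
have := HC s; rewrite /exp_inv; case: ifPn => s0; last first.
  by rewrite normr0 mulr_ge0// sqr_ge0.
rewrite hornerM hornerXn -mulrA normrM ger0_norm ?sqr_ge0// exprVn.
by rewrite mulrC ler_pdivrMr// exprn_gt0.
Qed.

Lemma is_derive_sqr_bound (f : R -> R) (C : R) : f 0 = 0 ->
  (forall s, `|f s| <= C * s ^+ 2) -> is_derive (0 : R) 1 f 0.
Proof.
move=> f0 fC.
have C0 : 0 <= C by have := fC 1; rewrite expr1n mulr1; apply: le_trans.
have cvg0 : h^-1 *: ((f \o shift 0) (h *: (1 : R)) - f 0) @[h --> 0^'] --> (0 : R).
  apply/cvgr0Pnorm_lt => e e0.
  near=> h; have h0 : h != 0 by near: h; exact: nbhs_dnbhs_neq.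
  rewrite /= addr0 f0 subr0 /GRing.scale/= mulr1 normrM normfV.
  rewrite mulrC ltr_pdivrMr ?normr_gt0//.
  apply: le_lt_trans (fC h) _; rewrite -real_normK ?num_real// expr2 mulrA.
  rewrite ltr_pM2r ?normr_gt0//.
  apply: (@le_lt_trans _ _ ((C + 1) * `|h|)); first by rewrite ler_wpM2r// lerDl.
  rewrite mulrC -ltr_pdivlMr ?ltr_wpDl//.
  near: h; apply: nbhs_dnbhs; apply: (@nbhs0_lt R R^o).
  by rewrite divr_gt0// ltr_wpDl.
split; first by apply/cvg_ex; exists 0.
exact/cvg_lim.
Unshelve. all: by end_near. Qed.

Lemma is_derive_exp_inv P s :
  is_derive s 1 (exp_inv P) (exp_inv ('X^2 * (P - P^`())) s).
Proof.
have [s0|s0|<-] := ltrgtP 0 s.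
- rewrite {2}/exp_inv s0.
  pose f u : R := P.[u^-1] * expR (- u^-1).
  apply: (@near_eq_is_derive _ _ _ f).
    near=> u; rewrite /exp_inv ifT//; near: u; exact: lt_nbhsr.
  have s1 : s != 0 by rewrite gt_eqF.
  have dinv : is_derive s 1 (fun u : R => u^-1) (- s ^- 2).
    apply: is_derive_eqfun (is_deriveV s1 (is_derive_id s 1)) => //.
    by rewrite /GRing.scale/= mulr1.
  have dh : is_derive s 1 (fun u => P.[u^-1]) (P^`().[s^-1] * - s ^- 2).
    exact: (is_derive1_comp (is_derive_poly P s^-1) dinv).
  have de : is_derive s 1 (fun u : R => expR (- u^-1)) (expR (- s^-1) * s ^- 2).
    have dn : is_derive s 1 (fun u : R => - u^-1) (s ^- 2).
      by apply: is_derive_eqfun (is_deriveN dinv) => //; rewrite opprK.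
    exact: (@is_derive1_comp R expR (fun u => - u^-1) s _ _ (is_derive_expR _) dn).
  apply: is_derive_eqfun (is_deriveM dh de) => //.
  rewrite !hornerE /GRing.scale/= exprVn; ring.
- rewrite {2}/exp_inv ltNge (ltW s0)/=.
  have d0 : is_derive s 1 (cst (0 : R)) 0 by exact: is_derive_cst.
  apply: near_eq_is_derive d0.
  near=> u; rewrite /exp_inv ltNge ifN// negbK ltW//; near: u; exact: lt_nbhsl.
- rewrite {2}/exp_inv ltxx; have [C C0 HC] := exp_inv_sqr_bounded P.
  by apply: is_derive_sqr_bound HC; rewrite /exp_inv ltxx.
Unshelve. all: by end_near. Qed.

End exp_inverse.

Section truncation.
Context {R : realType}.
Implicit Types (P : {poly R}) (s t k c e : R).

Let step P : {poly R} := 'X^2 * (P - P^`()).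

Lemma is_derive_affine (f : R -> R) c e s df : is_derive (c * s + e) 1 f df ->
  is_derive s 1 (fun s => f (c * s + e)) (c * df).
Proof.
move=> hf.
have h : is_derive s 1 (fun s : R => c * s + e) c.
  apply: is_derive_eqfun (is_deriveD (is_deriveZ c (is_derive_id s 1)) (is_derive_cst e s 1)) => //.
  by rewrite addr0 /GRing.scale/= mulr1.
apply: is_derive_eqfun (@is_derive1_comp R f (fun s => c * s + e) s _ _ hf h) => //.
exact: mulrC.
Qed.

Definition exp_inv_affine c e n s : R := c ^+ n * exp_inv (iter n step 1) (c * s + e).

Lemma is_derive_exp_inv_affine c e n s :
  is_derive s 1 (exp_inv_affine c e n) (exp_inv_affine c e n.+1 s).
Proof.
have := is_derive_affine (is_derive_exp_inv (iter n step 1) (c * s + e)).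
move=> /(is_deriveZ (c ^+ n)) h; apply: is_derive_eqfun h => //.
by rewrite /exp_inv_affine (exprSr c) -mulrA.
Qed.

Lemma exp_inv1_itv s : 0 <= exp_inv 1 s <= 1.
Proof.
rewrite /exp_inv; case: ifPn => [s0|_]; last by rewrite lexx ler01.
by rewrite hornerC mul1r expR_ge0 expR_le1 oppr_le0 invr_ge0 ltW.
Qed.

Lemma exp_inv1_eq0 s : (exp_inv 1 s == 0) = (s <= 0).
Proof.
rewrite /exp_inv; case: ltP => s0; last by rewrite eqxx.
by rewrite hornerC mul1r gt_eqF ?expR_gt0.
Qed.

(** The successive derivatives of s exp (- 1 / s). The first one is (1 + 1/s) exp (- 1 / s), so the
    family [exp_inv] takes over from there. *)
Definition pre_trunc n s : R :=
  if n is n'.+1 then exp_inv (iter n' step (1 + 'X)) s else s * exp_inv 1 s.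

Lemma is_derive_pre_trunc n s : is_derive s 1 (pre_trunc n) (pre_trunc n.+1 s).
Proof.
case: n => [|n]; last exact: is_derive_exp_inv.
apply: is_derive_eqfun (is_deriveM (is_derive_id s 1) (is_derive_exp_inv 1 s)) => //.
rewrite /= /exp_inv /GRing.scale/= derivC subr0; case: ifPn => s0; last by rewrite mulr0 mul0r addr0.
by rewrite !hornerE /=; set X := expR _; field; exact: lt0r_neq0.
Qed.

(* [trunc k e n] is the [n]-th derivative of [s |-> (s - k) exp (- e / (s - k))],
   a smooth convex minorant of the positive part of [s - k]. *)
Definition trunc k e n s : R := e * e^-1 ^+ n * pre_trunc n (e^-1 * s + - (e^-1 * k)).

Lemma is_derive_trunc k e n s : is_derive s 1 (trunc k e n) (trunc k e n.+1 s).
Proof.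
have := is_derive_affine (is_derive_pre_trunc n (e^-1 * s + - (e^-1 * k))).
move=> /(is_deriveZ (e * e^-1 ^+ n)) h; apply: is_derive_eqfun h => //.
by rewrite /trunc (exprSr e^-1) /GRing.scale/= !mulrA.
Qed.

Lemma trunc0E k e s : 0 < e ->
  trunc k e 0 s = if k < s then (s - k) * expR (- (e / (s - k))) else 0.
Proof.
move=> e0; rewrite /trunc /= /exp_inv expr0 mulr1 -mulrBr pmulr_rgt0 ?invr_gt0// subr_gt0.
case: ifPn => ks; last by rewrite !mulr0.
rewrite hornerC mul1r invfM invrK mulrA mulVKf ?gt_eqF//.
Qed.

Lemma trunc1E k e s : 0 < e ->
  trunc k e 1 s = if k < s then (1 + e / (s - k)) * expR (- (e / (s - k))) else 0.
Proof.
move=> e0; rewrite /trunc /= /exp_inv expr1 divff ?gt_eqF// mul1r -mulrBr.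
rewrite pmulr_rgt0 ?invr_gt0// subr_gt0; case: ifPn => // ks.
by rewrite !hornerE invfM invrK.
Qed.

(** The derivative has the form (1 + y) exp (- y) with y >= 0. Hence truncation does not increase
    gradients. *)
Lemma trunc1_itv k e s : 0 < e -> 0 <= trunc k e 1 s <= 1.
Proof.
move=> e0; rewrite trunc1E//; case: ifPn => ks; last by rewrite lexx ler01.
have y0 : 0 <= e / (s - k) by rewrite divr_ge0 ?subr_ge0 ?ltW.
rewrite mulr_ge0 ?expR_ge0 ?addr_ge0//= expRN ler_pdivrMr ?expR_gt0// mul1r.
exact: expR_ge1Dx.
Qed.

(** From exp (- y) >= 1 - y with y = e / (s - k). This lower bound lets the truncation at k detect
    the level sets above k + e. *)
Lemma trunc0_ge k e s : 0 < e -> s - k - e <= trunc k e 0 s.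
Proof.
move=> e0; rewrite trunc0E//; case: ltP => ks; last by lra.
have d0 : 0 < s - k by rewrite subr_gt0.
have := expR_ge1Dx (- (e / (s - k))); set y := expR _ => h.
have : (s - k) * (1 - e / (s - k)) <= (s - k) * y by rewrite ler_pM2l.
by rewrite mulrBr mulr1 mulrCA divff ?gt_eqF// mulr1.
Qed.

Lemma lipschitz_is_derive (f df : R -> R) (C : R) :
  (forall s, is_derive s 1 f (df s)) -> (forall s, `|df s| <= C) ->
  forall s t, `|f s - f t| <= C * `|s - t|.
Proof.
move=> fdf dfC s t; wlog ts : s t / t <= s => [H|].
  by have [/H//|/ltW/H] := leP t s; rewrite distrC (distrC t).
have cf : {within `[t, s], continuous f}.
  by apply: derivable_within_continuous => z _; case: (fdf z).
have [z _ ->] := MVT_segment ts (fun x _ => fdf x) cf.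
by rewrite normrM ler_wpM2r.
Qed.

Lemma trunc0_lipschitz k e s t : 0 < e -> `|trunc k e 0 s - trunc k e 0 t| <= `|s - t|.
Proof.
move=> e0; rewrite -[leRHS]mul1r.
apply: (lipschitz_is_derive (is_derive_trunc k e 0)) => u.
by have /andP[u0 u1] := trunc1_itv k u e0; rewrite ger0_norm.
Qed.

Lemma trunc1_lipschitz k e : 0 < e -> exists2 C : R, 0 <= C &
  forall s t, `|trunc k e 1 s - trunc k e 1 t| <= C * `|s - t|.
Proof.
move=> e0; have [C C0 HC] := exp_inv_bounded (step (1 + 'X) : {poly R}).
exists (e * e^-1 ^+ 2 * C); first by rewrite !mulr_ge0 ?exprn_ge0 ?invr_ge0 ?(ltW e0).
apply: (lipschitz_is_derive (is_derive_trunc k e 1)) => u.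
have c0 : 0 <= e * e^-1 ^+ 2 by rewrite mulr_ge0 ?exprn_ge0 ?invr_ge0 ?(ltW e0).
by rewrite /trunc normrM (ger0_norm c0) ler_wpM2l//; exact: HC.
Qed.

End truncation.

(** * Operations on test functions, and bumps on boxes *)

Section test_functions.
Context {R : realType} {N : nat}.
Local Notation E := 'rV[R]_N.
Implicit Types (f g phi : E -> R) (j : 'I_N) (x : E) (Om : set E).

Lemma tsupport_sub f (K : set E) : closed K -> (forall x, f x != 0 -> K x) ->
  tsupport f `<=` K.
Proof. by move=> /closure_id KE fK; rewrite KE; exact: closure_subset. Qed.

Lemma sub_tsupport f x : f x != 0 -> tsupport f x.
Proof. by move=> fx; exact: subset_closure. Qed.

Lemma test_function_sub Om f g : smooth f -> (forall x, f x != 0 -> tsupport g x) ->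
  test_function Om g -> test_function Om f.
Proof.
move=> sf fg [_ cg gO].
have cg' : closed (tsupport g) by exact: closed_closure.
have sub := tsupport_sub cg' fg.
split => //; last exact: subset_trans gO.
exact: subclosed_compact (@closed_closure _ _) cg sub.
Qed.

Lemma test_function_out Om phi x : test_function Om phi -> ~ Om x -> phi x = 0.
Proof.
by move=> [_ _ sO] Ox; apply: contrapT => /eqP/sub_tsupport/sO.
Qed.

Lemma partial_out_tsupport f j x : ~ tsupport f x -> partial j f x = 0.
Proof.
move=> fx; rewrite /partial (@near_eq_derive _ _ _ _ (cst 0)) ?derive_cst//.
  near=> y; apply: contrapT => /eqP/sub_tsupport; near: y.
  apply: open_nbhs_nbhs; split => //; exact/closed_openC/closed_closure.
Unshelve. all: by end_near. Qed.

Lemma test_functionD Om f g : test_function Om f -> test_function Om g ->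
  test_function Om (f + g).
Proof.
move=> [sf cf fO] [sg cg gO].
have sub : tsupport (f + g) `<=` tsupport f `|` tsupport g.
  apply: tsupport_sub => [|x fg]; first by apply: closedU; exact: closed_closure.
  have [f0|f0] := eqVneq (f x) 0; last by left; exact: sub_tsupport.
  right; apply: sub_tsupport; apply: contra fg => /eqP g0.
  by rewrite -[(f + g) x]/(f x + g x) f0 g0 addr0.
split; first exact: smoothD.
  by apply: subclosed_compact (compactU cf cg) sub; exact: closed_closure.
by apply: subset_trans sub _; rewrite subUset.
Qed.

Lemma test_functionM Om f g : test_function Om f -> smooth g -> test_function Om (f * g).
Proof.
move=> tf sg; have [sf _ _] := tf; apply: test_function_sub tf; first exact: smoothM.
move=> x fg; apply: sub_tsupport; apply: contra fg => /eqP f0.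
by rewrite /GRing.mul/= f0 mul0r.
Qed.

Lemma test_functionZ Om c f : test_function Om f -> test_function Om (fun x => c * f x).
Proof.
move=> tf; rewrite (_ : (fun x => c * f x) = f * cst c).
  by apply: test_functionM => //; exact: smooth_cst.
by apply/funext => x; exact: mulrC.
Qed.

Lemma test_function0 Om : test_function Om (cst 0).
Proof.
have ts0 : tsupport (cst 0 : E -> R) = set0.
  by rewrite -subset0; apply: tsupport_sub => [|x]; [exact: closed0|rewrite eqxx].
by split; rewrite ?ts0//; [exact: smooth_cst|exact: compact0].
Qed.

Lemma test_function_partial Om j f : test_function Om f -> test_function Om (partial j f).
Proof.
move=> tf; have [sf _ _] := tf; apply: test_function_sub tf; first exact: smooth_partial.
by move=> x; apply: contra_neqP => /partial_out_tsupport ->.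
Qed.

Lemma test_function_comp Om (t : nat -> R -> R) f :
  (forall n (s : R), is_derive s 1 (t n) (t n.+1 s)) -> t 0%N 0 = 0 ->
  test_function Om f -> test_function Om (t 0%N \o f).
Proof.
move=> dt t0 tf; have [sf _ _] := tf; apply: test_function_sub tf.
  exact: smooth_comp.
move=> x tx; apply: sub_tsupport; apply: contra tx => /eqP f0.
by rewrite /= f0 t0.
Qed.

(** One factor for each face of the box, each of the form exp (- 1 / (n s)) with s the distance to
    the face. As n grows these bumps tend pointwise to the indicator of the open box while staying
    below 1. *)
Definition box_bump (a b : E) (n : nat) : E -> R := \prod_i
  ((fun x => exp_inv 1 (n%:R * x ord0 i + - (n%:R * a ord0 i)))
   * (fun x => exp_inv 1 (- n%:R * x ord0 i + n%:R * b ord0 i))).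

Lemma box_bumpE a b n x : box_bump a b n x = \prod_i
  (exp_inv 1 (n%:R * (x ord0 i - a ord0 i)) * exp_inv 1 (n%:R * (b ord0 i - x ord0 i))).
Proof.
rewrite /box_bump; elim/big_ind2 : _ => // [f r g s <- <- //|i _].
by congr (exp_inv 1 _ * exp_inv 1 _); ring.
Qed.

Lemma box_bump_itv a b n x : 0 <= box_bump a b n x <= 1.
Proof.
rewrite box_bumpE; elim/big_ind : _ => [|r s /andP[r0 r1] /andP[s0 s1]|i _].
- by rewrite ler01 lexx.
- by rewrite mulr_ge0//= mulr_ile1.
- have /andP[? ?] := exp_inv1_itv (n%:R * (x ord0 i - a ord0 i)).
  have /andP[? ?] := exp_inv1_itv (n%:R * (b ord0 i - x ord0 i)).
  by rewrite mulr_ge0//= mulr_ile1.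
Qed.

Lemma smooth_box_bump a b n : smooth (box_bump a b n).
Proof.
apply: smooth_prod => i; apply: smoothM.
  pose t := exp_inv_affine n%:R (- (n%:R * a ord0 i)).
  rewrite (_ : (fun _ => _) = t 0%N \o (fun x => x ord0 i)).
    by apply: smooth_comp; [exact: is_derive_exp_inv_affine|exact: smooth_coord].
  by apply/funext => x; rewrite /= /t /exp_inv_affine expr0 mul1r.
pose t := exp_inv_affine (- n%:R) (n%:R * b ord0 i).
rewrite (_ : (fun _ => _) = t 0%N \o (fun x => x ord0 i)).
  by apply: smooth_comp; [exact: is_derive_exp_inv_affine|exact: smooth_coord].
by apply/funext => x; rewrite /= /t /exp_inv_affine expr0 mul1r.
Qed.

Lemma box_bump_neq0 a b n x : (0 < n)%N -> (box_bump a b n x != 0) =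
  [forall i, x ord0 i \in `]a ord0 i, b ord0 i[].
Proof.
move=> n0; rewrite box_bumpE; apply/idP/forallP => [/prodf_neq0 h i|h].
  have := h i isT; rewrite mulf_eq0 !exp_inv1_eq0 !pmulr_rle0 ?ltr0n//.
  by rewrite !subr_le0 negb_or -!ltNge in_itv.
apply/prodf_neq0 => i _; have := h i; rewrite in_itv/= => /andP[? ?].
by rewrite mulf_eq0 !exp_inv1_eq0 !pmulr_rle0 ?ltr0n// !subr_le0 negb_or -!ltNge; apply/andP.
Qed.

Lemma test_function_box_bump Om (a b : E) n : (0 < n)%N ->
  [set x : E | forall i, x ord0 i \in `[a ord0 i, b ord0 i]] `<=` Om ->
  test_function Om (box_bump a b n).
Proof.
move=> n0 abO; set K := [set x | _] in abO.
have cK : compact K.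
  by apply: (@rV_compact _ _ (fun i => `[a ord0 i, b ord0 i]%classic)) => i; exact: segment_compact.
have clK : closed K by apply: compact_closed => //; exact: norm_hausdorff.
have sub : tsupport (box_bump a b n) `<=` K.
  apply: tsupport_sub => // x; rewrite box_bump_neq0// => /forallP h i.
  exact: subset_itv_oo_cc.
split; first exact: smooth_box_bump.
  exact: subclosed_compact (@closed_closure _ _) cK sub.
exact: subset_trans sub abO.
Qed.

Lemma cvg_exp_inv1 (s : R) : exp_inv 1 (n%:R * s) @[n --> \oo] --> (((0 < s)%R)%:R : R).
Proof.
case: ltP => s0; last first.
  apply: (@cvg_trans _ ((cst (0 : R)) @ \oo)); last exact: cvg_cst.
  apply: near_eq_cvg; near=> n; apply/esym/eqP; rewrite exp_inv1_eq0.
  by rewrite mulr_ge0_le0.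
have h : expR (- (n%:R * s)^-1) @[n --> \oo] --> (1 : R).
  rewrite -[X in _ --> X](@expR0 R); apply: continuous_cvg; first exact: continuous_expR.
  rewrite -oppr0; apply: cvgN.
  apply/cvgr0Pnorm_lt => e e0; near=> n.
  have n0 : 0 < n%:R :> R.
    by rewrite ltr0n; near: n; exists 1%N.
  rewrite ger0_norm ?invr_ge0 ?mulr_ge0 ?ltW// invf_plt ?posrE ?mulr_gt0//.
  rewrite -ltr_pdivrMr//; near: n; exact: nbhs_infty_gtr.
apply: cvg_trans h; apply: near_eq_cvg; near=> n.
have n0 : 0 < n%:R :> R by rewrite ltr0n; near: n; exists 1%N.
by rewrite /exp_inv mulr_gt0// hornerC mul1r.
Unshelve. all: by end_near. Qed.

Lemma cvg_bigprod (I : Type) (r : seq I) (F : I -> nat -> R) (l : I -> R) :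
  (forall i, F i n @[n --> \oo] --> l i) ->
  \prod_(i <- r) F i n @[n --> \oo] --> \prod_(i <- r) l i.
Proof.
move=> Fl; elim: r => [|i r IH].
  rewrite big_nil (_ : (fun n => _) = cst 1); first exact: cvg_cst.
  by apply/funext => n; rewrite big_nil.
rewrite big_cons (_ : (fun n => _) = fun n => F i n * \prod_(j <- r) F j n).
  by apply: cvgM => //; exact: Fl.
by apply/funext => n; rewrite big_cons.
Qed.

Lemma cvg_box_bump (a b : E) x : box_bump a b n x @[n --> \oo] -->
  ([forall i, x ord0 i \in `]a ord0 i, b ord0 i[]%:R : R).
Proof.
under eq_fun do rewrite box_bumpE.
rewrite (_ : _%:R = \prod_i (((0 < x ord0 i - a ord0 i)%R)%:R * ((0 < b ord0 i - x ord0 i)%R)%:R)).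
  by apply: cvg_bigprod => i; apply: cvgM; exact: cvg_exp_inv1.
case: (boolP [forall i, _]) => [/forallP h|].
  rewrite big1// => i _; have := h i; rewrite in_itv/= => /andP[ax xb].
  by rewrite !subr_gt0 ax xb mulr1.
rewrite negb_forall => /existsP[i]; rewrite in_itv/= => h.
rewrite (bigD1 i)//= !subr_gt0; move: h.
by case: (a ord0 i < _); case: (_ < b ord0 i) => //= _; rewrite ?mulr0 !mul0r.
Qed.

End test_functions.

(** * Integral estimates for test functions *)

Section integrable_toolkit.
Context d (T : measurableType d) (R : realType) (mu : {measure set T -> \bar R}).
Variables (D : set T) (mD : measurable D).
Implicit Types (f g : T -> R).
Local Notation L f := (mu.-integrable D (EFin \o f)).
Local Notation I f := (Rintegral mu D f).

Lemma integrable_measurable f : L f -> measurable_fun D f.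
Proof. by move/measurable_int/measurable_EFinP. Qed.

Lemma integrableD_EFin f g : L f -> L g -> L (fun x => f x + g x).
Proof. by move=> Lf Lg; exact: (integrableD mD Lf Lg). Qed.

Lemma integrableB_EFin f g : L f -> L g -> L (fun x => f x - g x).
Proof. by move=> Lf Lg; exact: (integrableB mD Lf Lg). Qed.

Lemma integrableZ_EFin c f : L f -> L (fun x => c * f x).
Proof. by move=> Lf; exact: (integrableZl mD c Lf). Qed.

Lemma integrable_norm_EFin f : L f -> L (fun x => `|f x|).
Proof. by move=> Lf; exact: (integrable_norm Lf). Qed.

Lemma integrable_le f g : measurable_fun D f -> L g ->
  (forall x, D x -> `|f x| <= g x) -> L f.
Proof.
move=> mf Lg fg; apply: le_integrable Lg => //; first exact/measurable_EFinP.
by move=> x Dx; rewrite lee_fin (le_trans (fg x Dx))// ler_norm.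
Qed.

Lemma integrable_eq f g : (forall x, D x -> f x = g x) -> L f -> L g.
Proof.
move=> fg; apply: eq_integrable => // x; rewrite inE => Dx.
by rewrite /= fg.
Qed.

Lemma integrable_cst_EFin c : (mu D < +oo)%E -> L (fun=> c).
Proof.
move=> fD; apply/integrableP; split; first exact: measurable_cst.
rewrite (_ : (\int[mu]_(x in D) _)%E = (\int[mu]_(x in D) cst `|c|%:E x)%E)//.
by rewrite integral_cst// lte_mul_pinfty.
Qed.

Lemma EFin_Rintegral f : L f -> (I f)%:E = (\int[mu]_(x in D) (f x)%:E)%E.
Proof. by move=> Lf; rewrite fineK//; exact: integrable_fin_num. Qed.

Lemma ge0_integrable f : measurable_fun D f -> (forall x, D x -> 0 <= f x) ->
  (\int[mu]_(x in D) (f x)%:E < +oo)%E -> L f.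
Proof.
move=> mf f0 foo; apply/integrableP; split; first exact/measurable_EFinP.
rewrite (_ : (\int[mu]_(x in D) _)%E = (\int[mu]_(x in D) (f x)%:E)%E)//.
by apply: eq_integral => x; rewrite inE => Dx; rewrite /= ger0_norm ?f0.
Qed.

(** Integrate the tangent of s^q at s = |I f|, taken at |f x|: the slope term has nonnegative
    integral because |I f| <= I |f|. The tangent inequality comes from [powR_strong_convex] for q >
    1 and is an identity for q = 1. *)
Lemma jensen_powR q f : mu D = 1%E -> 1 <= q <= 2 -> L f ->
  L (fun x => `|f x| `^ q) -> `|I f| `^ q <= I (fun x => `|f x| `^ q).
Proof.
move=> D1 /andP[q1 q2] Lf Lfq; set a : R := `|I f|.
have fD : (mu D < +oo)%E by rewrite D1 ltry.
have Ln := integrable_norm_EFin Lf.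
have af : a <= I (fun x => `|f x|) by exact: le_normr_Rintegral.
have Lb := integrableB_EFin Ln (integrable_cst_EFin a fD).
have tangent x : a `^ q + q * a `^ (q - 1) * (`|f x| - a) <= `|f x| `^ q.
  move: q1; rewrite le_eqVlt => /predU1P[<-|q1].
    by rewrite subrr powRr0 !powRr1 ?normr_ge0// !mul1r addrC subrK.
  set K := Num.max a `|f x|.
  have q12 : 1 < q <= 2 by rewrite q1.
  have aK : 0 <= a <= K by rewrite normr_ge0/= le_max lexx.
  have fK : 0 <= `|f x| <= K by rewrite normr_ge0/= le_max lexx orbT.
  have := powR_strong_convex q12 aK fK; set Y : R := _ * (_ - _) ^+ 2 => h.
  have q20 : 0 <= (q - 1) / 2 by lra.
  have Y0 : 0 <= Y by rewrite /Y mulr_ge0 ?sqr_ge0// mulr_ge0 ?powR_ge0.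
  have {h} : q * (a `^ q / q + a `^ (q - 1) * (`|f x| - a)) <= q * (`|f x| `^ q / q).
    by rewrite ler_pM2l; lra.
  rewrite mulrDr !(mulrCA q) divff ?mulr1 ?mulrA//; last by rewrite gt_eqF//; lra.
  by rewrite (mulrC _ q).
apply: (@le_trans _ _ (I (fun x => a `^ q + q * a `^ (q - 1) * (`|f x| - a)))); last first.
  apply: le_Rintegral => //; apply: integrableD_EFin; first exact: integrable_cst_EFin.
  exact: integrableZ_EFin.
rewrite RintegralD//; [|exact: integrable_cst_EFin|exact: integrableZ_EFin].
rewrite RintegralZl// RintegralB//; last exact: integrable_cst_EFin.
rewrite !Rintegral_cst// D1/= !mulr1 lerDl mulr_ge0 ?subr_ge0//.
by rewrite mulr_ge0 ?powR_ge0// (le_trans _ q1).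
Qed.

End integrable_toolkit.

Section tonelli_in.
Context d1 d2 (T1 : measurableType d1) (T2 : measurableType d2) (R : realType).
Variables (m1 : {sigma_finite_measure set T1 -> \bar R})
  (m2 : {sigma_finite_measure set T2 -> \bar R}).
Local Open Scope ereal_scope.

Lemma integral_in_indic d (T : measurableType d) (mu : {measure set T -> \bar R})
  (A : set T) (f : T -> \bar R) :
  \int[mu]_(x in A) f x = \int[mu]_x ((\1_A x)%:E * f x).
Proof.
rewrite integral_mkcond; apply: eq_integral => x _; rewrite patchE indicE.
by case: ifP => _; rewrite ?mul1e ?mul0e.
Qed.

Lemma tonelli_in (A : set T1) (B : set T2) (f : T1 * T2 -> \bar R) :
  measurable A -> measurable B -> measurable_fun setT f -> (forall z, 0 <= f z) ->
  \int[m1]_(x in A) \int[m2]_(y in B) f (x, y) =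
  \int[m2]_(y in B) \int[m1]_(x in A) f (x, y).
Proof.
move=> mA mB mf f0.
pose F (z : T1 * T2) := (\1_A z.1)%:E * ((\1_B z.2)%:E * f z).
have i0 d (T : measurableType d) (C : set T) x : 0 <= (\1_C x : R)%:E by rewrite lee_fin.
have mF : measurable_fun setT F.
  apply: emeasurable_funM; last apply: emeasurable_funM => //.
    apply/measurable_EFinP; apply: measurableT_comp; [exact: measurable_indic|exact: measurable_fst].
  apply/measurable_EFinP; apply: measurableT_comp; [exact: measurable_indic|exact: measurable_snd].
have F0 z : 0 <= F z by rewrite !mule_ge0.
have mfx x : measurable_fun setT (fun y => f (x, y)).
  exact: (measurableT_comp mf (measurable_pair1 _)).
have mfy y : measurable_fun setT (fun x => f (x, y)).
  exact: (measurableT_comp mf (measurable_pair2 _)).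
rewrite integral_in_indic; transitivity (\int[m1]_x \int[m2]_y F (x, y)).
  apply: eq_integral => x _; rewrite integral_in_indic -ge0_integralZl//.
    apply: emeasurable_funM => //; apply/measurable_EFinP; exact: measurable_indic.
  by move=> y _; rewrite mule_ge0.
rewrite (fubini_tonelli F mF F0) [RHS]integral_in_indic; apply: eq_integral => y _.
rewrite [in RHS]integral_in_indic -ge0_integralZl//.
- by apply: eq_integral => x _; rewrite /F/= muleCA.
- apply: emeasurable_funM => //; apply/measurable_EFinP; exact: measurable_indic.
- by move=> x _; rewrite mule_ge0.
Qed.

Lemma measurable_tonelli_in (B : set T2) (f : T1 * T2 -> \bar R) :
  measurable B -> measurable_fun setT f -> (forall z, 0 <= f z) ->
  measurable_fun setT (fun x => \int[m2]_(y in B) f (x, y)).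
Proof.
move=> mB mf f0; under eq_fun do rewrite integral_in_indic.
pose F (z : T1 * T2) := (\1_B z.2)%:E * f z.
apply: (@measurable_fun_fubini_tonelli_F _ _ _ _ _ m2 F) => [|z].
  apply: emeasurable_funM => //; apply/measurable_EFinP.
  by apply: measurableT_comp; [exact: measurable_indic|exact: measurable_snd].
by rewrite mule_ge0 ?lee_fin.
Qed.

End tonelli_in.

(** * Translation estimates and integration by parts *)

Section shift_estimate.
Context {R : realType} {N : nat}.
Local Notation E := 'rV[R]_N.
Local Notation leb := (lebesgue_rV R N).
Local Notation lebR := (@lebesgue_measure R).
Implicit Types (phi : E -> R) (h x : E) (q : R) (A : set E).

Definition grad phi (x : E) : E := \row_j partial j phi x.

Lemma derive_grad phi h x : smooth phi -> 'D_h phi x = dot h (grad phi x).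
Proof.
move=> sphi; have d := smooth_differentiable sphi x.
rewrite deriveE// [in LHS](row_sum_delta h) linear_sum.
by apply: eq_bigr => j _; rewrite linearZ/= mxE /partial deriveE.
Qed.

Lemma smooth_dot_grad phi h : smooth phi -> smooth (fun x => dot h (grad phi x)).
Proof.
move=> sphi; rewrite (_ : (fun x => _) = \sum_j (cst (h ord0 j) * partial j phi)).
  elim/big_ind : _ => [|f g|j _]; first exact: smooth_cst.
    exact: smoothD.
  by apply: smoothM; [exact: smooth_cst|exact: smooth_partial].
by apply/funext => x; rewrite fct_sumE; apply: eq_bigr => j _; rewrite mxE.
Qed.

Lemma smooth_measurable phi : smooth phi -> measurable_fun setT phi.
Proof. by move=> sphi; apply: continuous_measurable_rV; exact: smooth_continuous. Qed.

Lemma measurable_line d (T : measurableType d) (f : E -> T) h : measurable_fun setT f ->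
  measurable_fun setT (fun xt : E * measurableTypeR R => f (xt.1 + xt.2 *: h)).
Proof.
move=> mf; apply: measurableT_comp => //; apply/measurable_rVP => i.
under eq_fun do rewrite !mxE.
apply: measurable_funD.
  by move/measurable_rVP : (@measurable_fst _ _ E (measurableTypeR R)); exact.
by apply: measurable_funM; [exact: measurable_snd|exact: measurable_cst].
Qed.

Lemma continuous_line (f : E -> R) h x : continuous f ->
  continuous (fun t : R => f (x + t *: h)).
Proof.
move=> cf t; apply: (@continuous_comp _ _ _ (fun t : R => x + t *: h) f); last exact: cf.
apply: cvgD; first exact: cvg_cst.
by apply: cvgZr_tmp; exact: cvg_id.
Qed.

Lemma smooth_line phi h x : smooth phi ->
  (\int[lebR]_(t in `[0%R, 1%R]) (dot h (grad phi (x + t *: h)))%:E)%E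
  = (phi (x + h) - phi x)%:E.
Proof.
move=> sphi.
pose F (t : R) := phi (x + t *: h).
have dF (t : R) : is_derive t 1 F (dot h (grad phi (x + t *: h))).
  rewrite -derive_grad//.
  have d : derivable phi (x + t *: h) h by apply/diff_derivable/smooth_differentiable.
  have e : (fun s : R => s^-1 *: ((F \o shift t) (s *: (1 : R)) - F t)) =
           (fun s : R => s^-1 *: ((phi \o shift (x + t *: h)) (s *: h) - phi (x + t *: h))).
    apply/funext => s; rewrite /F /=; congr (_ *: (phi _ - _)).
    by rewrite scalerDl /GRing.scale/= mulr1 addrCA.
  by split; rewrite /derivable /derive e.
have cG : continuous (fun t : R => dot h (grad phi (x + t *: h))).
  exact: (continuous_line (smooth_continuous (smooth_dot_grad h sphi))).
have cF : continuous F.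
  by move=> t; apply/differentiable_continuous/derivable1_diffP; case: (dF t).
rewrite (@continuous_FTC2 _ _ F)//.
- by rewrite /F scale1r scale0r addr0.
- exact: continuous_subspaceT.
- split=> [t _||]; first by case: (dF t).
    by apply: cvg_at_right_filter; exact: cF.
  by apply: cvg_at_left_filter; exact: cF.
- by move=> t _; rewrite derive1E; case: (dF t).
Qed.

Lemma integrable_cts01 (f : R -> R) : continuous f ->
  lebR.-integrable `[0%R, 1%R] (EFin \o f).
Proof.
move=> cf; apply: continuous_compact_integrable; first exact: segment_compact.
exact: continuous_subspaceT.
Qed.

Lemma lebesgue01 : lebR `[0%R, 1%R] = 1%E.
Proof. by rewrite lebesgue_measure_itv/= lte_fin ltr01 -EFinD subr0. Qed.

Lemma measurable_shift_diff phi h : smooth phi ->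
  measurable_fun setT (fun x => phi (x + h) - phi x).
Proof.
move=> sphi; have mp := smooth_measurable sphi; apply: measurable_funB => //.
by apply: measurableT_comp => //; exact: measurable_shift_rV.
Qed.

Lemma measurable_powR_norm d (T : measurableType d) (D : set T) (f : T -> R) q :
  measurable_fun D f -> measurable_fun D (fun y => `|f y| `^ q).
Proof.
move=> mf; apply: (@measurableT_comp _ _ _ _ _ _ (fun y : R => y `^ q)).
  exact: measurable_powR.
exact: measurableT_comp.
Qed.

(** The increment is the mean of the directional derivative over the segment from x to x + h, and
    Jensen's inequality moves the power inside. *)
Lemma shift_estimate_pt phi h x q : smooth phi -> 1 <= q <= 2 ->
  ((`|phi (x + h) - phi x| `^ q)%:E <=
  \int[lebR]_(t in `[0%R, 1%R]) (`|dot h (grad phi (x + t *: h))| `^ q)%:E)%E.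
Proof.
move=> sphi /andP[q1 q2]; set G := fun t : R => dot h (grad phi (x + t *: h)).
have cG : continuous G.
  exact: (continuous_line (smooth_continuous (smooth_dot_grad h sphi))).
have LG := integrable_cts01 cG.
have LGq : lebR.-integrable `[0%R, 1%R] (EFin \o (fun t => `|G t| `^ q)).
  have cG2 : continuous (fun t => 1 + G t * G t).
    by move=> t; apply: cvgD; [exact: cvg_cst|apply: cvgM; exact: cG].
  apply: (integrable_le _ (measurable_powR_norm _ _) (integrable_cts01 cG2)) => //.
    exact: integrable_measurable LG.
  move=> t _; rewrite ger0_norm ?powR_ge0// -expr2 -real_normK ?num_real//.
  have [G1|G1] := leP `|G t| 1.
    apply: (@le_trans _ _ 1); last by rewrite lerDl sqr_ge0.
    rewrite [leRHS](_ : 1 = 1 `^ q); last by rewrite powR1.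
    apply: ge0_ler_powR; rewrite ?nnegrE//.
    exact: le_trans q1.
  apply: (@le_trans _ _ (`|G t| `^ 2)); first by apply: ler_powR => //; exact: ltW.
  by rewrite (powR_mulrn 2)// lerDr.
have m01 : measurable (`[0%R, 1%R] : set (measurableTypeR R)) by exact: measurable_itv.
rewrite -(EFin_Rintegral m01 LGq) lee_fin.
have q12 : 1 <= q <= 2 by rewrite q1.
have := jensen_powR m01 lebesgue01 q12 LG LGq.
suff -> : Rintegral lebR `[0%R, 1%R] G = phi (x + h) - phi x by [].
by rewrite /Rintegral smooth_line.
Qed.

(** After exchanging the integrals, each t contributes the integral of a translate of f, and the
    parameter interval has length 1. *)
Lemma integral_line (f : E -> \bar R) h : measurable_fun setT f -> (forall x, 0 <= f x)%E ->
  (\int[leb]_x \int[lebR]_(t in `[0%R, 1%R]) f (x + t *: h)%R = \int[leb]_x f x)%E.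
Proof.
move=> mf f0.
have m01 : measurable (`[0%R, 1%R] : set (measurableTypeR R)) by exact: measurable_itv.
have mline := measurable_line h mf.
rewrite (@tonelli_in _ _ E (measurableTypeR R) R leb lebR setT `[0%R, 1%R]%classic
  (fun xt => f (xt.1 + xt.2 *: h)))//.
under eq_integral do rewrite /= ge0_integral_shift//.
rewrite integral_cst//.
by rewrite [X in (_ * X)%E](_ : _ = 1%E) ?mule1//; exact: lebesgue01.
Qed.

Lemma measurable_integral_line (f : E -> \bar R) h : measurable_fun setT f ->
  (forall x, 0 <= f x)%E ->
  measurable_fun setT (fun x => \int[lebR]_(t in `[0%R, 1%R]) f (x + t *: h)%R)%E.
Proof.
move=> mf f0.
have m01 : measurable (`[0%R, 1%R] : set (measurableTypeR R)) by exact: measurable_itv.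
exact: (@measurable_tonelli_in _ _ E (measurableTypeR R) R lebR _ _ m01
  (measurable_line h mf) (fun xt => f0 (xt.1 + xt.2 *: h))).
Qed.

Lemma shift_estimate phi h q : smooth phi -> 1 <= q <= 2 ->
  (\int[leb]_x (`|phi (x + h)%R - phi x| `^ q)%:E <=
   \int[leb]_x (`|dot h (grad phi x)| `^ q)%:E)%E.
Proof.
move=> sphi q12; pose f y := ((`|dot h (grad phi y)| `^ q)%:E : \bar R).
have mf : measurable_fun setT f.
  by apply/measurable_EFinP; exact: (measurable_powR_norm q (smooth_measurable (smooth_dot_grad h sphi))).
have f0 y : (0 <= f y)%E by rewrite lee_fin powR_ge0.
rewrite -[leRHS](integral_line h mf f0).
apply: ge0_le_integral => //.
- by apply/measurable_EFinP; exact: (measurable_powR_norm q (measurable_shift_diff h sphi)).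
- exact: measurable_integral_line.
- by move=> x _; exact: shift_estimate_pt.
Qed.

Lemma compact_measurable_rV (K : set E) : compact K -> measurable K.
Proof.
move=> cK; rewrite -(setCK K); apply: measurableC; apply: open_measurable_rV.
by apply: closed_openC; apply: compact_closed => //; exact: norm_hausdorff.
Qed.

Lemma test_function_bounded Om phi : test_function Om phi ->
  exists2 C : R, 0 <= C & forall x, `|phi x| <= C.
Proof.
move=> tphi; have [sphi cphi _] := tphi.
have [M [Mr HM]] : bounded_set (phi @` tsupport phi).
  apply: compact_bounded; apply: continuous_compact => //.
  by apply: continuous_subspaceT; exact: smooth_continuous.
exists `|M + 1| => // x; have [->|px] := eqVneq (phi x) 0; first by rewrite normr0.
apply: le_trans (ler_norm _); apply: (HM (M + 1)); first by rewrite ltrDl.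
by exists x => //; exact: sub_tsupport.
Qed.

Lemma integrable_bounded_support (D : set E) (K : set E) (f : E -> R) (C : R) :
  measurable D -> compact K -> measurable_fun setT f -> (forall x, `|f x| <= C) ->
  (forall x, f x != 0 -> K x) -> leb.-integrable D (EFin \o f).
Proof.
move=> mD cK mf fC fK; have mK := compact_measurable_rV cK.
apply: (integrableS measurableT mD) => //.
have LK : leb.-integrable setT (EFin \o (fun x => C * \1_K x)).
  apply: integrableZ_EFin => //; apply: ge0_integrable => //.
  rewrite integral_indic// setIT; apply: lebesgue_rV_bounded => //.
  exact: compact_bounded.
apply: (integrable_le measurableT mf LK) => x _.
have [->|fx] := eqVneq (f x) 0.
  by rewrite normr0 mulr_ge0 ?(le_trans _ (fC x)).
by rewrite indicE mem_set ?mulr1//; exact: fK.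
Qed.

Lemma integrable_test (D : set E) Om phi : measurable D -> test_function Om phi ->
  leb.-integrable D (EFin \o phi).
Proof.
move=> mD tphi; have [C C0 HC] := test_function_bounded tphi; have [sphi cphi _] := tphi.
apply: (integrable_bounded_support mD cphi (smooth_measurable sphi) HC) => x.
exact: sub_tsupport.
Qed.

Lemma Rintegral_shift (f : E -> R) h : measurable_fun setT f ->
  \int[leb]_x f (x + h) = \int[leb]_x f x.
Proof.
move=> mf; rewrite /Rintegral; congr fine.
rewrite integralE [RHS]integralE; congr (_ - _)%E.
  have mp : measurable_fun setT ((fun x => (f x)%:E)^\+)%E.
    by apply: measurable_funepos; exact/measurable_EFinP.
  rewrite -[RHS](ge0_integral_shift h mp (fun x => funepos_ge0 _ x)).
  by apply: eq_integral => x _; rewrite !funeposE.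
have mn : measurable_fun setT ((fun x => (f x)%:E)^\-)%E.
  by apply: measurable_funeneg; exact/measurable_EFinP.
rewrite -[RHS](ge0_integral_shift h mn (fun x => funeneg_ge0 _ x)).
by apply: eq_integral => x _; rewrite !funenegE.
Qed.

Lemma dot_delta (n : nat) j (x : 'rV[R]_n) : dot (delta_mx ord0 j) x = x ord0 j.
Proof.
rewrite /dot (bigD1 j)//= mxE !eqxx mul1r big1 ?addr0// => i ij.
by rewrite mxE (negbTE ij) andbF mul0r.
Qed.

Lemma integrable_shift (f : E -> R) h : leb.-integrable setT (EFin \o f) ->
  leb.-integrable setT (EFin \o (fun x => f (x + h))).
Proof.
move=> /integrableP[mf foo]; apply/integrableP; split.
  exact: (measurableT_comp mf (measurable_shift_rV h)).
have ma : measurable_fun setT (fun x => `|(f x)%:E|)%E by exact: measurableT_comp.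
by rewrite (ge0_integral_shift h ma).
Qed.

Lemma Rintegral_line (f : E -> R) h : continuous f -> (forall x, 0 <= f x) ->
  leb.-integrable setT (EFin \o f) ->
  let A x := \int[lebR]_(t in `[0%R, 1%R]) f (x + t *: h) in
  leb.-integrable setT (EFin \o A) /\ \int[leb]_x A x = \int[leb]_x f x.
Proof.
move=> cf f0 Lf A.
have m01 : measurable (`[0%R, 1%R] : set (measurableTypeR R)) by exact: measurable_itv.
have mf : measurable_fun setT (EFin \o f) by exact: measurable_int Lf.
have f0' x : (0 <= (EFin \o f) x)%E by rewrite lee_fin.
have AE x : (A x)%:E = (\int[lebR]_(t in `[0%R, 1%R]) (EFin \o f) (x + t *: h)%R)%E.
  by rewrite /A EFin_Rintegral//; exact/integrable_cts01/continuous_line.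
have IA : (\int[leb]_x (A x)%:E = \int[leb]_x (f x)%:E)%E.
  by under eq_integral do rewrite AE; exact: (integral_line h mf f0').
split; last by rewrite /Rintegral IA.
apply: ge0_integrable => //.
- apply/measurable_EFinP; rewrite (_ : EFin \o A = fun x => (A x)%:E)//.
  under eq_fun do rewrite AE.
  exact: (measurable_integral_line h mf f0').
- by move=> x _; exact: Rintegral_ge0.
- by rewrite IA -EFin_Rintegral// ltry.
Qed.

(* Average the derivative along [0, h]: the increment phi (x + h) - phi x has integral 0. *)
Lemma integral_partial_eq0 Om phi j : test_function Om phi ->
  \int[leb]_x partial j phi x = 0.
Proof.
move=> tphi; have [sphi _ _] := tphi; set h : E := delta_mx ord0 j.
have dE x : dot h (grad phi x) = partial j phi x by rewrite dot_delta mxE.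
have Lphi := integrable_test measurableT tphi.
have Ld := integrable_test measurableT (test_function_partial j tphi).
have cd := smooth_continuous (smooth_partial j sphi).
(* Positive and negative parts are averaged separately, since averaging over the segment rests on
   Tonelli's theorem for nonnegative functions. *)
pose gp x : R := Num.max (partial j phi x) 0.
pose gm x : R := Num.max (- partial j phi x) 0.
have gE x : partial j phi x = gp x - gm x.
  rewrite /gp /gm; move: (partial j phi x) => y; clear.
  by case: (leP y 0) => ?; case: (leP (- y) 0) => ?; lra.
have cgp : continuous gp by move=> x; apply: continuous_max; [exact: cd|exact: cst_continuous].
have cgm : continuous gm.
  have cN : continuous (fun x => - partial j phi x) by move=> x; exact: (continuousN (cd x)).
  by move=> x; exact: (continuous_max (cN x) (@cst_continuous _ _ (0 : R) x)).
have gp0 x : 0 <= gp x by rewrite le_max lexx orbT.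
have gm0 x : 0 <= gm x by rewrite le_max lexx orbT.
have Ln := integrable_norm_EFin Ld.
have Lgp : leb.-integrable setT (EFin \o gp).
  apply: (integrable_le measurableT _ Ln) => [|x _]; first exact: continuous_measurable_rV.
  by rewrite ger0_norm// ge_max ler_norm normr_ge0.
have Lgm : leb.-integrable setT (EFin \o gm).
  apply: (integrable_le measurableT _ Ln) => [|x _]; first exact: continuous_measurable_rV.
  by rewrite ger0_norm// ge_max normr_ge0 -normrN ler_norm.
have [LAp IAp] := Rintegral_line h cgp gp0 Lgp.
have [LAm IAm] := Rintegral_line h cgm gm0 Lgm.
have m01 : measurable (`[0%R, 1%R] : set (measurableTypeR R)) by exact: measurable_itv.
under eq_Rintegral do rewrite gE.
rewrite RintegralB// -IAp -IAm -RintegralB//.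
transitivity (\int[leb]_x (phi (x + h) - phi x)).
  apply: eq_Rintegral => x _; rewrite -RintegralB//; try exact/integrable_cts01/continuous_line.
  under eq_Rintegral do rewrite -gE -dE.
  by rewrite /Rintegral smooth_line.
rewrite RintegralB//; last exact: integrable_shift.
by rewrite Rintegral_shift ?subrr//; exact: integrable_measurable Lphi.
Qed.

Lemma integral_by_parts Om phi psi j : smooth phi -> test_function Om psi ->
  \int[leb]_x (phi x * partial j psi x) = - \int[leb]_x (partial j phi x * psi x).
Proof.
move=> sphi tpsi; have [spsi _ _] := tpsi.
have t1 := test_functionM tpsi sphi.
have t2 := test_functionM (test_function_partial j tpsi) sphi.
have t3 := test_functionM tpsi (smooth_partial j sphi).
have L2 := integrable_test measurableT t2; have L3 := integrable_test measurableT t3.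
apply/eqP; rewrite -addr_eq0; apply/eqP.
rewrite -(integral_partial_eq0 j t1) partialM; try exact: smooth_differentiable.
rewrite -RintegralD//.
- by apply: eq_Rintegral => x _; rewrite addrC mulrC.
- by apply: integrable_eq L2 => // x _; exact: mulrC.
- by apply: integrable_eq L3 => // x _; exact: mulrC.
Qed.

End shift_estimate.

Section dominated.
Context d (T : measurableType d) (R : realType) (mu : {measure set T -> \bar R}).

Lemma Rintegral_cvg_dominated (D : set T) (f_ : nat -> T -> R) (f g : T -> R) :
  measurable D -> (forall n, measurable_fun D (f_ n)) -> measurable_fun D f ->
  {ae mu, forall x, D x -> f_ n x @[n --> \oo] --> f x} ->
  mu.-integrable D (EFin \o g) -> (forall n x, D x -> `|f_ n x| <= g x) ->
  Rintegral mu D (f_ n) @[n --> \oo] --> Rintegral mu D f.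
Proof.
move=> mD mf_ mf cv Lg fg.
have h1 n : measurable_fun D (EFin \o f_ n) by exact/measurable_EFinP.
have h2 : measurable_fun D (EFin \o f) by exact/measurable_EFinP.
have h3 : {ae mu, forall x, D x -> (EFin \o f_ n) x @[n --> \oo] --> (EFin \o f) x}.
  apply: filterS cv => x h Dx; apply: cvg_EFin; last exact: h.
  exact: nearW.
have h4 : {ae mu, forall x n, D x -> (`|(EFin \o f_ n) x| <= (EFin \o g) x)%E}.
  by apply: aeW => x n Dx; rewrite lee_fin; exact: fg.
have [Lf _ cvi] := dominated_convergence mD h1 h2 h3 Lg h4.
apply/fine_cvg; rewrite EFin_Rintegral//.
Qed.

End dominated.

(** * Faber-Krahn and Poincare inequalities, and uniqueness of weak gradients *)

Section faber_krahn.
Context {R : realType} {N : nat}.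
Local Notation E := 'rV[R]_N.
Local Notation leb := (lebesgue_rV R N).
Implicit Types (phi : E -> R) (h x : E) (q : R) (A Om : set E).

Lemma measurable_dot d (T : measurableType d) (D : set T) n (F G : T -> 'rV[R]_n) :
  (forall j, measurable_fun D (fun t => F t ord0 j)) ->
  (forall j, measurable_fun D (fun t => G t ord0 j)) ->
  measurable_fun D (fun t => dot (F t) (G t)).
Proof.
by move=> mF mG; rewrite /dot; apply: measurable_sum => j; exact: measurable_funM.
Qed.

Lemma measurable_enorm d (T : measurableType d) (D : set T) n (F : T -> 'rV[R]_n) :
  (forall j, measurable_fun D (fun t => F t ord0 j)) ->
  measurable_fun D (fun t => enorm (F t)).
Proof.
move=> mF; have ms : measurable_fun setT (Num.sqrt : R -> R).
  by apply: continuous_measurable_fun; exact: sqrt_continuous.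
exact: (measurableT_comp ms (measurable_dot mF mF)).
Qed.

Lemma measurable_grad_coord phi j : smooth phi ->
  measurable_fun setT (fun x => grad phi x ord0 j).
Proof.
move=> sphi; under eq_fun do rewrite mxE.
by apply: smooth_measurable; exact: smooth_partial.
Qed.

Lemma Rintegral_support (D : set E) (f : E -> R) :
  (forall x, ~ D x -> f x = 0) -> \int[leb]_(x in D) f x = \int[leb]_x f x.
Proof.
move=> f0; rewrite Rintegral_mkcond; apply: eq_Rintegral => x _.
by rewrite patchE; case: ifPn => // /negP; rewrite inE => /f0.
Qed.

Lemma grad_out_tsupport phi x : ~ tsupport phi x -> grad phi x = 0.
Proof. by move=> px; apply/rowP => j; rewrite !mxE partial_out_tsupport. Qed.

Lemma grad_out Om phi x : test_function Om phi -> ~ Om x -> grad phi x = 0.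
Proof. by move=> [_ _ sO] Ox; apply: grad_out_tsupport => /sO. Qed.

Lemma enorm_grad_bounded Om phi : test_function Om phi ->
  exists2 C : R, 0 <= C & forall x, enorm (grad phi x) <= C.
Proof.
move=> tphi; have /choice[C HC] : forall j, exists C : R, forall x, `|partial j phi x| <= C.
  by move=> j; have [C _ HC] := test_function_bounded (test_function_partial j tphi); exists C.
exists `|\sum_j C j| => // x; apply: le_trans (ler_norm _).
apply: le_trans (enorm_le_sum _) _; apply: ler_sum => j _; rewrite mxE; exact: HC.
Qed.

Lemma integrable_enorm_grad (D : set E) Om phi q : measurable D -> 0 < q ->
  test_function Om phi -> leb.-integrable D (EFin \o (fun x => enorm (grad phi x) `^ q)).
Proof.
move=> mD q0 tphi; have [C C0 HC] := enorm_grad_bounded tphi; have [sphi cphi _] := tphi.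
apply: (@integrable_bounded_support _ _ _ _ _ (C `^ q) mD cphi).
- apply: (@measurableT_comp _ _ _ _ _ _ (fun y : R => y `^ q)); first exact: measurable_powR.
  by apply: measurable_enorm => j; exact: measurable_grad_coord.
- move=> x; rewrite ger0_norm ?powR_ge0//; apply: ge0_ler_powR => //; first exact: ltW.
  by rewrite nnegrE enorm_ge0.
- move=> x; apply: contra_neqP => /grad_out_tsupport ->.
  by rewrite enorm0 powR0 ?gt_eqF.
Qed.

Lemma shift_estimate_enorm phi h Om q c : test_function Om phi -> 1 <= q <= 2 ->
  enorm h <= c ->
  (\int[leb]_x (`|phi (x + h)%R - phi x| `^ q)%:E <=
   (c `^ q * \int[leb]_x (enorm (grad phi x) `^ q))%:E)%E.
Proof.
move=> tphi q12 hc; have [sphi _ _] := tphi; have /andP[q1 _] := q12.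
have q0 : 0 < q by exact: lt_le_trans q1.
have c0 := le_trans (enorm_ge0 h) hc.
have Lg := integrable_enorm_grad measurableT q0 tphi.
apply: le_trans (shift_estimate h sphi q12) _.
rewrite -RintegralZl// EFin_Rintegral//; last exact: integrableZ_EFin.
apply: ge0_le_integral => //.
- apply/measurable_EFinP; apply: measurable_powR_norm.
  exact: smooth_measurable (smooth_dot_grad h sphi).
- by apply/measurable_EFinP; exact: (integrable_measurable (integrableZ_EFin measurableT _ Lg)).
- move=> x _; rewrite lee_fin -powRM ?enorm_ge0//.
  apply: ge0_ler_powR; rewrite ?nnegrE ?mulr_ge0 ?enorm_ge0//; first exact: ltW.
  by apply: le_trans (cauchy_schwarz _ _) _; rewrite ler_wpM2r ?enorm_ge0.
Qed.

Lemma measurable_cube (e : R) :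
  measurable [set h : E | forall i, `[0%R, e]%classic (h ord0 i)].
Proof.
by have := @measurable_box R N (fun=> `[0%R, e]%classic); apply => i; exact: measurable_itv.
Qed.

Lemma lebesgue_cube (e : R) : 0 < e ->
  leb [set h : E | forall i, `[0%R, e]%classic (h ord0 i)] = (e ^+ N)%:E.
Proof.
move=> e0; rewrite (lebesgue_rV_box (A := fun=> `[0%R, e]%classic)); last first.
  by move=> i; exact: measurable_itv.
rewrite (eq_bigr (fun=> e%:E)) => [|i _]; last first.
  by rewrite lebesgue_measure_itv/= lte_fin e0 -EFinD subr0.
by rewrite prodEFin prodr_const card_ord.
Qed.

Lemma measurable_add_rV : measurable_fun setT (fun z : E * E => z.1 + z.2).
Proof.
apply/measurable_rVP => i; under eq_fun do rewrite mxE.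
apply: measurable_funD.
  by move/measurable_rVP : (@measurable_fst _ _ E E); exact.
by move/measurable_rVP : (@measurable_snd _ _ E E); exact.
Qed.

(* Compare phi with its averages over cubes of side e, which are bounded by
   e^-N times the L^1 norm of phi. *)
Lemma faber_krahn_test Om phi A (e : R) : test_function Om phi ->
  measurable A -> (leb A < +oo)%E -> 0 < e ->
  \int[leb]_(x in A) `|phi x| <=
  N%:R * e * \int[leb]_x enorm (grad phi x)
  + e ^- N * fine (leb A) * \int[leb]_x `|phi x|.
Proof.
move=> tphi mA Afin e0; have [sphi _ _] := tphi.
set Q := [set h : E | forall i, `[0%R, e]%classic (h ord0 i)].
have mQ : measurable Q by exact: measurable_cube.
have Lphi := integrable_norm_EFin (integrable_test measurableT tphi).
have LA := integrable_norm_EFin (integrable_test mA tphi).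
have Lg : leb.-integrable setT (EFin \o (fun x => enorm (grad phi x))).
  apply: (integrable_eq measurableT _ (integrable_enorm_grad measurableT ltr01 tphi)) => x _.
  by rewrite powRr1 ?enorm_ge0.
set a := \int[leb]_(x in A) `|phi x|; set c := \int[leb]_x enorm (grad phi x).
set b := \int[leb]_x `|phi x|.
have c0 : 0 <= c by apply: Rintegral_ge0 => x _; exact: enorm_ge0.
have b0 : 0 <= b by exact: Rintegral_ge0.
have mn : measurable_fun setT (fun x => (`|phi x|)%:E).
  by apply/measurable_EFinP; exact: integrable_measurable Lphi.
have mxh : measurable_fun setT (fun hx : E * E => (`|phi (hx.2 + hx.1)|)%:E).
  by under eq_fun do rewrite addrC; exact: (measurableT_comp mn measurable_add_rV).
have step h : Q h ->
    (a%:E <= \int[leb]_(x in A) (`|phi (x + h)%R|)%:E + (N%:R * e * c)%:E)%E.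
  move=> Qh; rewrite /a EFin_Rintegral//.
  have hN : enorm h <= N%:R * e.
    apply: le_trans (enorm_le_sum _) _.
    rewrite -[X in _ <= X%:R * _]card_ord mulr_natl -sumr_const.
    apply: ler_sum => j _; have := Qh j; rewrite /= in_itv/= => /andP[h0 he].
    by rewrite ger0_norm.
  have q12 : 1 <= (1 : R) <= 2 by rewrite lexx ler1n.
  have := shift_estimate_enorm tphi q12 hN.
  rewrite powRr1 => [sh|]; last by rewrite mulr_ge0 ?(ltW e0).
  rewrite (_ : c = \int[leb]_x (enorm (grad phi x) `^ 1)); last first.
    by apply: eq_Rintegral => x _; rewrite powRr1 ?enorm_ge0.
  have msh : measurable_fun setT (fun x => (`|phi (x + h)%R - phi x| `^ 1)%:E).
    apply/measurable_EFinP; apply: measurable_powR_norm; exact: measurable_shift_diff.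
  have mph : measurable_fun setT (fun x => (`|phi (x + h)|)%:E).
    exact: (measurableT_comp mn (measurable_shift_rV h)).
  apply: le_trans (leeD2l _ sh).
  apply: (@le_trans _ _ (\int[leb]_(x in A) (`|phi (x + h)|)%:E +
      \int[leb]_(x in A) (`|phi (x + h)%R - phi x| `^ 1)%:E)%E); last first.
    rewrite leeD2l//; apply: ge0_subset_integral => //.
  rewrite -ge0_integralD//; [|exact: measurable_funTS|exact: measurable_funTS].
  apply: ge0_le_integral => //.
  - exact: measurable_funTS.
  - by apply: emeasurable_funD; exact: measurable_funTS.
  - move=> x _; rewrite -EFinD lee_fin powRr1//.
    by rewrite -lerBlDl (le_trans (lerB_dist _ _))// distrC.
have mi : measurable_fun Q (fun h => \int[leb]_(x in A) (`|phi (x + h)%R|)%:E)%E.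
  apply: measurable_funTS.
  exact: (@measurable_tonelli_in _ _ E E R leb A _ mA mxh).
have k0 : 0 <= N%:R * e * c by rewrite !mulr_ge0// ltW.
(* Integrate over h in the cube Q, of measure e^N. For fixed x the integral of |phi (x + h)| over Q
   is then bounded by the full L^1 norm b, and the integral over A contributes its measure. *)
have : (\int[leb]_(h in Q) a%:E <=
    \int[leb]_(h in Q) (\int[leb]_(x in A) (`|phi (x + h)%R|)%:E + (N%:R * e * c)%:E))%E.
  apply: ge0_le_integral => //.
  - by move=> h _; rewrite lee_fin; exact: Rintegral_ge0.
  - exact: emeasurable_funD.
rewrite (ge0_integralD leb mQ _ mi)//; last by move=> h _; exact: integral_ge0.
have eQ : leb Q = (e ^+ N)%:E by exact: lebesgue_cube.
have iQ (k : R) : (\int[leb]_(_ in Q) k%:E = (k * e ^+ N)%:E)%E.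
  by rewrite integral_cst// EFinM; congr (_ * _)%E; exact: eQ.
rewrite !iQ.
rewrite (@tonelli_in _ _ E E R leb leb Q A (fun hx => (`|phi (hx.2 + hx.1)|)%:E))//.
have inner : (\int[leb]_(x in A) \int[leb]_(h in Q) (`|phi (x + h)|)%:E <=
    b%:E * leb A)%E.
  rewrite -integral_cst//; apply: ge0_le_integral => //.
  - by move=> x _; exact: integral_ge0.
  - apply: measurable_funTS.
    have mhx : measurable_fun setT (fun xh : E * E => (`|phi (xh.1 + xh.2)|)%:E).
      exact: (measurableT_comp mn measurable_add_rV).
    exact: (@measurable_tonelli_in _ _ E E R leb Q _ mQ mhx).
  - move=> x _; rewrite /b EFin_Rintegral// -(ge0_integral_shift x mn)//.
    under [leRHS]eq_integral do rewrite addrC.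
    apply: ge0_subset_integral => //.
    have mxy : measurable_fun setT (fun y : E => x + y).
      rewrite (_ : (fun y => _) = fun y => y + x); first exact: measurable_shift_rV.
      by apply/funext => y; rewrite addrC.
    exact: (measurableT_comp mn mxy).
have eA : leb A = (fine (leb A))%:E by rewrite fineK// ge0_fin_numE.
rewrite eA -EFinM in inner.
move=> /le_trans/(_ (leeD2r _ inner)); rewrite -EFinD lee_fin.
have eN : 0 < e ^+ N by exact: exprn_gt0.
set m := fine _; set C := N%:R * e * c => h.
rewrite -(ler_pM2r eN) (le_trans h)// mulrDl addrC lerD2l.
rewrite [leRHS](_ : _ = b * m)//; move: eN; move: (e ^+ N) => y y0.
by field; rewrite gt_eqF.
Qed.

(** The shift h along the first axis is longer than the width of Om, so x + h lies outside Om for x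
    in Om, and |phi x| is the increment of phi along h. The constant is |h|^q. *)
Lemma poincare_test Om q : (0 < N)%N -> bounded_set Om -> 1 <= q <= 2 ->
  exists2 C : R, 0 <= C & forall phi, test_function Om phi ->
    \int[leb]_x (`|phi x| `^ q) <= C * \int[leb]_x (enorm (grad phi x) `^ q).
Proof.
move=> N0 [M [Mr HM]] q12; have /andP[q1 _] := q12; have q0 : 0 < q by exact: lt_le_trans q1.
have OmM x i : Om x -> `|x ord0 i| <= `|M| + 1.
  move=> Ox; apply: le_trans (entry_le_norm x i) _.
  by apply: HM => //; rewrite (le_lt_trans (ler_norm M))// ltrDl.
pose i0 := Ordinal N0.
pose h : E := (2 * (`|M| + 1) + 1) *: delta_mx ord0 i0.
have M0 : 0 <= `|M| by [].
have out x : Om x -> ~ Om (x + h).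
  move=> /(OmM _ i0) + /(OmM _ i0); rewrite !mxE !eqxx mulr1 => h1 h2.
  have := ler_normB (x ord0 i0 + (2 * (`|M| + 1) + 1)) (x ord0 i0).
  rewrite addrC addKr ger0_norm; lra.
exists (enorm h `^ q); first exact: powR_ge0.
move=> phi tphi; have [sphi _ _] := tphi.
have Lphi := integrable_test measurableT tphi.
have mp := measurable_powR_norm q (measurable_shift_diff h sphi).
have := shift_estimate_enorm tphi q12 (lexx (enorm h)).
rewrite -lee_fin => /(le_trans _); apply.
have le_pt x : `|phi x| `^ q <= `|phi (x + h) - phi x| `^ q.
  have [Ox|Ox] := pselect (Om x).
    by rewrite (test_function_out tphi (out _ Ox)) sub0r normrN.
  by rewrite (test_function_out tphi Ox) normr0 powR0 ?gt_eqF// powR_ge0.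
have fin : (\int[leb]_x (`|phi (x + h)%R - phi x| `^ q)%:E < +oo)%E.
  exact: le_lt_trans (shift_estimate_enorm tphi q12 (lexx (enorm h))) (ltry _).
have mphi := measurable_powR_norm q (smooth_measurable sphi).
have le_int : (\int[leb]_x (`|phi x| `^ q)%:E <=
    \int[leb]_x (`|phi (x + h)%R - phi x| `^ q)%:E)%E.
  apply: ge0_le_integral => //; try exact/measurable_EFinP.
  by move=> x _; rewrite lee_fin.
have Lq := ge0_integrable mphi (fun x _ => powR_ge0 _ _) (le_lt_trans le_int fin).
by rewrite (EFin_Rintegral measurableT Lq).
Qed.

Lemma box_closed_compact (a b : E) :
  compact [set x : E | forall i, x ord0 i \in `[a ord0 i, b ord0 i]].
Proof.
by apply: (@rV_compact _ _ (fun i => `[a ord0 i, b ord0 i]%classic)) => i; exact: segment_compact.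
Qed.

(** Test with the bumps of the box and let n tend to infinity; |f| dominates on the closed box, a
    compact subset of Om. *)
Lemma integral_open_box_eq0 Om (f : E -> R) (a b : E) : loc_integrable Om f ->
  (forall phi, test_function Om phi -> \int[leb]_(x in Om) (f x * phi x) = 0) ->
  [set x : E | forall i, x ord0 i \in `[a ord0 i, b ord0 i]] `<=` Om ->
  (\int[leb]_(x in [set x : E | forall i, x ord0 i \in `]a ord0 i, b ord0 i[]) (f x)%:E = 0)%E.
Proof.
move=> Lf f0 abO; set K := [set x | _] in abO; set B := [set x | _].
have cK : compact K by exact: box_closed_compact.
have mK := compact_measurable_rV cK.
have mB : measurable B by exact: box_rV_measurable.
have BK : B `<=` K by move=> x xB i; apply: subset_itv_oo_cc; exact: xB.
have LK := Lf _ cK abO; have mf := integrable_measurable LK.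
pose F n x := f x * box_bump a b n.+1 x.
have bump0 n x : ~ K x -> box_bump a b n.+1 x = 0.
  move=> nK; apply: contrapT => /eqP; rewrite box_bump_neq0// => /forallP xB.
  by apply: nK; apply: BK => i; exact: xB.
have mF n : measurable_fun K (F n).
  apply: measurable_funM => //; apply: measurable_funTS.
  exact: (smooth_measurable (smooth_box_bump a b n.+1)).
have Fle n x : `|F n x| <= `|f x|.
  have /andP[b0 b1] := box_bump_itv a b n.+1 x.
  by rewrite normrM (ger0_norm b0) ler_piMr.
have LF n : leb.-integrable K (EFin \o F n).
  by apply: (integrable_le mK (mF n) (integrable_norm_EFin LK)).
have F0 n : (\int[leb]_(x in K) (F n x)%:E = 0)%E.
  rewrite -(EFin_Rintegral mK (LF n)); congr EFin.
  rewrite -(f0 _ (@test_function_box_bump _ _ Om a b n.+1 isT abO)).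
  rewrite [LHS]Rintegral_support => [|x nK]; last by rewrite /F bump0 ?mulr0.
  by rewrite [RHS]Rintegral_support// => x nO; rewrite bump0 ?mulr0// => /abO.
have FB x : F n x @[n --> \oo] --> (f \_ B) x.
  rewrite (_ : (f \_ B) x = f x * ([forall i, x ord0 i \in `]a ord0 i, b ord0 i[]%:R : R)).
    apply: cvgM; first exact: cvg_cst.
    by have := @cvg_box_bump R N a b x; rewrite -(cvg_shiftS (fun n => box_bump a b n x)).
  rewrite patchE; have [xB|xB] := pselect (B x).
    by rewrite mem_set// (introT forallP xB) mulr1.
  rewrite memNset//; case: forallP => [h|_]; last by rewrite mulr0.
  by exfalso; apply: xB => i; exact: h.
have mfB : measurable_fun K (f \_ B).
  rewrite -measurable_restrict//.
  exact: measurable_funS (@subIsetl _ _ _) mf.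
have := Rintegral_cvg_dominated mK mF mfB (aeW _ (fun x _ => FB x)) (integrable_norm_EFin LK)
  (fun n x _ => Fle n x).
rewrite (_ : (fun n => _) = cst 0); last first.
  by apply/funext => n; rewrite /Rintegral F0.
move=> /(cvg_unique (@norm_hausdorff _ R^o) (cvg_cst 0)) h.
have LfB : leb.-integrable K (EFin \o (f \_ B)).
  apply: (integrable_le mK mfB (integrable_norm_EFin LK)) => x _; rewrite patchE.
  by case: ifP => //; rewrite normr0.
rewrite -{1}(setIidr BK) integral_mkcondr.
rewrite (_ : (\int[leb]_(x in K) _)%E = (\int[leb]_(x in K) ((f \_ B) x)%:E)%E); last first.
  by apply: eq_integral => x _; rewrite restrict_EFin.
by rewrite -(EFin_Rintegral mK LfB) -h.
Qed.

(** The sets X over which f has integral 0 inside B form a Dynkin system that contains the open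
    boxes; stability under complements is the vanishing of the integral over B itself. *)
Lemma integral_in_box_eq0 (f : E -> R) (B : set E) : measurable B ->
  leb.-integrable B (EFin \o f) ->
  (\int[leb]_(x in B) (f x)%:E = 0)%E ->
  (forall c d : E, \int[leb]_(x in B `&` [set x : E | forall i, x ord0 i \in `]c ord0 i, d ord0 i[])
    (f x)%:E = 0)%E ->
  {ae leb, forall x, B x -> f x = 0}.
Proof.
move=> mB LB B0 box0.
have all0 X : measurable X -> (\int[leb]_(x in B `&` X) (f x)%:E = 0)%E.
  rewrite measurable_rV_generated.
  apply: (@dynkin_induction _ E _ (fun X => \int[leb]_(x in B `&` X) (f x)%:E = 0)%E
    (@measurable_rV_generated R N)).
  - move=> _ _ [a [b ->]] [c [d ->]].
    exists (\row_i Num.max (a ord0 i) (c ord0 i)), (\row_i Num.min (b ord0 i) (d ord0 i)).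
    apply/seteqP; split=> [x [xab xcd] i|x xi].
      have := xab i; have := xcd i; rewrite !mxE !in_itv/= => /andP[h1 h2] /andP[h3 h4].
      by rewrite gt_max lt_min h1 h2 h3 h4.
    by split=> i; have := xi i; rewrite !mxE !in_itv/= gt_max lt_min
      => /andP[/andP[h1 h2] /andP[h3 h4]]; rewrite ?h1 ?h2 ?h3 ?h4.
  - by rewrite setIT.
  - by move=> _ [a [b ->]]; exact: box0.
  - move=> S mS S0.
    have LBS : leb.-integrable (B `&` S `|` B `&` ~` S) (EFin \o f).
      by rewrite -setIUr setUv setIT.
    have := B0; rewrite -{1}(setIT B) -(setUv S) setIUr integral_setU_EFin//.
    + by rewrite S0 add0e.
    + exact: measurableI.
    + by apply: measurableI => //; exact: measurableC.
    + exact: integrable_measurable LBS.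
    + apply/disj_setPLR => x [_ Sx] [_]; exact.
  - move=> F mF tF F0; rewrite setI_bigcupr integral_bigcup.
    + by under eq_eseriesr do rewrite F0; rewrite eseries0.
    + exact: trivIset_setIl.
    + by move=> k; exact: measurableI.
    + apply: integrableS LB => //; first by apply: bigcup_measurable => k _; exact: measurableI.
      by move=> x [k _ []].
have := @integral_ae_eq _ _ _ leb B mB (cst 0%E) (EFin \o f) LB (measurable_cst _).
move=> h; have : ae_eq leb B (EFin \o f) (cst 0%E).
  by apply: h => X XB mX; rewrite integral0 -[RHS](all0 X mX) (setIidr XB).
by apply: filterS => x h' Bx; have := h' Bx => -[].
Qed.

Lemma ae_eq0_test Om (f : E -> R) : open Om -> loc_integrable Om f ->
  (forall phi, test_function Om phi -> \int[leb]_(x in Om) (f x * phi x) = 0) ->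
  {ae leb, forall x, Om x -> f x = 0}.
Proof.
move=> oO Lf f0.
pose cbox (ab : 'rV[rat]_N * 'rV[rat]_N) : set E :=
  [set x | forall i, x ord0 i \in `[(ratr (ab.1 ord0 i)), (ratr (ab.2 ord0 i))]].
pose obox (ab : 'rV[rat]_N * 'rV[rat]_N) : set E :=
  [set x | forall i, x ord0 i \in `](ratr (ab.1 ord0 i)), (ratr (ab.2 ord0 i))[].
have ae_box ab : cbox ab `<=` Om -> {ae leb, forall x, obox ab x -> f x = 0}.
  move=> abO; pose a : E := map_mx ratr ab.1; pose b : E := map_mx ratr ab.2.
  have cE : cbox ab = [set x | forall i, x ord0 i \in `[a ord0 i, b ord0 i]].
    by apply/seteqP; split=> x h i; have := h i; rewrite !mxE.
  have oE : obox ab = [set x | forall i, x ord0 i \in `]a ord0 i, b ord0 i[].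
    by apply/seteqP; split=> x h i; have := h i; rewrite !mxE.
  have ocb : obox ab `<=` cbox ab.
    by move=> x h i; apply: subset_itv_oo_cc; exact: h.
  have mo : measurable (obox ab) by rewrite oE; exact: box_rV_measurable.
  have kc : compact (cbox ab) by rewrite cE; exact: box_closed_compact.
  have Lb : leb.-integrable (obox ab) (EFin \o f).
    by apply: integrableS (Lf _ kc abO) => //; exact: compact_measurable_rV.
  rewrite cE in abO; rewrite oE in mo Lb *; apply: integral_in_box_eq0 => //.
    exact: (integral_open_box_eq0 Lf f0 abO).
  move=> c d; set B := (X in (\int[leb]_(x in X) _)%E).
  have -> : B = [set x : E | forall i,
      x ord0 i \in `](\row_i Num.max (a ord0 i) (c ord0 i)) ord0 i,
                     (\row_i Num.min (b ord0 i) (d ord0 i)) ord0 i[].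
    apply/seteqP; split=> [x [xab xcd] i|x xi].
      have := xab i; have := xcd i; rewrite !mxE !in_itv/= => /andP[h1 h2] /andP[h3 h4].
      by rewrite gt_max lt_min h1 h2 h3 h4.
    by split=> i; have := xi i; rewrite !mxE !in_itv/= gt_max lt_min
      => /andP[/andP[h1 h2] /andP[h3 h4]]; rewrite ?h1 ?h2 ?h3 ?h4.
  apply: (integral_open_box_eq0 Lf f0); apply: subset_trans abO => x h i.
  have := h i; rewrite !mxE !in_itv/= ge_max le_min => /andP[/andP[h1 _] /andP[h2 _]].
  by rewrite h1.
(* The rational boxes are enumerated by [unpickle], so that the exceptional sets are countably many
   and their union is a null set. *)
have : {ae leb, forall x n, if @unpickle ('rV[rat]_N * 'rV[rat]_N)%type n is Some ab
    then cbox ab `<=` Om -> obox ab x -> f x = 0 else True}.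
  apply: ae_foralln => n; case: unpickle => [ab|]; last exact: aeW.
  have [h|h] := pselect (cbox ab `<=` Om); last by apply: aeW => x /h.
  by apply: filterS (ae_box _ h) => x.
apply: filterS => x h Ox; move: (Ox); rewrite {1}(open_bigcup_box oO) => -[ab abO xab].
by have := h (pickle ab); rewrite pickleK; apply.
Qed.

Lemma weak_gradient_unique Om (u : E -> R) (F G : E -> E) : open Om ->
  is_weak_gradient Om u F -> is_weak_gradient Om u G ->
  {ae leb, forall x, Om x -> F x = G x}.
Proof.
move=> oO hF hG; have mO := open_measurable_rV oO.
have ae_j j : {ae leb, forall x, Om x -> component F j x - component G j x = 0}.
  have [LF iF] := hF j; have [LG iG] := hG j.
  apply: (ae_eq0_test oO) => [K cK KO|phi tphi].
    by apply: integrableB_EFin; [exact: compact_measurable_rV|exact: LF|exact: LG].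
  have [C C0 HC] := test_function_bounded tphi; have [sphi cphi sO] := tphi.
  have Lp (H : E -> R) : loc_integrable Om H ->
      leb.-integrable Om (EFin \o (fun x => H x * phi x)).
    move=> LH; have mK := compact_measurable_rV cphi; have LK := LH _ cphi sO.
    have LKp : leb.-integrable (tsupport phi) (EFin \o (fun x => H x * phi x)).
      apply: (integrable_le mK _ (integrableZ_EFin mK C (integrable_norm_EFin LK))).
        apply: measurable_funM; first exact: integrable_measurable LK.
        exact: measurable_funTS (smooth_measurable sphi).
      by move=> x _; rewrite normrM mulrC ler_wpM2r.
    apply/(integrable_mkcond _ mO); move/(integrable_mkcond _ mK) : LKp.
    rewrite (_ : _ \_ _ = (EFin \o (fun x => H x * phi x)) \_ Om)//.
    apply/funext => x; rewrite !patchE.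
    have [px|px] := pselect (tsupport phi x); first by rewrite !mem_set//; exact: sO.
    rewrite (memNset px); case: ifP => // _ /=.
    have [->|/sub_tsupport//] := eqVneq (phi x) 0.
    by rewrite mulr0.
  under eq_Rintegral do rewrite mulrBl.
  by rewrite (RintegralB mO (Lp _ LF) (Lp _ LG)) -[RHS]oppr0 -(subrr (\int[leb]_(x in Om) (u x * partial j phi x)))
    {1}(iF _ tphi) (iG _ tphi) opprD !opprK.
have : {ae leb, forall x j, Om x -> component F j x - component G j x = 0}.
  exact: filter_forall.
apply: filterS => x h Ox; apply/rowP => j.
by apply/eqP; rewrite -subr_eq0; apply/eqP; exact: h.
Qed.

End faber_krahn.

(** * Vector-valued functions with finite p-energy *)

Section sequence_limits.
Context {R : realType}.

Lemma summable_cvgn (u : nat -> R) (C : R) :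
  (forall n, \sum_(k < n) `|u k.+1 - u k| <= C) -> cvgn u.
Proof.
move=> uC; pose v k := u k.+1 - u k.
have cn : cvgn [normed series v].
  apply: nondecreasing_is_cvgn.
    by apply: nondecreasing_series => k _ _; exact: normr_ge0.
  exists C => _ [n _ <-]; rewrite /= /series/= big_mkord; exact: uC.
have := @normed_cvg R R^o v cn.
rewrite (_ : series v = fun n => u n - u 0%N); last first.
  by apply/funext => n; rewrite /series/= telescope_sumr.
move=> cv; rewrite (_ : u = (fun n => u n - u 0%N) + cst (u 0%N)).
  by apply: is_cvgD => //; exact: is_cvg_cst.
by apply/funext => n; rewrite /GRing.add/= subrK.
Qed.

(** The limit superior is measurable on all of D, and its finite part is the limit wherever the
    sequence converges. *)
Lemma ae_cvgn_measurable d (T : measurableType d) (mu : {measure set T -> \bar R})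
  (D : set T) (f : nat -> T -> R) : measurable D ->
  (forall k, measurable_fun D (f k)) ->
  {ae mu, forall x, D x -> cvgn (f ^~ x)} ->
  exists2 g : T -> R, measurable_fun D g &
    {ae mu, forall x, D x -> f k x @[k --> \oo] --> g x}.
Proof.
move=> mD mf cf; pose G x := limn_esup (fun k => (f k x)%:E).
have mG : measurable_fun D G.
  by apply: (@measurable_fun_limn_esup _ _ _ D (fun k x => (f k x)%:E)) => k; exact/measurable_EFinP.
exists (fine \o G); first by apply: measurableT_comp => //; exact: measurable_fine.
apply: filterS cf => x h Dx; have /cvg_ex[/= l fl] := h Dx.
have : (f k x)%:E @[k --> \oo] --> l%:E by apply: cvg_EFin => //; exact: nearW.
by move=> /cvg_limn_einf_sup[_ Gl]; rewrite /= /G Gl.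
Qed.

Lemma cvg_powR (u : nat -> R) (r p : R) : 1 <= p -> (forall l, 0 <= u l) ->
  u l @[l --> \oo] --> r -> u l `^ p @[l --> \oo] --> r `^ p.
Proof.
move=> p1 u0 ur; have p0 : 0 < p by exact: lt_le_trans p1.
have : 0 <= r by rewrite -(cvg_lim _ ur)//; apply: limr_ge; [apply/cvg_ex; exists r|exact: nearW].
rewrite le_eqVlt => /predU1P[r0|r0].
  rewrite -r0 in ur *; rewrite powR0 ?gt_eqF//.
  apply/cvgr0Pnorm_lt => e e0; near=> l.
  have ul1 : u l < Num.min 1 e.
    rewrite -[X in X < _]ger0_norm//; near: l; apply: cvgr0_norm_lt => //.
    by rewrite lt_min ltr01.
  rewrite ger0_norm ?powR_ge0//; move: ul1; rewrite lt_min => /andP[ul1 ule].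
  have := u0 l; rewrite le_eqVlt => /predU1P[<-|ul0]; first by rewrite powR0 ?gt_eqF.
  by apply: le_lt_trans ule; apply: ge1r_powR => //; rewrite ul0 ltW.
have dr : derivable (fun y : R => y `^ p) r 1 by case: (is_derive1_powR p r0).
have : {for r, continuous (fun y : R => y `^ p)}.
  by apply: differentiable_continuous; apply/derivable1_diffP.
by move=> c; apply: (cvg_comp _ _ ur c).
Unshelve. all: by end_near. Qed.

Lemma cvg_enorm n (F : nat -> 'rV[R]_n) (G : 'rV[R]_n) :
  (forall j, F l ord0 j @[l --> \oo] --> G ord0 j) ->
  enorm (F l) @[l --> \oo] --> enorm G.
Proof.
move=> FG; have dFG : dot (F l) (F l) @[l --> \oo] --> dot G G.
  by rewrite /dot; apply: cvg_big => [|j _]; [exact: add_continuous|apply: cvgM; exact: FG].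
exact: (cvg_comp _ _ dFG (@sqrt_continuous R _)).
Qed.

End sequence_limits.

Section vector_Lp.
Context d (T : measurableType d) (R : realType) (mu : {measure set T -> \bar R}).
Variables (D : set T) (mD : measurable D) (p : R).
Hypotheses (finD : (mu D < +oo)%E) (p12 : 1 < p <= 2).
Implicit Types (n : nat).
Local Notation L f := (mu.-integrable D (EFin \o f)).
Local Notation I f := (Rintegral mu D f).

Let p1 : 1 < p. Proof. by case/andP: p12. Qed.
Let p0 : 0 < p. Proof. exact: lt_trans p1. Qed.

Definition vLp n (F : T -> 'rV[R]_n) :=
  (forall j, measurable_fun D (fun x => F x ord0 j)) /\ L (fun x => enorm (F x) `^ p).

Definition energy n (F : T -> 'rV[R]_n) : R := I (fun x => enorm (F x) `^ p).

Lemma energy_ge0 n (F : T -> 'rV[R]_n) : 0 <= energy F.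
Proof. by apply: Rintegral_ge0 => x _; exact: powR_ge0. Qed.

Lemma measurable_powR_comp (f : T -> R) q : measurable_fun D f ->
  measurable_fun D (fun x => f x `^ q).
Proof.
move=> mf; apply: (@measurableT_comp _ _ _ _ _ _ (fun y : R => y `^ q)) mf.
exact: measurable_powR.
Qed.

Lemma vLp_le n (F : T -> 'rV[R]_n) (g : T -> R) :
  (forall j, measurable_fun D (fun x => F x ord0 j)) -> L g ->
  (forall x, D x -> enorm (F x) `^ p <= g x) -> vLp F /\ energy F <= I g.
Proof.
move=> mF Lg Fg.
have LF : L (fun x => enorm (F x) `^ p).
  apply: (integrable_le mD _ Lg) => [|x Dx].
    exact/measurable_powR_comp/measurable_enorm.
  by rewrite ger0_norm ?powR_ge0// Fg.
by split => //; exact: le_Rintegral.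
Qed.

Lemma vLpD n (F G : T -> 'rV[R]_n) : vLp F -> vLp G ->
  vLp (fun x => F x + G x) /\ energy (fun x => F x + G x) <= 4 * (energy F + energy G).
Proof.
move=> [mF LF] [mG LG].
have L4 := integrableZ_EFin mD 4 (integrableD_EFin mD LF LG).
rewrite /energy -(RintegralD mD LF LG) -(@RintegralZl _ _ _ mu D _ 4 mD (integrableD_EFin mD LF LG)).
apply: vLp_le => // [j|x _].
  by under eq_fun do rewrite mxE; exact: measurable_funD.
apply: le_trans (powR_addl p12 (enorm_ge0 _) (enorm_ge0 _)).
apply: ge0_ler_powR; rewrite ?nnegrE ?addr_ge0 ?enorm_ge0//; first exact: ltW.
exact: enormD.
Qed.

Lemma vLpZ n c (F : T -> 'rV[R]_n) : vLp F ->
  vLp (fun x => c *: F x) /\ energy (fun x => c *: F x) = `|c| `^ p * energy F.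
Proof.
move=> [mF LF]; have LcF := integrableZ_EFin mD (`|c| `^ p) LF.
have e x : `|c| `^ p * enorm (F x) `^ p = enorm (c *: F x) `^ p.
  by rewrite enormZ powRM ?enorm_ge0.
split; first split=> [j|].
- by under eq_fun do rewrite mxE; exact: measurable_funM.
- by apply: (integrable_eq mD _ LcF) => x _; rewrite e.
by rewrite /energy -RintegralZl//; apply: eq_Rintegral => x _; rewrite e.
Qed.

Lemma vLpN n (F : T -> 'rV[R]_n) : vLp F ->
  vLp (fun x => - F x) /\ energy (fun x => - F x) = energy F.
Proof.
move=> /(vLpZ (-1)); rewrite normrN1 powR1 mul1r.
by under [X in vLp X]eq_fun do rewrite scaleN1r; under [X in energy X]eq_fun do rewrite scaleN1r.
Qed.

Lemma vLpB n (F G : T -> 'rV[R]_n) : vLp F -> vLp G ->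
  vLp (fun x => F x - G x) /\ energy (fun x => F x - G x) <= 4 * (energy F + energy G).
Proof. by move=> LF LG; have [LN <-] := vLpN LG; exact: vLpD. Qed.

Lemma vLp_integrable n (F : T -> 'rV[R]_n) (t : R) : 0 < t -> vLp F ->
  L (fun x => enorm (F x)) /\
  I (fun x => enorm (F x)) <= t * fine (mu D) + t `^ (1 - p) * energy F.
Proof.
move=> t0 [mF LF].
have Lg : L (fun x => t + t `^ (1 - p) * enorm (F x) `^ p).
  by apply: integrableD_EFin => //; [exact: integrable_cst_EFin|exact: integrableZ_EFin].
have le x : enorm (F x) <= t + t `^ (1 - p) * enorm (F x) `^ p.
  exact: le_powR_p (enorm_ge0 _).
have LF1 : L (fun x => enorm (F x)).
  apply: (integrable_le mD (measurable_enorm mF) Lg) => x _.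
  by rewrite ger0_norm ?enorm_ge0.
split => //; apply: le_trans (le_Rintegral mD LF1 Lg _) _ => //.
rewrite RintegralD//; [|exact: integrable_cst_EFin|exact: integrableZ_EFin].
by rewrite Rintegral_cst// RintegralZl.
Qed.

(** First fix t so small that t times the measure of D is at most dl / 2; then t^(1-p) is a
    constant, and a small energy makes the other term of [vLp_integrable] small. *)
Lemma vLp_L1_small (dl : R) : 0 < dl -> exists2 e : R, 0 < e & forall n (F : T -> 'rV[R]_n),
  vLp F -> energy F < e -> I (fun x => enorm (F x)) < dl.
Proof.
move=> dl0; set m := fine (mu D); have m0 : 0 <= m by exact: fine_ge0.
pose t := dl / (2 * (m + 1)).
have m1 : 0 < 2 * (m + 1) by rewrite mulr_gt0// ltr_wpDl.
have t0 : 0 < t by exact: divr_gt0.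
have tp : 0 < t `^ (1 - p) by exact: powR_gt0.
exists (dl / 2 / t `^ (1 - p)); first by rewrite !divr_gt0.
move=> n F LF eF; have [_ /le_lt_trans] := vLp_integrable t0 LF; apply.
have h1 : t * m <= dl / 2.
  rewrite /t -mulrA invfM -mulrA ler_pM2l// -[leRHS]mulr1 ler_pM2l ?invr_gt0//.
  by rewrite mulrC ler_pdivrMr ?mul1r ?lerDl// ltr_wpDl.
have h2 : t `^ (1 - p) * energy F < dl / 2 by rewrite mulrC -ltr_pdivlMr.
by rewrite (splitr dl) ler_ltD.
Qed.

Lemma vLp_flux_integrable n (F G : T -> 'rV[R]_n) : vLp F -> vLp G ->
  L (fun x => dot (p_flux p (F x)) (G x)).
Proof.
move=> [mF LF] [mG LG]; have Lg := integrableD_EFin mD LF LG.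
have mfl j : measurable_fun D (fun x => p_flux p (F x) ord0 j).
  under eq_fun do rewrite mxE; apply: measurable_funM => //.
  exact/measurable_powR_comp/measurable_enorm.
apply: (integrable_le mD (measurable_dot mfl mG) Lg) => x _.
apply: le_trans (cauchy_schwarz _ _) _; rewrite enorm_p_flux//.
have := powR_young p1 ltr01 (enorm_ge0 (F x)) (enorm_ge0 (G x)).
by rewrite invr1 powR1 !mul1r.
Qed.

(* |x|^(p-1) |y| <= |x|^p / t + t^(p-1) |y|^p, integrated. *)
Lemma vLp_flux_diff n (F1 F2 G : T -> 'rV[R]_n) (t : R) : 0 < t ->
  vLp F1 -> vLp F2 -> vLp G ->
  `|I (fun x => dot (p_flux p (F1 x)) (G x)) - I (fun x => dot (p_flux p (F2 x)) (G x))|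
  <= 3 * (t^-1 * energy (fun x => F1 x - F2 x) + t `^ (p - 1) * energy G).
Proof.
move=> t0 LF1 LF2 LG.
have L1 := vLp_flux_integrable LF1 LG; have L2 := vLp_flux_integrable LF2 LG.
have [[_ LB] _] := vLpB LF1 LF2; have [mG LG'] := LG.
rewrite -RintegralB//; apply: le_trans (le_normr_Rintegral mD (integrableB_EFin mD L1 L2)) _.
have La := integrableZ_EFin mD t^-1 LB; have Lb := integrableZ_EFin mD (t `^ (p - 1)) LG'.
rewrite /energy -(@RintegralZl _ _ _ mu D _ t^-1 mD LB).
rewrite -(@RintegralZl _ _ _ mu D _ (t `^ (p - 1)) mD LG') -(RintegralD mD La Lb).
rewrite -(@RintegralZl _ _ _ mu D _ 3 mD (integrableD_EFin mD La Lb)).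
apply: le_Rintegral => //.
- exact: (integrable_norm_EFin (integrableB_EFin mD L1 L2)).
- exact: (integrableZ_EFin mD 3 (integrableD_EFin mD La Lb)).
move=> x _; rewrite -dotBl; apply: le_trans (cauchy_schwarz _ _) _.
apply: le_trans (ler_wpM2r (enorm_ge0 _) (p_flux_hoelder _ _ p12)) _.
by rewrite -mulrA ler_wpM2l//; exact: powR_young (enorm_ge0 _) (enorm_ge0 _).
Qed.

(** Dominated convergence along the levels k + 1. It is meant for products of F with a bounded
    scalar factor, which are easily estimated where F is bounded by K. *)
Lemma vLp_tail n (F : T -> 'rV[R]_n) (e : R) : vLp F -> 0 < e ->
  exists2 K : R, 0 < K & L (fun x => if enorm (F x) <= K then 0 else enorm (F x) `^ p) /\
    I (fun x => if enorm (F x) <= K then 0 else enorm (F x) `^ p) < e.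
Proof.
move=> [mF LF] e0; set g := fun x => enorm (F x) `^ p.
pose f k x : R := if enorm (F x) <= k.+1%:R then 0 else g x.
have mf k : measurable_fun D (f k).
  have mle := measurable_fun_ler (measurable_enorm mF) (@measurable_cst _ _ _ _ D (k.+1%:R : R)).
  apply: (measurable_fun_if mD mle) => //.
  apply: measurable_funS (integrable_measurable LF) => //.
have fg k x : D x -> `|f k x| <= g x.
  by move=> _; rewrite /f; case: ifP => _; rewrite ?normr0 ?ger0_norm ?powR_ge0.
have cv x : f k x @[k --> \oo] --> (0 : R).
  apply: (@cvg_trans _ ((cst (0 : R)) @ \oo)); last exact: cvg_cst.
  apply: near_eq_cvg; near=> k; rewrite /f ifT//.
  have : enorm (F x) <= k%:R by near: k; exact: nbhs_infty_ger.
  by move=> /le_trans; apply; rewrite ler_nat.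
have := Rintegral_cvg_dominated mD mf (@measurable_cst _ _ _ _ D (0 : R)) (aeW _ (fun x _ => cv x)) LF fg.
rewrite Rintegral_cst// mul0r => /cvgr0Pnorm_lt/(_ _ e0) [k _ /(_ k (leqnn _))] h.
exists k.+1%:R; first by rewrite ltr0n.
split; first exact: (integrable_le mD (mf k) LF (fg k)).
exact: le_lt_trans (ler_norm _) h.
Unshelve. all: by end_near. Qed.

(* A sequence with energies of the increments at most 4^-k is summable in L^1
   with rate 2^-k, hence converges almost everywhere; conclude by Fatou. *)
Lemma vLp_complete n (F : nat -> T -> 'rV[R]_n) : (forall k, vLp (F k)) ->
  (forall k l, (k <= l)%N -> energy (fun x => F l x - F k x) <= 4^-1 ^+ k) ->
  exists2 G, vLp G & forall k, energy (fun x => G x - F k x) <= 4^-1 ^+ k.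
Proof.
move=> LF CF; set m := fine (mu D); have m0 : 0 <= m by exact: fine_ge0.
pose a k x := enorm (F k.+1 x - F k x).
have LB k l : vLp (fun x => F l x - F k x) by have [] := vLpB (LF l) (LF k).
have La k : L (a k) /\ I (a k) <= (m + 1) * 2^-1 ^+ k.
  (* With t = 2^-k the two terms of [vLp_integrable] are at most 2^-k m and 2^(k (p-1)) 4^-k, and
     the latter is at most 2^-k because p <= 2. *)
  have t0 : 0 < 2^-1 ^+ k :> R by rewrite exprn_gt0// invr_gt0.
  have [h1 h2] := vLp_integrable t0 (LB k k.+1); split => //.
  apply: le_trans h2 _; rewrite mulrDl mul1r [m * _]mulrC lerD2l.
  apply: le_trans (ler_wpM2l (powR_ge0 _ _) (CF k k.+1 (leqnSn k))) _.
  have -> : 4^-1 ^+ k = 2^-1 ^+ k * 2^-1 ^+ k :> R.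
    by rewrite -exprMn; congr (_ ^+ k); lra.
  rewrite mulrA ler_piMl ?(ltW t0)//.
  have pp : (2^-1 ^+ k) `^ (1 - p) * 2^-1 ^+ k = (2^-1 ^+ k) `^ (2 - p) :> R.
    rewrite -[X in _ * X]powRr1 ?(ltW t0)// -powRD; last by rewrite implybE (gt_eqF t0) orbT.
    by congr (_ `^ _); ring.
  rewrite pp [leRHS](_ : 1 = 1 `^ (2 - p)); last by rewrite powR1.
  apply: ge0_ler_powR; rewrite ?nnegrE ?(ltW t0)//.
    by rewrite subr_ge0; case/andP: p12.
  by apply: exprn_ile1; rewrite ?invr_ge0// invf_le1// ler1n.
have a0 k x : 0 <= a k x by exact: enorm_ge0.
have ma k : measurable_fun D (fun x => (a k x)%:E).
  by apply/measurable_EFinP; exact: integrable_measurable (La k).1.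
pose S x := (\sum_(0 <= k <oo) (a k x)%:E)%E.
have LS : mu.-integrable D S.
  have S0 x : (0 <= S x)%E by apply: nneseries_ge0 => k _ _; rewrite lee_fin.
  apply/integrableP; split.
    by apply: ge0_emeasurable_sum => [k x Dx _|k _]; [rewrite lee_fin|exact: ma].
  rewrite (eq_integral S) => [|x _]; last by rewrite gee0_abs.
  rewrite integral_nneseries//; last by move=> k x _; rewrite lee_fin.
  (* The bound (m + 1) 2^-k is written as 2 (m + 1) / 2^(k+1), the terms of a series with sum 2 (m +
     1). *)
  apply: (@le_lt_trans _ _ (\sum_(0 <= k <oo) ((2 * (m + 1)) / (2 ^ k.+1)%:R)%:E)%E).
    apply: lee_nneseries => [k _ _|k _].
      by apply: integral_ge0 => x _; rewrite lee_fin.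
    rewrite -(EFin_Rintegral mD (La k).1) lee_fin; apply: le_trans (La k).2 _.
    rewrite le_eqVlt; apply/orP; left; apply/eqP.
    by rewrite natrX exprS invfM exprVn; field; rewrite expf_neq0.
  apply: le_lt_trans (ltry (2 * (m + 1))).
  by apply: epsilon_trick0; rewrite mulr_ge0// addr_ge0.
have cvF j : {ae mu, forall x, D x -> cvgn (fun k => F k x ord0 j)}.
  apply: filterS (integrable_ae mD LS) => x h Dx; have {h} Sx := h Dx.
  apply: (@summable_cvgn _ _ (fine (S x))) => N.
  rewrite -lee_fin fineK//.
  apply: (@le_trans _ _ (\sum_(0 <= k < N) (a k x)%:E)%E).
    rewrite sumEFin lee_fin big_mkord; apply: ler_sum => k _.
    by have := entry_le_enorm (F k.+1 x - F k x) j; rewrite !mxE.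
  by apply: nneseries_lim_ge => k _ _; rewrite lee_fin.
have /choice[g hg] : forall j, exists g : T -> R, measurable_fun D g /\
    {ae mu, forall x, D x -> F k x ord0 j @[k --> \oo] --> g x}.
  move=> j; have [g mg cg] := ae_cvgn_measurable mD (fun k => (LF k).1 j) (cvF j).
  by exists g.
pose G x : 'rV[R]_n := \row_j g j x.
have mG j : measurable_fun D (fun x => G x ord0 j).
  by under eq_fun do rewrite mxE; exact: (hg j).1.
have cvG : {ae mu, forall x j, D x -> F k x ord0 j @[k --> \oo] --> G x ord0 j}.
  by apply: filter_forall => j; apply: filterS (hg j).2 => x h Dx; rewrite mxE; exact: h.
have mGF k : measurable_fun D (fun x => (enorm (G x - F k x) `^ p)%:E).
  apply/measurable_EFinP/measurable_powR_comp/measurable_enorm => j.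
  under eq_fun do rewrite !mxE; apply: measurable_funB; first exact: (hg j).1.
  exact: (LF k).1.
have fatouG k : (\int[mu]_(x in D) (enorm (G x - F k x) `^ p)%:E <= (4^-1 ^+ k)%:E)%E.
  (* The index is shifted by k, so that the Cauchy estimate holds for every term of the sequence to
     which Fatou's lemma is applied. *)
  pose f l x := ((enorm (F (l + k)%N x - F k x) `^ p)%:E : \bar R).
  have mf l : measurable_fun D (f l).
    by apply/measurable_EFinP; exact: integrable_measurable (LB k (l + k)%N).2.
  have f0 l x : D x -> (0 <= f l x)%E by rewrite lee_fin powR_ge0.
  have := fatou mu mD mf f0.
  rewrite (_ : (\int[mu]_(x in D) limn_einf (f ^~ x))%E =
      (\int[mu]_(x in D) (enorm (G x - F k x) `^ p)%:E)%E); last first.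
    apply: ae_eq_integral => //.
      rewrite (_ : (fun x => _) = fun x => (- limn_esup (fun l => - f l x))%E); last first.
        by apply/funext => x; rewrite -[LHS]oppeK -limn_esupN.
      apply: measurableT_comp => //.
      apply: (@measurable_fun_limn_esup _ _ _ D (fun l x => - f l x)%E) => l.
      exact: measurableT_comp.
    apply: filterS cvG => x h Dx.
    suff : f l x @[l --> \oo] --> (enorm (G x - F k x) `^ p)%:E.
      by move=> /cvg_limn_einf_sup[].
    apply: cvg_EFin; first exact: nearW.
    apply: cvg_powR => [||]; [exact: ltW|by move=> ?; exact: enorm_ge0|].
    apply: cvg_enorm => j; rewrite !mxE; under eq_fun do rewrite !mxE.
    apply: cvgB; last exact: cvg_cst.
    by rewrite (cvg_shiftn k (fun l => F l x ord0 j)); have := h j Dx; rewrite mxE.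
  move=> /le_trans; apply; apply: le_trans (limn_einf_sup _) _.
  rewrite limn_esup_lim; apply: lime_le; first exact: is_cvg_esups.
  apply: nearW => N; apply: ge_ereal_sup => _ [l _ <-].
  by rewrite -(EFin_Rintegral mD (LB k (l + k)%N).2) lee_fin CF// leq_addl.
have LGF k : vLp (fun x => G x - F k x) /\ energy (fun x => G x - F k x) <= 4^-1 ^+ k.
  have Lk : L (fun x => enorm (G x - F k x) `^ p).
    have mk := (measurable_EFinP _ _).1 (mGF k).
    apply: (ge0_integrable mk) => [x _|]; first exact: powR_ge0.
    exact: le_lt_trans (fatouG k) (ltry _).
  split; last by rewrite -lee_fin /energy (EFin_Rintegral mD Lk).
  split=> // j; under eq_fun do rewrite !mxE; apply: measurable_funB; first exact: (hg j).1.
  exact: (LF k).1.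
exists G => [|k]; last exact: (LGF k).2.
have [] := vLpD (LGF 0%N).1 (LF 0%N).
by under [X in vLp X]eq_fun do rewrite subrK.
Qed.

End vector_Lp.

(** * The closure of the test functions *)

Section jets.
Context {R : realType} {N : nat}.
Local Notation E := 'rV[R]_N.

Lemma sqr_enorm_row_mx (a : R) (y : E) :
  enorm (row_mx a%:M y : 'rV_(1 + N)) ^+ 2 = a ^+ 2 + enorm y ^+ 2.
Proof.
rewrite !sqr_enorm /dot big_split_ord /= big_ord1 row_mxEl mxE eqxx mulr1n expr2.
by congr (_ + _); apply: eq_bigr => j _; rewrite row_mxEr.
Qed.

Lemma norm_le_enorm_row_mx (a : R) (y : E) : `|a| <= enorm (row_mx a%:M y : 'rV_(1 + N)).
Proof.
rewrite -ler_sqr ?nnegrE ?enorm_ge0// sqr_enorm_row_mx.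
by rewrite real_normK ?num_real// lerDl sqr_ge0.
Qed.

Lemma enorm_le_enorm_row_mx (a : R) (y : E) :
  enorm y <= enorm (row_mx a%:M y : 'rV_(1 + N)).
Proof. by rewrite -ler_sqr ?nnegrE ?enorm_ge0// sqr_enorm_row_mx lerDr sqr_ge0. Qed.

Lemma enorm_row_mx_le (a : R) (y : E) :
  enorm (row_mx a%:M y : 'rV_(1 + N)) <= `|a| + enorm y.
Proof.
rewrite -ler_sqr ?nnegrE ?addr_ge0 ?enorm_ge0// sqr_enorm_row_mx sqrrD.
by rewrite real_normK ?num_real// lerD2r lerDl mulrn_wge0// mulr_ge0// enorm_ge0.
Qed.

Lemma row_mx_scalarB (a b : R) (y z : E) :
  row_mx a%:M y - row_mx b%:M z = row_mx (a - b)%:M (y - z) :> 'rV_(1 + N).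
Proof. by rewrite opp_row_mx add_row_mx raddfB. Qed.

Lemma row_mx_scalarD (a b : R) (y z : E) :
  row_mx a%:M y + row_mx b%:M z = row_mx (a + b)%:M (y + z) :> 'rV_(1 + N).
Proof. by rewrite add_row_mx raddfD. Qed.

Lemma row_mx_scalarZ (c a : R) (y : E) :
  c *: row_mx a%:M y = row_mx (c * a)%:M (c *: y) :> 'rV_(1 + N).
Proof. by rewrite scale_row_mx scale_scalar_mx. Qed.

(** A function and its gradient as one vector field: the L^p theory of vector fields, completeness
    included, then covers the Sobolev norm. *)
Definition jet (u : E -> R) (G : E -> E) (x : E) : 'rV[R]_(1 + N) := row_mx (u x)%:M (G x).

End jets.

Section test_closure.
Context {R : realType} {N : nat}.
Local Notation E := 'rV[R]_N.
Local Notation leb := (lebesgue_rV R N).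
Variables (Om : set E) (p : R).
Hypotheses (oOm : open Om) (bOm : bounded_set Om) (p12 : 1 < p <= 2).
Implicit Types (phi psi u v : E -> R) (G V : E -> E).
Local Notation L f := (leb.-integrable Om (EFin \o f)).
Local Notation I f := (Rintegral leb Om f).
Local Notation LP := (vLp leb Om p).
Local Notation EN := (energy leb Om p).

Let mOm : measurable Om. Proof. exact: open_measurable_rV. Qed.
Let finOm : (leb Om < +oo)%E. Proof. exact: lebesgue_rV_bounded. Qed.
Let p1 : 1 < p. Proof. by case/andP: p12. Qed.
Let p0 : 0 < p. Proof. exact: lt_trans p1. Qed.
Let p12' : 1 <= p <= 2. Proof. by case/andP: p12 => /ltW -> ->. Qed.

Let split8 (a b c e : R) : c <= 4 * (a + b) -> a < e / 8 -> b < e / 8 -> c < e.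
Proof. lra. Qed.

Let fk_sum (a b c1 c2 x y g z dl : R) : c1 * x <= c1 * (g + dl) -> c2 * y <= c2 * (z + dl) ->
  a <= b + dl -> b <= c1 * x + c2 * y -> a <= c1 * g + c2 * z + (c1 + c2 + 1) * dl.
Proof. rewrite !mulrDr; lra. Qed.

Let trunc_sum (x y d s t z dl : R) : 0 < dl -> x <= y -> y < dl / 16 -> z <= s + t ->
  s <= dl / 16 -> t < dl / 16 -> 4 * (x + z) < dl.
Proof. lra. Qed.

Lemma energy_triangle n (F G H : E -> 'rV[R]_n) : LP F -> LP G -> LP H ->
  EN (fun x => F x - H x) <= 4 * (EN (fun x => F x - G x) + EN (fun x => G x - H x)).
Proof.
move=> LF LG LH; have [LFG _] := vLpB mOm p12 LF LG; have [LGH _] := vLpB mOm p12 LG LH.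
have [_] := vLpD mOm p12 LFG LGH.
by under [X in energy _ _ _ X]eq_fun do rewrite addrA subrK.
Qed.

Lemma measurable_jet u G : measurable_fun Om u ->
  (forall j, measurable_fun Om (fun x => G x ord0 j)) ->
  forall j, measurable_fun Om (fun x => jet u G x ord0 j).
Proof.
move=> mu mG j; case: (split_ordP j) => i ->; last first.
  by have := mG i; congr measurable_fun; apply/funext => x; rewrite /jet row_mxEr.
have := mu; congr measurable_fun.
by apply/funext => x; rewrite /jet row_mxEl mxE (ord1 i) eqxx mulr1n.
Qed.

Lemma vLp_jetP u G : LP (jet u G) <-> LP G /\
  (measurable_fun Om u /\ L (fun x => `|u x| `^ p)).
Proof.
have mn (f : E -> R) : measurable_fun Om f -> measurable_fun Om (fun x : E => `|f x| `^ p).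
  by move=> mf; apply: measurable_powR_norm.
split=> [[mJ LJ]|[[mG LG] [mu Lu]]].
  have mu : measurable_fun Om u.
    have := mJ (lshift N ord0); congr measurable_fun.
    by apply/funext => x; rewrite /jet row_mxEl mxE eqxx mulr1n.
  have mG j : measurable_fun Om (fun x => G x ord0 j).
    by have := mJ (rshift 1 j); congr measurable_fun; apply/funext => x; rewrite /jet row_mxEr.
  split; [split; [exact: mG|]|split; [exact: mu|]].
    apply: (integrable_le mOm _ LJ) => [|x _].
      exact/measurable_powR_comp/measurable_enorm.
    rewrite ger0_norm ?powR_ge0//; apply: ge0_ler_powR; rewrite ?nnegrE ?enorm_ge0//.
      exact: ltW.
    exact: enorm_le_enorm_row_mx.
  apply: (integrable_le mOm (mn _ mu) LJ) => x _.
  rewrite ger0_norm ?powR_ge0//; apply: ge0_ler_powR; rewrite ?nnegrE ?enorm_ge0//.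
    exact: ltW.
  exact: norm_le_enorm_row_mx.
have mJ := measurable_jet mu mG.
split; first exact: mJ.
have Lg := integrableZ_EFin mOm 4 (integrableD_EFin mOm Lu LG).
apply: (integrable_le mOm _ Lg) => [|x _].
  exact/measurable_powR_comp/measurable_enorm.
rewrite ger0_norm ?powR_ge0//.
apply: le_trans (powR_addl p12 (normr_ge0 _) (enorm_ge0 _)).
apply: ge0_ler_powR; rewrite ?nnegrE ?addr_ge0 ?enorm_ge0//; first exact: ltW.
exact: enorm_row_mx_le.
Qed.

Lemma energy_jet u G : LP (jet u G) ->
  [/\ I (fun x => `|u x| `^ p) <= EN (jet u G), EN G <= EN (jet u G) &
      EN (jet u G) <= 4 * (I (fun x => `|u x| `^ p) + EN G)].
Proof.
move=> LJ; have [[_ LJ'] [[_ LG] [_ Lu]]] := (LJ, (vLp_jetP u G).1 LJ).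
split.
- apply: (le_Rintegral mOm Lu LJ') => x _; apply: ge0_ler_powR; rewrite ?nnegrE ?enorm_ge0//.
    exact: ltW.
  exact: norm_le_enorm_row_mx.
- apply: (le_Rintegral mOm LG LJ') => x _; apply: ge0_ler_powR; rewrite ?nnegrE ?enorm_ge0//.
    exact: ltW.
  exact: enorm_le_enorm_row_mx.
have Ls := integrableD_EFin mOm Lu LG.
rewrite /energy -(RintegralD mOm Lu LG) -(@RintegralZl _ _ _ leb Om _ 4 mOm Ls).
apply: (le_Rintegral mOm LJ' (integrableZ_EFin mOm 4 Ls)) => x _.
apply: le_trans (powR_addl p12 (normr_ge0 _) (enorm_ge0 _)).
apply: ge0_ler_powR; rewrite ?nnegrE ?addr_ge0 ?enorm_ge0//; first exact: ltW.
exact: enorm_row_mx_le.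
Qed.

Lemma jetB u G v V : (fun x => jet u G x - jet v V x) =
  jet (fun x => u x - v x) (fun x => G x - V x).
Proof. by apply/funext => x; exact: row_mx_scalarB. Qed.

(* The pairs (u, G) such that u lies in the closure of the test functions for the
   Sobolev norm, with gradient G. *)
Definition test_closure u G := LP (jet u G) /\ forall e, 0 < e ->
  exists2 phi, test_function Om phi & EN (fun x => jet u G x - jet phi (grad phi) x) < e.

Lemma vLp_jet_test phi : test_function Om phi -> LP (jet phi (grad phi)).
Proof.
move=> tphi; have [sphi _ _] := tphi; apply/vLp_jetP; split; first split.
- by move=> j; apply: measurable_funTS; exact: measurable_grad_coord.
- exact: integrable_enorm_grad tphi.
have mphi : measurable_fun Om phi by apply: measurable_funTS; exact: smooth_measurable.
split => //; have [C C0 HC] := test_function_bounded tphi.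
apply: (integrable_le mOm (measurable_powR_norm _ mphi) (integrable_cst_EFin mOm (C `^ p) finOm)).
move=> x _; rewrite ger0_norm ?powR_ge0//; apply: ge0_ler_powR; rewrite ?nnegrE//.
exact: ltW.
Qed.

Lemma test_closure_test phi : test_function Om phi -> test_closure phi (grad phi).
Proof.
move=> tphi; split=> [|e e0]; first exact: vLp_jet_test.
exists phi => //; rewrite [X in X < _](_ : _ = I (cst 0)).
  by rewrite Rintegral_cst// mul0r.
by apply: eq_Rintegral => x _; rewrite subrr enorm0 powR0 ?gt_eqF.
Qed.

Lemma test_closureD u G v V : test_closure u G -> test_closure v V ->
  test_closure (fun x => u x + v x) (fun x => G x + V x).
Proof.
move=> [Lu cu] [Lv cv].
have jD : jet (fun x => u x + v x) (fun x => G x + V x) = fun x => jet u G x + jet v V x.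
  by apply/funext => x; rewrite /jet row_mx_scalarD.
split=> [|e e0]; first by rewrite jD; case: (vLpD mOm p12 Lu Lv).
have e8 : 0 < e / 8 by rewrite divr_gt0.
have [phi tphi hphi] := cu _ e8; have [psi tpsi hpsi] := cv _ e8.
have [[sphi _ _] [spsi _ _]] := (tphi, tpsi).
exists (phi + psi); first exact: test_functionD.
have [Lphi _] := vLpB mOm p12 Lu (vLp_jet_test tphi).
have [Lpsi _] := vLpB mOm p12 Lv (vLp_jet_test tpsi).
have [_] := vLpD mOm p12 Lphi Lpsi.
rewrite (_ : (fun x => _ - _ + _) =
  fun x => jet (fun x => u x + v x) (fun x => G x + V x) x - jet (phi + psi) (grad (phi + psi)) x).
  by move=> h; exact: split8 h hphi hpsi.
apply/funext => x; rewrite jD addrACA -opprD; congr (_ - _).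
rewrite /jet row_mx_scalarD; congr (row_mx _ _); apply/rowP => j; rewrite !mxE.
by rewrite partialD//; exact: smooth_differentiable.
Qed.

Lemma test_closureZ c u G : test_closure u G ->
  test_closure (fun x => c * u x) (fun x => c *: G x).
Proof.
move=> [Lu cu].
have jZ : jet (fun x => c * u x) (fun x => c *: G x) = fun x => c *: jet u G x.
  by apply/funext => x; rewrite /jet row_mx_scalarZ.
split=> [|e e0]; first by rewrite jZ; case: (vLpZ mOm c Lu).
have c0 : 0 < `|c| `^ p + 1 by rewrite ltr_wpDl// powR_ge0.
have [phi tphi hphi] := cu _ (divr_gt0 e0 c0); have [sphi _ _] := tphi.
exists (fun x => c * phi x); first exact: test_functionZ.
have [Lphi _] := vLpB mOm p12 Lu (vLp_jet_test tphi).
have [_] := vLpZ mOm c Lphi.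
rewrite (_ : (fun x => c *: (_ - _)) = fun x => jet (fun x => c * u x) (fun x => c *: G x) x
   - jet (fun x => c * phi x) (grad (fun x => c * phi x)) x).
  move=> ->; rewrite ltr_pdivlMr// mulrC in hphi; apply: le_lt_trans hphi.
  by rewrite ler_wpM2r ?energy_ge0// lerDl.
apply/funext => x; rewrite jZ scalerBr; congr (_ - _).
rewrite /jet row_mx_scalarZ; congr (row_mx _ _); apply/rowP => j; rewrite !mxE.
by rewrite partialZ//; exact: smooth_differentiable.
Qed.

Lemma test_closureB u G v V : test_closure u G -> test_closure v V ->
  test_closure (fun x => u x - v x) (fun x => G x - V x).
Proof.
move=> cu /(test_closureZ (-1)) cv.
rewrite (_ : (fun x => u x - v x) = fun x => u x + -1 * v x).
  rewrite (_ : (fun x => G x - V x) = fun x => G x + -1 *: V x).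
    exact: test_closureD.
  by apply/funext => x; rewrite scaleN1r.
by apply/funext => x; rewrite mulN1r.
Qed.

Lemma test_closure_closed u G : LP (jet u G) ->
  (forall e, 0 < e -> exists v V, test_closure v V /\
     EN (fun x => jet u G x - jet v V x) < e) -> test_closure u G.
Proof.
move=> Lu cu; split=> // e e0; have e8 : 0 < e / 8 by rewrite divr_gt0.
have [v [V [[Lv cv] uv]]] := cu _ e8; have [phi tphi hphi] := cv _ e8.
exists phi => //.
exact: split8 (energy_triangle Lu Lv (vLp_jet_test tphi)) uv hphi.
Qed.


Lemma ler_add_eps (a b c : R) : (forall e, 0 < e -> a <= b + c * e) -> a <= b.
Proof.
move=> h; apply/ler_addgt0Pr => e e0; have c0 : 0 < `|c| + 1 by rewrite ltr_wpDl.
apply: le_trans (h _ (divr_gt0 e0 c0)) _; rewrite lerD2l mulrCA ler_piMr ?(ltW e0)//.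
by rewrite ler_pdivrMr// mul1r; apply: le_trans (ler_norm _) _; rewrite lerDl.
Qed.

Lemma test_closure_poincare : (0 < N)%N -> exists2 C : R, 0 <= C &
  forall u G, test_closure u G -> EN (jet u G) <= C * EN G.
Proof.
move=> N0; have [C C0 HC] := poincare_test N0 bOm p12'.
(* One factor 4 each for passing from the jet of u to the jet of phi, from there to grad phi, and
   from grad phi to G. *)
exists (64 * (C + 1)) => [|u G [Lu cu]]; first by rewrite mulr_ge0// addr_ge0.
apply: (@ler_add_eps _ _ (64 * (C + 1) + 4)) => e e0; have [phi tphi hphi] := cu _ e0.
have Lphi := vLp_jet_test tphi; have [_ _ Ephi] := energy_jet Lphi.
have [LD _] := vLpB mOm p12 Lu Lphi.
have ED : EN (fun x => G x - grad phi x) <= e.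
  apply: le_trans (ltW hphi); rewrite jetB in LD *.
  by have [_ h _] := energy_jet LD; exact: h.
have Eg : EN (grad phi) <= 4 * (EN G + e).
  have [LG _] := (vLp_jetP u G).1 Lu; have [Lg _] := (vLp_jetP phi _).1 Lphi.
  have [LGg _] := vLpB mOm p12 LG Lg; have [_] := vLpB mOm p12 LG LGg.
  under [X in energy _ _ _ X]eq_fun do rewrite subKr.
  by move=> /le_trans; apply; rewrite ler_pM2l// lerD2l.
have Pphi : I (fun x => `|phi x| `^ p) <= C * EN (grad phi).
  have e1 : I (fun x => `|phi x| `^ p) = \int[leb]_x (`|phi x| `^ p).
    apply: Rintegral_support => x Ox.
    by rewrite (test_function_out tphi Ox) normr0 powR0 ?gt_eqF.
  have e2 : EN (grad phi) = \int[leb]_x (enorm (grad phi x) `^ p).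
    by apply: Rintegral_support => x Ox; rewrite (grad_out tphi Ox) enorm0 powR0 ?gt_eqF.
  by rewrite e1 e2; exact: HC tphi.
have Eu : EN (jet u G) <= 4 * (EN (fun x => jet u G x - jet phi (grad phi) x) + EN (jet phi (grad phi))).
  have [_] := vLpD mOm p12 LD Lphi.
  rewrite (_ : (fun x => _ + _) = jet u G) //.
  by apply/funext => x; rewrite subrK.
apply: le_trans Eu _.
have C1 : 0 <= 16 * (C + 1) by rewrite mulr_ge0// addr_ge0.
have h1 : EN (jet phi (grad phi)) <= 4 * ((C + 1) * EN (grad phi)).
  by apply: le_trans Ephi _; rewrite (mulrDl C 1) mul1r ler_pM2l// lerD2r.
have h2 : 4 * ((C + 1) * EN (grad phi)) <= 16 * (C + 1) * (EN G + e).
  rewrite (_ : 16 * (C + 1) * (EN G + e) = 4 * ((C + 1) * (4 * (EN G + e)))); last by ring.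
  by rewrite ler_pM2l// ler_wpM2l// addr_ge0.
rewrite (_ : _ + _ * e = 4 * (e + 16 * (C + 1) * (EN G + e))); last by ring.
apply: ler_wpM2l; first exact: ler0n.
exact: lerD (ltW hphi) (le_trans h1 h2).
Qed.

Lemma test_closure_integrable u G : test_closure u G -> L u /\ L (fun x => enorm (G x)).
Proof.
move=> [Lu _]; have [LG [mu _]] := (vLp_jetP u G).1 Lu.
have [LJ _] := vLp_integrable mOm finOm p12 ltr01 Lu.
split; last by have [] := vLp_integrable mOm finOm p12 ltr01 LG.
by apply: (integrable_le mOm mu LJ) => x _; exact: norm_le_enorm_row_mx.
Qed.

Lemma test_closure_L1 u G dl : 0 < dl -> test_closure u G ->
  exists2 phi, test_function Om phi &
    I (fun x => `|u x - phi x|) < dl /\ I (fun x => enorm (G x - grad phi x)) < dl.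
Proof.
move=> dl0 cu; have [Lu Au] := cu.
have [e e0 he] := vLp_L1_small mOm finOm p12 dl0; have [phi tphi hphi] := Au _ e0.
exists phi => //; have cD := test_closureB cu (test_closure_test tphi).
have [LD _] := cD; have [L1 L2] := test_closure_integrable cD.
rewrite jetB in hphi; have hD := he _ _ LD hphi.
have [LJ _] := vLp_integrable mOm finOm p12 ltr01 LD.
split; apply: le_lt_trans hD.
  apply: (le_Rintegral mOm (integrable_norm_EFin L1) LJ) => x _.
  exact: norm_le_enorm_row_mx.
by apply: (le_Rintegral mOm L2 LJ) => x _; exact: enorm_le_enorm_row_mx.
Qed.

(** Every integral in the inequality for test functions is continuous with respect to L^1
    convergence of u and G. *)
Lemma test_closure_faber_krahn u G (A : set E) (e : R) : test_closure u G ->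
  measurable A -> A `<=` Om -> 0 < e ->
  \int[leb]_(x in A) `|u x| <=
  N%:R * e * I (fun x => enorm (G x)) + e ^- N * fine (leb A) * I (fun x => `|u x|).
Proof.
move=> cu mA AO e0; have [Lu LG] := test_closure_integrable cu.
have finA : (leb A < +oo)%E by apply: le_lt_trans finOm; apply: le_measure; rewrite ?inE.
set c1 := N%:R * e; set c2 := e ^- N * fine (leb A).
have c10 : 0 <= c1 by rewrite mulr_ge0// ltW.
have c20 : 0 <= c2 by rewrite mulr_ge0 ?fine_ge0// invr_ge0 exprn_ge0// ltW.
apply: (@ler_add_eps _ _ (c1 + c2 + 1)) => dl dl0.
have [phi tphi [h1 h2]] := test_closure_L1 dl0 cu.
have [Lp Lg] := test_closure_integrable (test_closure_test tphi).
have LD := integrable_norm_EFin (integrableB_EFin mOm Lu Lp).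
have LDg := (test_closure_integrable (test_closureB cu (test_closure_test tphi))).2.
have fk := faber_krahn_test tphi mA finA e0.
have e1 : I (fun x => enorm (grad phi x)) = \int[leb]_x enorm (grad phi x).
  by apply: Rintegral_support => x Ox; rewrite (grad_out tphi Ox) enorm0.
have e2 : I (fun x => `|phi x|) = \int[leb]_x `|phi x|.
  by apply: Rintegral_support => x Ox; rewrite (test_function_out tphi Ox) normr0.
rewrite -e1 -e2 -/c1 -/c2 in fk.
have s1 : I (fun x => enorm (grad phi x)) <= I (fun x => enorm (G x)) + dl.
  apply: le_trans (_ : _ <= I (fun x => enorm (G x)) + I (fun x => enorm (G x - grad phi x))) _.
    rewrite -(RintegralD mOm LG LDg).
    apply: (le_Rintegral mOm Lg (integrableD_EFin mOm LG LDg)) => x _.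
    by have := enormB (G x) (G x - grad phi x); rewrite subKr.
  by rewrite lerD2l ltW.
have Lnu := integrable_norm_EFin Lu; have Lnp := integrable_norm_EFin Lp.
have s2 : I (fun x => `|phi x|) <= I (fun x => `|u x|) + dl.
  apply: le_trans (_ : _ <= I (fun x => `|u x|) + I (fun x => `|u x - phi x|)) _.
    rewrite -(RintegralD mOm Lnu LD).
    apply: (le_Rintegral mOm Lnp (integrableD_EFin mOm Lnu LD)) => x _.
    by have := ler_normB (u x) (u x - phi x); rewrite subKr.
  by rewrite lerD2l ltW.
have LA f : L f -> leb.-integrable A (EFin \o f) by exact: integrableS.
have s3 : \int[leb]_(x in A) `|u x| <= \int[leb]_(x in A) `|phi x| + dl.
  apply: le_trans (_ : _ <= \int[leb]_(x in A) `|phi x| + \int[leb]_(x in A) `|u x - phi x|) _.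
    rewrite -(RintegralD mA (LA _ Lnp) (LA _ LD)).
    apply: (le_Rintegral mA (LA _ Lnu) (integrableD_EFin mA (LA _ Lnp) (LA _ LD))) => x _.
    by rewrite addrC; have := ler_normD (u x - phi x) (phi x); rewrite subrK.
  rewrite lerD2l; apply: le_trans (ltW h1).
  rewrite -lee_fin (EFin_Rintegral mA (LA _ LD)) (EFin_Rintegral mOm LD).
  apply: ge0_subset_integral => //; exact: (measurable_EFinP _ _).2 (integrable_measurable LD).
have t1 := ler_wpM2l c10 s1; have t2 := ler_wpM2l c20 s2.
exact: fk_sum t1 t2 s3 fk.
Qed.

Lemma integrable_mul_bounded (f h : E -> R) (C : R) : L f -> measurable_fun Om h ->
  (forall x, `|h x| <= C) ->
  L (fun x => f x * h x) /\ `|I (fun x => f x * h x)| <= C * I (fun x => `|f x|).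
Proof.
move=> Lf mh hC; have Lg := integrableZ_EFin mOm C (integrable_norm_EFin Lf).
have le x : `|f x * h x| <= C * `|f x| by rewrite normrM mulrC ler_wpM2r.
have Lfh : L (fun x => f x * h x).
  by apply: (integrable_le mOm _ Lg) => //; apply: measurable_funM => //; exact: integrable_measurable Lf.
split => //; apply: le_trans (le_normr_Rintegral mOm Lfh) _.
rewrite -(@RintegralZl _ _ _ leb Om _ C mOm (integrable_norm_EFin Lf)).
by apply: (le_Rintegral mOm (integrable_norm_EFin Lfh) Lg) => x _.
Qed.

(** Integration by parts holds for the approximating test functions, and both sides pass to the
    limit in L^1 because psi and its partial derivatives are bounded. *)
Lemma test_closure_weak_gradient u G : test_closure u G -> is_weak_gradient Om u G.
Proof.
move=> cu j; have [Lu LG] := test_closure_integrable cu.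
have mG i : measurable_fun Om (fun x => G x ord0 i).
  by have [[]] := (vLp_jetP u G).1 cu.1.
have LGj : L (fun x => G x ord0 j).
  by apply: (integrable_le mOm (mG j) LG) => x _; exact: entry_le_enorm.
split=> [K cK KO|psi tpsi].
  by apply: integrableS LGj => //; exact: compact_measurable_rV.
have [spsi _ _] := tpsi; have tdpsi := test_function_partial j tpsi.
have [C1 C10 HC1] := test_function_bounded tpsi.
have [C2 C20 HC2] := test_function_bounded tdpsi.
have mpsi : measurable_fun Om psi by apply: measurable_funTS; exact: smooth_measurable.
have mdpsi : measurable_fun Om (partial j psi).
  by apply: measurable_funTS; apply: smooth_measurable; case: tdpsi.
have [La _] := integrable_mul_bounded Lu mdpsi HC2.
have [Lb _] := integrable_mul_bounded LGj mpsi HC1.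
apply/eqP; rewrite -subr_eq0 opprK -normr_le0; apply: (@ler_add_eps _ _ (C1 + C2)) => dl dl0.
rewrite add0r; have [phi tphi [h1 h2]] := test_closure_L1 dl0 cu; have [sphi _ _] := tphi.
have cD := test_closureB cu (test_closure_test tphi).
have [LD LDg] := test_closure_integrable cD.
have [Lp Lg] := test_closure_integrable (test_closure_test tphi).
have Lpj : L (partial j phi).
  apply: integrable_test (test_function_partial j tphi) => //.
have LDj := integrableB_EFin mOm LGj Lpj.
have [L1 k1] := integrable_mul_bounded LD mdpsi HC2.
have [L2 k2] := integrable_mul_bounded LDj mpsi HC1.
have [L3 _] := integrable_mul_bounded Lp mdpsi HC2.
have [L4 _] := integrable_mul_bounded Lpj mpsi HC1.
have ibp : I (fun x => phi x * partial j psi x) + I (fun x => partial j phi x * psi x) = 0.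
  have e1 : I (fun x => phi x * partial j psi x) = \int[leb]_x (phi x * partial j psi x).
    by apply: Rintegral_support => x Ox; rewrite (test_function_out tphi Ox) mul0r.
  have e2 : I (fun x => partial j phi x * psi x) = \int[leb]_x (partial j phi x * psi x).
    by apply: Rintegral_support => x Ox; rewrite (test_function_out tpsi Ox) mulr0.
  by rewrite e1 e2 (integral_by_parts j sphi tpsi) addNr.
have -> : I (fun x => u x * partial j psi x) + I (fun x => component G j x * psi x) =
    I (fun x => (u x - phi x) * partial j psi x)
    + I (fun x => (G x ord0 j - partial j phi x) * psi x).
  have -> : I (fun x => (u x - phi x) * partial j psi x) =
      I (fun x => u x * partial j psi x) - I (fun x => phi x * partial j psi x).
    by rewrite -(RintegralB mOm La L3); apply: eq_Rintegral => x _; rewrite mulrBl.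
  have -> : I (fun x => (G x ord0 j - partial j phi x) * psi x) =
      I (fun x => G x ord0 j * psi x) - I (fun x => partial j phi x * psi x).
    by rewrite -(RintegralB mOm Lb L4); apply: eq_Rintegral => x _; rewrite mulrBl.
  by rewrite addrACA -opprD ibp subr0.
apply: le_trans (ler_normD _ _) _; rewrite mulrDl addrC; apply: lerD.
  apply: le_trans k2 _; rewrite ler_wpM2l//; apply: le_trans (ltW h2).
  apply: (le_Rintegral mOm (integrable_norm_EFin LDj) LDg) => x _.
  by have := entry_le_enorm (G x - grad phi x) j; rewrite !mxE.
by apply: le_trans k1 _; rewrite ler_wpM2l// ltW.
Qed.

(** Truncations of test functions approximate; k >= 0 keeps the value 0 at 0 and hence the compact
    support. The gradient error is the truncated derivative at phi times G - grad phi, plus the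
    difference of the derivatives at u and phi times G. Where |G| <= K the last part is at most C K
    |u - phi|; elsewhere it is bounded by |G|. So K is fixed by the tail of G first, and phi is
    chosen afterwards. *)
Lemma test_closure_trunc u G k e : 0 <= k -> 0 < e -> test_closure u G ->
  test_closure (fun x => trunc k e 0 (u x)) (fun x => trunc k e 1 (u x) *: G x).
Proof.
move=> k0 e0 [Lu cu]; have [[mG LG] [mu Lpu]] := (vLp_jetP u G).1 Lu.
have mt n : measurable_fun setT (trunc k e n).
  apply: continuous_measurable_fun => s; apply: differentiable_continuous.
  by apply/derivable1_diffP; case: (is_derive_trunc k e n s).
have t00 : trunc k e 0 0 = 0 by rewrite trunc0E// ltNge k0.
have t0le s : `|trunc k e 0 s| <= `|s|.
  by have := trunc0_lipschitz k s 0 e0; rewrite t00 !subr0.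
have t1le s : `|trunc k e 1 s| <= 1.
  by have /andP[t0 t1] := trunc1_itv k s e0; rewrite ger0_norm.
have t1le' s t : `|trunc k e 1 s - trunc k e 1 t| <= 1.
  have /andP[a0 a1] := trunc1_itv k s e0; have /andP[b0 b1] := trunc1_itv k t e0.
  by rewrite ler_norml; apply/andP; split; lra.
have [C C0 t1lip] := trunc1_lipschitz k e0.
have mono (a b : R) : 0 <= a <= b -> a `^ p <= b `^ p.
  move=> /andP[a0 ab]; apply: ge0_ler_powR; rewrite ?nnegrE//; first exact: ltW.
  exact: le_trans ab.
have row_le (a a' : R) (y y' : E) : `|a| <= `|a'| -> enorm y <= enorm y' ->
    enorm (row_mx a%:M y : 'rV_(1 + N)) `^ p <= enorm (row_mx a'%:M y' : 'rV_(1 + N)) `^ p.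
  move=> aa yy; apply: mono; rewrite enorm_ge0/= -ler_sqr ?nnegrE ?enorm_ge0//.
  by rewrite !sqr_enorm_row_mx lerD// -?[a ^+ 2]real_normK -?[a' ^+ 2]real_normK
    ?num_real// lerXn2r// nnegrE enorm_ge0.
have mtu n : measurable_fun Om (fun x => trunc k e n (u x)) by exact: measurableT_comp.
have mtG j : measurable_fun Om (fun x => (trunc k e 1 (u x) *: G x) ord0 j).
  by under eq_fun do rewrite mxE; exact: measurable_funM.
have scale_le (a : R) (y : E) : `|a| <= 1 -> enorm (a *: y) <= enorm y.
  by move=> a1; rewrite enormZ ler_piMl ?enorm_ge0.
have tle x : Om x -> enorm (jet (fun x => trunc k e 0 (u x)) (fun x => trunc k e 1 (u x) *: G x) x) `^ p
    <= enorm (jet u G x) `^ p.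
  by move=> _; apply: row_le; [exact: t0le|exact/scale_le/t1le].
have [Lt _] := vLp_le mOm (measurable_jet (mtu 0%N) mtG) Lu.2 tle.
apply: (test_closure_closed Lt) => dl dl0.
have d16 : 0 < dl / 16 by rewrite divr_gt0.
have [K K0 [Ltail tail]] := vLp_tail mOm (conj mG LG) d16.
have c0 : 0 < (C * K) `^ p + 1 by rewrite ltr_wpDl// powR_ge0.
have dc : 0 < Num.min (dl / 16) (dl / 16 / ((C * K) `^ p + 1)) by rewrite lt_min d16 divr_gt0.
have [phi tphi hphi] := cu _ dc; have [sphi _ _] := tphi.
have ttphi : test_function Om (trunc k e 0 \o phi).
  exact: (test_function_comp (is_derive_trunc k e) t00 tphi).
exists (trunc k e 0 \o phi), (grad (trunc k e 0 \o phi)).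
split; first exact: test_closure_test.
have gt x : grad (trunc k e 0 \o phi) x = trunc k e 1 (phi x) *: grad phi x.
  apply/rowP => j; rewrite !mxE; apply: partial_comp; last exact: is_derive_trunc.
  exact: smooth_differentiable.
have Lphi := vLp_jet_test tphi; have [[mg Lg] [mphi _]] := (vLp_jetP _ _).1 Lphi.
have [LD _] := vLpB mOm p12 Lu Lphi; rewrite jetB in LD hphi.
have [_ [_ LpD]] := (vLp_jetP _ _).1 LD; have [EuD _ _] := energy_jet LD.
pose a x := trunc k e 0 (u x) - trunc k e 0 (phi x).
pose b x := trunc k e 1 (phi x) *: (G x - grad phi x).
pose c x := (trunc k e 1 (u x) - trunc k e 1 (phi x)) *: G x.
have mtp n : measurable_fun Om (fun x => trunc k e n (phi x)) by exact: measurableT_comp.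
have mb j : measurable_fun Om (fun x => b x ord0 j).
  under eq_fun do rewrite !mxE; apply: measurable_funM => //; apply: measurable_funB => //.
  by have := mg j; under eq_fun do rewrite mxE.
have mc j : measurable_fun Om (fun x => c x ord0 j).
  by under eq_fun do rewrite !mxE; apply: measurable_funM => //; exact: measurable_funB.
have [Lab Eab] : LP (jet a b) /\ EN (jet a b) <= EN (jet (fun x => u x - phi x) (fun x => G x - grad phi x)).
  apply: (vLp_le mOm (measurable_jet (measurable_funB (mtu _) (mtp _)) mb) LD.2) => x _.
  by apply: row_le; [exact: trunc0_lipschitz|exact: scale_le].
have Lr := integrableD_EFin mOm (integrableZ_EFin mOm ((C * K) `^ p) LpD) Ltail.
have cle x : Om x -> enorm (jet (cst 0) c x) `^ p <=
    (C * K) `^ p * `|u x - phi x| `^ p + (if enorm (G x) <= K then 0 else enorm (G x) `^ p).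
  move=> _; rewrite (_ : enorm (jet (cst 0) c x) = enorm (c x)); last first.
    apply/eqP; rewrite -(@eqrXn2 _ 2) ?enorm_ge0//.
    by rewrite sqr_enorm_row_mx expr0n add0r.
  case: ifPn => GK.
    have CK0 : 0 <= C * K by rewrite mulr_ge0// ltW.
    rewrite addr0 -(powRM _ CK0 (normr_ge0 _)); apply: mono; rewrite enorm_ge0/= enormZ.
    by rewrite mulrAC; apply: ler_pM; rewrite ?enorm_ge0.
  rewrite -[leLHS]add0r lerD ?mulr_ge0 ?powR_ge0//; apply: mono; rewrite enorm_ge0/=.
  by apply: scale_le; exact: t1le'.
have [Lc Ec] := vLp_le mOm (measurable_jet (@measurable_cst _ _ _ _ Om (0 : R)) mc) Lr cle.
have -> : EN (fun x => jet (fun x => trunc k e 0 (u x)) (fun x => trunc k e 1 (u x) *: G x) x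
    - jet (trunc k e 0 \o phi) (grad (trunc k e 0 \o phi)) x)
  = EN (fun x => jet a b x + jet (cst 0) c x).
  congr (energy _ _ _ _); apply/funext => x; rewrite /jet row_mx_scalarB row_mx_scalarD addr0 gt.
  congr (row_mx _ _); rewrite /b /c scalerBr scalerBl [RHS]addrC addrA; congr (_ - _).
  by rewrite subrK.
have [_ /le_lt_trans] := vLpD mOm p12 Lab Lc; apply.
have hD1 : EN (jet (fun x => u x - phi x) (fun x => G x - grad phi x)) < dl / 16.
  by apply: lt_le_trans hphi _; rewrite ge_min lexx.
have hD2 : (C * K) `^ p * EN (jet (fun x => u x - phi x) (fun x => G x - grad phi x)) <= dl / 16.
  have : EN (jet (fun x => u x - phi x) (fun x => G x - grad phi x)) <= dl / 16 / ((C * K) `^ p + 1).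
    by apply: le_trans (ltW hphi) _; rewrite ge_min lexx orbT.
  rewrite ler_pdivlMr// mulrC; apply: le_trans.
  by rewrite ler_wpM2r ?energy_ge0// lerDl.
rewrite (RintegralD mOm (integrableZ_EFin mOm ((C * K) `^ p) LpD) Ltail) in Ec.
rewrite (@RintegralZl _ _ _ leb Om _ ((C * K) `^ p) mOm LpD) in Ec.
have h3 := ler_wpM2l (powR_ge0 (C * K) p) EuD.
exact: trunc_sum dl0 Eab hD1 Ec (le_trans h3 hD2) tail.
Qed.

End test_closure.

Section ae_equal.
Context d (T : measurableType d) (R : realType) (mu : {measure set T -> \bar R}).
Variables (D : set T) (mD : measurable D).
Implicit Types (f g : T -> R).

Lemma ae_eq_Rintegral f g : measurable_fun D f -> measurable_fun D g ->
  {ae mu, forall x, D x -> f x = g x} -> Rintegral mu D f = Rintegral mu D g.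
Proof.
move=> /measurable_EFinP mf /measurable_EFinP mg fg; congr fine.
by apply: (ae_eq_integral _ _ mD mf mg); apply: filterS fg => x h Dx /=; rewrite h.
Qed.

End ae_equal.

(** * Identification of the closure with the space W^{1,p}_0 of the statement *)

Section sobolev_closure.
Context {R : realType} {N : nat}.
Local Notation E := 'rV[R]_N.
Local Notation leb := (lebesgue_rV R N).
Variables (Om : set E) (p : R).
Hypotheses (oOm : open Om) (bOm : bounded_set Om) (p12 : 1 < p <= 2).
Implicit Types (phi psi u v : E -> R) (G V : E -> E).
Local Notation L f := (leb.-integrable Om (EFin \o f)).
Local Notation I f := (Rintegral leb Om f).
Local Notation LP := (vLp leb Om p).
Local Notation EN := (energy leb Om p).

Let mOm : measurable Om. Proof. exact: open_measurable_rV. Qed.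
Let finOm : (leb Om < +oo)%E. Proof. exact: lebesgue_rV_bounded. Qed.
Let p1 : 1 < p. Proof. by case/andP: p12. Qed.
Let p0 : 0 < p. Proof. exact: lt_trans p1. Qed.

Let two_thirds (a : R) : 0 < a -> a / 3 + a / 3 < a. Proof. lra. Qed.

(** Om is a countable union of open boxes whose closures are compact subsets of Om, and f is
    measurable on each of these. *)
Lemma measurable_loc_integrable (f : E -> R) : loc_integrable Om f -> measurable_fun Om f.
Proof.
move=> Lf _ Y mY; rewrite {1}(open_bigcup_box oOm) setI_bigcupl bigcup_mkcond.
apply: countable_bigcupT_measurable => [|[a b]]; first exact: countableP.
case: ifPn => [/set_mem /= abO|_]; last exact: measurable0.
pose a' : E := map_mx ratr a; pose b' : E := map_mx ratr b.
have cE : [set x : E | forall i, x ord0 i \in `[(ratr (a ord0 i)), (ratr (b ord0 i))]] =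
    [set x | forall i, x ord0 i \in `[a' ord0 i, b' ord0 i]].
  by apply/seteqP; split=> x h i; have := h i; rewrite !mxE.
have oE : [set x : E | forall i, x ord0 i \in `](ratr (a ord0 i)), (ratr (b ord0 i))[] =
    [set x | forall i, x ord0 i \in `]a' ord0 i, b' ord0 i[].
  by apply/seteqP; split=> x h i; have := h i; rewrite !mxE.
rewrite cE in abO; rewrite oE.
have mo := box_rV_measurable a' b'.
have kc := box_closed_compact (a := a') (b := b').
have Lc := integrable_measurable (Lf _ kc abO).
apply: (measurable_funS (compact_measurable_rV kc) _ Lc) => //.
by move=> x h i; apply: subset_itv_oo_cc; exact: h.
Qed.

Lemma Lp_normE_integral (f : E -> R) : Lp_norm Om p%:E f =
  ((\int[leb]_(x in Om) (`|f x| `^ p)%:E) `^ p^-1)%E.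
Proof.
rewrite /Lp_norm unlock [in RHS]integral_mkcond; congr (_ `^ _)%E.
apply: eq_integral => x _ /=; rewrite !patchE; case: ifPn => // _.
by rewrite (_ : point = 0 :> R)// normr0 powR0 ?gt_eqF.
Qed.

Lemma Lp_normE (f : E -> R) : L (fun x => `|f x| `^ p) ->
  Lp_norm Om p%:E f = ((I (fun x => `|f x| `^ p)) `^ p^-1)%:E.
Proof. by move=> Lf; rewrite Lp_normE_integral -(EFin_Rintegral mOm Lf) poweR_EFin. Qed.

Lemma Lp_norm_lt (f : E -> R) (e : R) : 0 < e -> (Lp_norm Om p%:E f < e%:E)%E ->
  (\int[leb]_(x in Om) (`|f x| `^ p)%:E < (e `^ p)%:E)%E.
Proof.
rewrite Lp_normE_integral => e0; apply: contraTT; rewrite -!leNgt => h.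
have : (((e `^ p)%:E `^ p^-1) <= (\int[leb]_(x in Om) (`|f x| `^ p)%:E) `^ p^-1)%E.
  apply: gt0_ler_poweR => //.
  - by rewrite invr_ge0 ltW.
  - by rewrite in_itv/= lee_fin powR_ge0 leey.
  - by rewrite in_itv/= leey andbT integral_ge0// => x _; rewrite lee_fin powR_ge0.
by rewrite poweR_EFin -powRrM divff ?gt_eqF// powRr1// ltW.
Qed.

Lemma LpP (f : E -> R) : Lp Om p%:E f <->
  measurable_fun Om f /\ L (fun x => `|f x| `^ p).
Proof.
have mn (h : E -> R) : measurable_fun Om h -> measurable_fun Om (fun x : E => `|h x| `^ p).
  by move=> mh; apply: measurable_powR_norm.
split=> [/andP[]|[mf Lf]].
  rewrite !inE /= => /(measurable_restrictT _ mOm) mf.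
  rewrite /finite_norm -/(Lp_norm Om p%:E f) Lp_normE_integral => h; split=> //.
  apply: (ge0_integrable (mn _ mf)) => [x _|]; first exact: powR_ge0.
  by apply: lty_poweRy h; rewrite invr_neq0// gt_eqF.
apply/andP; rewrite !inE /=; split; first exact/(measurable_restrictT _ mOm).
by rewrite /finite_norm -/(Lp_norm Om p%:E f) (Lp_normE Lf) ltry.
Qed.

Lemma is_weak_gradientB u v F G : L u -> L v ->
  (forall j, measurable_fun Om (component F j)) ->
  is_weak_gradient Om u F -> is_weak_gradient Om v G ->
  is_weak_gradient Om (fun x => u x - v x) (fun x => F x - G x).
Proof.
move=> Lu Lv mF uF vG j; have [lF hF] := uF j; have [lG hG] := vG j.
have lFG (K : set E) : compact K -> K `<=` Om ->
    leb.-integrable K (EFin \o component (fun x => F x - G x) j).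
  move=> cK KO; have mK := compact_measurable_rV cK.
  apply: (integrable_eq mK _ (integrableB_EFin mK (lF _ cK KO) (lG _ cK KO))) => x _.
  by rewrite /component !mxE.
split=> // psi tpsi; have [spsi _ _] := tpsi; have tdpsi := test_function_partial j tpsi.
have [C1 C10 HC1] := test_function_bounded tpsi.
have [C2 C20 HC2] := test_function_bounded tdpsi.
have mdpsi : measurable_fun Om (partial j psi).
  by apply: measurable_funTS; apply: smooth_measurable; case: tdpsi.
have [La _] := integrable_mul_bounded oOm Lu mdpsi HC2.
have [Lb _] := integrable_mul_bounded oOm Lv mdpsi HC2.
have Lpsi (H : E -> E) : loc_integrable Om (component H j) -> L (fun x => component H j x * psi x).
  move=> lH; have [_ cK KO] := tpsi; have mK := compact_measurable_rV cK.
  have mpsi : measurable_fun setT psi by exact: smooth_measurable.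
  have mH := measurable_loc_integrable lH.
  have LK : leb.-integrable (tsupport psi) (EFin \o (fun x => component H j x * psi x)).
    apply: (integrable_le mK _ (integrableZ_EFin mK C1 (integrable_norm_EFin (lH _ cK KO)))).
      apply: measurable_funM; last exact: measurable_funTS.
      exact: measurable_funS KO mH.
    by move=> x _; rewrite normrM mulrC ler_wpM2r.
  have /integrableP[mI fin] := LK.
  apply/integrableP; split.
    apply/measurable_EFinP; apply: measurable_funM => //; exact: measurable_funTS.
  apply: le_lt_trans fin; rewrite integral_mkcond [leRHS]integral_mkcond.
  rewrite le_eqVlt; apply/orP; left; apply/eqP; apply: eq_integral => x _.
  rewrite !patchE; case: ifPn => [/set_mem Ox|Ox]; case: ifPn => [/set_mem Kx|Kx] //.
    rewrite /= (_ : psi x = 0) ?mulr0 ?normr0//; apply: contrapT => /eqP/sub_tsupport h.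
    by rewrite mem_set in Kx.
  by have := KO _ Kx; move/negP: Ox; rewrite inE.
have L1 := Lpsi _ lF; have L2 := Lpsi _ lG.
rewrite (_ : I (fun x => (u x - v x) * partial j psi x) =
   I (fun x => u x * partial j psi x) - I (fun x => v x * partial j psi x)); last first.
  by rewrite -(RintegralB mOm La Lb); apply: eq_Rintegral => x _; rewrite mulrBl.
rewrite (_ : I (fun x => component (fun x => F x - G x) j x * psi x) =
   I (fun x => component F j x * psi x) - I (fun x => component G j x * psi x)); last first.
  rewrite -(RintegralB mOm L1 L2); apply: eq_Rintegral => x _.
  by rewrite /component !mxE mulrBl.
by rewrite hF// hG// opprB opprK addrC.
Qed.

(** [get] returns a weak gradient as soon as one exists, and uniqueness determines it almost
    everywhere only. *)
Lemma weak_gradientP u G : is_weak_gradient Om u G ->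
  is_weak_gradient Om u (weak_gradient Om u) /\
  {ae leb, forall x, Om x -> weak_gradient Om u x = G x}.
Proof.
move=> uG; have h : is_weak_gradient Om u (weak_gradient Om u) by apply: getPex; exists G.
by split => //; exact: weak_gradient_unique h uG.
Qed.

Lemma measurable_weak_gradient u G : is_weak_gradient Om u G ->
  forall j, measurable_fun Om (fun x => G x ord0 j).
Proof. by move=> uG j; apply: measurable_loc_integrable; exact: (uG j).1. Qed.

Lemma measurable_weak_gradient_energy u G : is_weak_gradient Om u G ->
  measurable_fun Om (fun x => (enorm (G x) `^ p)%:E).
Proof.
move=> uG; apply/measurable_EFinP; apply: measurable_powR_comp.
by apply: measurable_enorm; exact: measurable_weak_gradient uG.
Qed.

Lemma weak_gradient_energy u F G : is_weak_gradient Om u F -> is_weak_gradient Om u G ->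
  (\int[leb]_(x in Om) (enorm (F x) `^ p)%:E = \int[leb]_(x in Om) (enorm (G x) `^ p)%:E)%E.
Proof.
move=> uF uG; apply: ae_eq_integral => //.
- exact: measurable_weak_gradient_energy uF.
- exact: measurable_weak_gradient_energy uG.
by apply: filterS (weak_gradient_unique oOm uF uG) => x h Ox; rewrite h.
Qed.

Lemma test_closure_eq u F G : test_closure Om p u G -> is_weak_gradient Om u F ->
  test_closure Om p u F.
Proof.
move=> cu uF; have uG := test_closure_weak_gradient oOm bOm p12 cu.
have FG := weak_gradient_unique oOm uF uG.
have [[mG LG] [mu Lu]] := (vLp_jetP oOm p12 u G).1 cu.1.
have LF : LP F.
  split; first exact: measurable_weak_gradient uF.
  apply: (ge0_integrable ((measurable_EFinP _ _).1 (measurable_weak_gradient_energy uF))).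
    by move=> x _; exact: powR_ge0.
  by rewrite (weak_gradient_energy uF uG) -(EFin_Rintegral mOm LG) ltry.
have LJ : LP (jet u F) by apply/(vLp_jetP oOm p12).
split; first exact: LJ.
move=> e e0; have [phi tphi hphi] := cu.2 _ e0; exists phi; first exact: tphi.
apply: le_lt_trans hphi; rewrite le_eqVlt; apply/orP; left; apply/eqP.
have Lphi := vLp_jet_test oOm bOm p12 tphi.
have [[_ L1] _] := vLpB mOm p12 LJ Lphi; have [[_ L2] _] := vLpB mOm p12 cu.1 Lphi.
apply: (ae_eq_Rintegral mOm (integrable_measurable L1) (integrable_measurable L2)).
by apply: filterS FG => x h Ox; rewrite /jet h.
Qed.

(** The norm of u - phi involves the weak gradient chosen for u - phi. Uniqueness replaces it by the
    difference of the gradients of u and phi, which is what the difference of the jets contains. *)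
Lemma W1p0_test_closure u : W1p0 Om p u -> test_closure Om p u (weak_gradient Om u).
Proof.
move=> [[/LpP[mu Lu] uG _] app]; set G := weak_gradient Om u in uG *.
have L1 v : measurable_fun Om v -> L (fun x => `|v x| `^ p) -> L v.
  move=> mv Lv.
  apply: (integrable_le mOm mv (integrableD_EFin mOm (integrable_cst_EFin mOm 1 finOm) Lv)) => x _.
  by have := le_powR_p p1 ltr01 (normr_ge0 (v x)); rewrite powR1 mul1r.
have {}app e : 0 < e -> exists2 phi, test_function Om phi &
    LP (jet u G) /\ EN (fun x => jet u G x - jet phi (grad phi) x) <= 8 * e `^ p.
  move=> e0; have [phi tphi hphi] := app _ e0; exists phi => //.
  have cphi := test_closure_test oOm bOm p12 tphi.
  have [_ [mphi Lphi]] := (vLp_jetP oOm p12 _ _).1 cphi.1.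
  have phiG := test_closure_weak_gradient oOm bOm p12 cphi.
  have wG : is_weak_gradient Om (fun x => u x - phi x) (fun x => G x - grad phi x).
    exact: (is_weak_gradientB (L1 _ mu Lu) (L1 _ mphi Lphi) (measurable_weak_gradient uG) uG phiG).
  have [wG' _] := weak_gradientP wG.
  have h1 : (Lp_norm Om p%:E (u \- phi)%R < e%:E)%E.
    by apply: le_lt_trans hphi; rewrite /W1p_norm leeDl// Lnorm_ge0.
  have h2 : (Lp_norm Om p%:E (@enorm R N \o weak_gradient Om (u \- phi)%R) < e%:E)%E.
    by apply: le_lt_trans hphi; rewrite /W1p_norm leeDr// Lnorm_ge0.
  have mw : measurable_fun Om (fun x => u x - phi x) by exact: measurable_funB.
  have Lw : L (fun x => `|u x - phi x| `^ p).
    apply: (ge0_integrable (measurable_powR_norm _ mw)) => [x _|]; first exact: powR_ge0.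
    exact: lt_trans (Lp_norm_lt e0 h1) (ltry _).
  have h3 : (\int[leb]_(x in Om) (enorm (G x - grad phi x) `^ p)%:E < (e `^ p)%:E)%E.
    rewrite (weak_gradient_energy wG wG'); have := Lp_norm_lt e0 h2.
    apply: le_lt_trans; rewrite le_eqVlt; apply/orP; left; apply/eqP.
    by apply: eq_integral => x _ /=; rewrite (ger0_norm (enorm_ge0 _)).
  have LGw : LP (fun x => G x - grad phi x).
    split; first exact: measurable_weak_gradient wG.
    apply: (ge0_integrable ((measurable_EFinP _ _).1 (measurable_weak_gradient_energy wG))).
      by move=> x _; exact: powR_ge0.
    exact: lt_trans h3 (ltry _).
  have LJ : LP (jet (fun x => u x - phi x) (fun x => G x - grad phi x)).
    exact/(vLp_jetP oOm p12).
  have [_ _ EJ] := energy_jet oOm p12 LJ.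
  split.
    have [LS _] := vLpD mOm p12 LJ cphi.1; rewrite -jetB in LS.
    by rewrite (_ : jet u G = fun x => jet u G x - jet phi (grad phi) x + jet phi (grad phi) x)//;
      apply/funext => x; rewrite subrK.
  rewrite jetB; apply: le_trans EJ _.
  have k1 : I (fun x => `|u x - phi x| `^ p) <= e `^ p.
    by rewrite -lee_fin (EFin_Rintegral mOm Lw); exact: ltW (Lp_norm_lt e0 h1).
  have k2 : EN (fun x => G x - grad phi x) <= e `^ p.
    by rewrite -lee_fin (EFin_Rintegral mOm LGw.2) ltW.
  rewrite (_ : 8 * e `^ p = 4 * (e `^ p + e `^ p)); last by ring.
  exact: (ler_wpM2l (ler0n _ 4) (lerD k1 k2)).
split=> [|e e0]; first by have [phi _ []] := app _ ltr01.
(* Chosen so that 8 e'^p = e / 2. *)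
pose e' := (e / 16) `^ p^-1; have e16 : 0 < e / 16 by rewrite divr_gt0.
have e'0 : 0 < e' by exact: powR_gt0.
have [phi tphi [_ hphi]] := app _ e'0; exists phi => //; apply: le_lt_trans hphi _.
rewrite /e' -powRrM mulVf ?gt_eqF// powRr1 ?(ltW e16)//.
by rewrite mulrCA gtr_pMr// ltr_pdivrMr// mul1r ltr_nat.
Qed.

Lemma W1p_normE u G : test_closure Om p u G -> W1p_norm Om p u =
  ((I (fun x => `|u x| `^ p)) `^ p^-1 + (EN G) `^ p^-1)%:E.
Proof.
move=> cu; have uG := test_closure_weak_gradient oOm bOm p12 cu.
have [uG' _] := weak_gradientP uG; have cu' := test_closure_eq cu uG'.
have [[_ LG] [_ Lu]] := (vLp_jetP oOm p12 _ _).1 cu.1.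
rewrite /W1p_norm (Lp_normE Lu) Lp_normE_integral EFinD; congr (_ + _)%E.
rewrite -poweR_EFin /energy (EFin_Rintegral mOm LG) -(weak_gradient_energy uG' uG).
rewrite (_ : (fun x => (`|(@enorm R N \o weak_gradient Om u) x| `^ p)%:E) =
  fun x => (enorm (weak_gradient Om u x) `^ p)%:E)//.
by apply/funext => x; rewrite /= (ger0_norm (enorm_ge0 _)).
Qed.

Lemma test_closure_W1p0 u G : test_closure Om p u G -> W1p0 Om p u.
Proof.
move=> cu; have uG := test_closure_weak_gradient oOm bOm p12 cu.
have [uG' _] := weak_gradientP uG; have cu' := test_closure_eq cu uG'.
have [[mG LG] Lu] := (vLp_jetP oOm p12 _ _).1 cu'.1.
split.
  split=> // [|j]; first exact/LpP.
  apply/LpP; split; first exact: mG.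
  apply: (integrable_le mOm (measurable_powR_norm p (mG j)) LG) => x _.
  rewrite ger0_norm ?powR_ge0//; apply: ge0_ler_powR; rewrite ?nnegrE ?enorm_ge0//.
    exact: ltW.
  exact: entry_le_enorm.
move=> e e0; pose e' := (e / 3) `^ p; have e3 : 0 < e / 3 by rewrite divr_gt0.
have e'0 : 0 < e' by exact: powR_gt0.
have [phi tphi hphi] := cu.2 _ e'0; exists phi => //.
have cD := test_closureB oOm bOm p12 cu (test_closure_test oOm bOm p12 tphi).
rewrite (W1p_normE cD); rewrite jetB in hphi.
have [k1 k2 _] := energy_jet oOm p12 cD.1.
have root (a : R) : 0 <= a -> a <= e' -> a `^ p^-1 <= e / 3.
  move=> a0 ae; have -> : e / 3 = e' `^ p^-1.
    by rewrite -powRrM divff ?gt_eqF// powRr1// ltW.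
  by apply: ge0_ler_powR; rewrite ?nnegrE ?invr_ge0 ?powR_ge0 ?(ltW p0).
have r1 : (I (fun x => `|u x - phi x| `^ p)) `^ p^-1 <= e / 3.
  apply: root; last exact: le_trans k1 (ltW hphi).
  by apply: Rintegral_ge0 => x _; exact: powR_ge0.
have r2 : (EN (fun x => G x - grad phi x)) `^ p^-1 <= e / 3.
  by apply: root; [exact: energy_ge0|exact: le_trans k2 (ltW hphi)].
rewrite lte_fin; apply: le_lt_trans (lerD r1 r2) _.
exact: two_thirds.
Qed.

End sobolev_closure.

(** * Existence of energy solutions with bounded right-hand side *)

Section quadratic_form.
Context {R : realType} (n : nat).
Implicit Types (x z : 'rV[R]_n).

(* The weighted square that controls the p-energy from below when p <= 2. *)
Definition wsqr (p : R) x z := (enorm x + enorm z) `^ (p - 2) * enorm (x - z) ^+ 2.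

Lemma wsqr_ge0 p x z : 0 <= wsqr p x z.
Proof. by rewrite mulr_ge0 ?powR_ge0 ?sqr_ge0. Qed.

Lemma wsqr_le p x z : 1 < p -> wsqr p x z <= (enorm x + enorm z) `^ p.
Proof.
move=> p1; rewrite powRS2 ?addr_ge0 ?enorm_ge0// ler_wpM2l ?powR_ge0//.
by rewrite lerXn2r ?nnegrE ?addr_ge0 ?enorm_ge0//; exact: enormB.
Qed.

(** Average the strong convexity at the midpoint m towards x and towards z: the flux terms cancel.
    The constant 1/16 is 1/2 from strong convexity, 1/4 from |x - m| = |x - z| / 2, and 1/2 from (2
    K)^(p-2) >= K^(p-2) / 2, where K = |x| + |z|. *)
Lemma enorm_midpoint p x z : 1 < p <= 2 ->
  enorm (2^-1 *: (x + z)) `^ p / p + (p - 1) / 16 * wsqr p x z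
  <= (enorm x `^ p / p + enorm z `^ p / p) / 2.
Proof.
move=> p12; have /andP[p1 p2] := p12; set m := 2^-1 *: (x + z).
set K := enorm x + enorm z; have K0 : 0 <= K by rewrite addr_ge0 ?enorm_ge0.
have mK : enorm m <= K.
  rewrite enormZ ger0_norm ?invr_ge0//; apply: le_trans (enormD x z).
  by rewrite ler_piMl ?enorm_ge0// invf_le1// ler1n.
have xm : x - m = 2^-1 *: (x - z).
  rewrite /m -{1}[x]scale1r {1}(splitr 1) mul1r scalerDl scalerDr scalerBr opprD addrA addrK.
  by [].
have zm : z - m = - (2^-1 *: (x - z)).
  rewrite /m -{1}[z]scale1r {1}(splitr 1) mul1r scalerDl scalerDr scalerBr opprD opprB addrACA.
  by rewrite subrr addr0.
have exm : enorm (x - m) ^+ 2 = enorm (x - z) ^+ 2 / 4.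
  by rewrite xm enormZ ger0_norm ?invr_ge0// exprMn; field.
have ezm : enorm (z - m) ^+ 2 = enorm (x - z) ^+ 2 / 4.
  by rewrite zm enormN enormZ ger0_norm ?invr_ge0// exprMn; field.
have hK y : enorm y <= K -> enorm (y - m) ^+ 2 = enorm (x - z) ^+ 2 / 4 ->
    wsqr p x z / 8 <= (enorm y + enorm m) `^ (p - 2) * enorm (y - m) ^+ 2.
  move=> yK e; have [s0|s0] := ltP 0 (enorm y + enorm m); last first.
    have y0 : enorm y = 0 by have := enorm_ge0 y; have := enorm_ge0 m; lra.
    have m0 : enorm m = 0 by have := enorm_ge0 y; have := enorm_ge0 m; lra.
    have xz0 : enorm (x - z) ^+ 2 = 0.
      have := e; rewrite (enorm_eq0 y0) (enorm_eq0 m0) subr0 enorm0 expr0n /= => /esym/eqP.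
      by rewrite mulf_eq0 invr_eq0 (pnatr_eq0 _ 4) orbF => /eqP.
    by rewrite /wsqr xz0 mulr0 mul0r mulr_ge0 ?powR_ge0 ?sqr_ge0.
  rewrite e /wsqr -/K.
  have h1 : (2 * K) `^ (p - 2) <= (enorm y + enorm m) `^ (p - 2).
    by apply: le_powRN; rewrite ?subr_le0// s0 /= mulr_natl mulr2n lerD.
  have h2 : 2^-1 <= 2 `^ (p - 2) :> R.
    have -> : 2^-1 = 2 `^ (-1) :> R by rewrite powR_inv1.
    by apply: ler_powR; [rewrite ler1n|lra].
  have h3 : 2^-1 * K `^ (p - 2) <= (enorm y + enorm m) `^ (p - 2).
    by apply: le_trans h1; rewrite (powRM _ _ K0)// ler_wpM2r// powR_ge0.
  have := ler_wpM2r (sqr_ge0 (enorm (x - z))) h3.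
  move: (K `^ (p - 2)) ((enorm y + enorm m) `^ (p - 2)) (enorm (x - z) ^+ 2) => a b c.
  by lra.
have hx : enorm x <= K by rewrite lerDl enorm_ge0.
have hz : enorm z <= K by rewrite lerDr enorm_ge0.
have hd : dot (p_flux p m) (z - m) + dot (p_flux p m) (x - m) = 0.
  by rewrite -dotDr xm zm addNr dot0r.
clearbody m.
have := enorm_strong_convex x m p12; have := enorm_strong_convex z m p12.
have p10 : 0 <= (p - 1) / 2 by rewrite divr_ge0// subr_ge0 ltW.
have := ler_wpM2l p10 (hK _ hx exm); have := ler_wpM2l p10 (hK _ hz ezm).
move: hd.
move: (dot _ _) (dot _ _) ((enorm z + enorm m) `^ _) ((enorm x + enorm m) `^ _) (wsqr p x z).
move=> d1 d2 w1 w2 w; move: (enorm (z - m) ^+ 2) (enorm (x - m) ^+ 2) => q1 q2.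
rewrite (_ : (p - 1) / 16 * w = (p - 1) / 2 * (w / 8)); last by field.
rewrite -[(p - 1) / 2 * w1 * q1]mulrA -[(p - 1) / 2 * w2 * q2]mulrA.
move: ((p - 1) / 2 * (w / 8)) ((p - 1) / 2 * (w1 * q1)) ((p - 1) / 2 * (w2 * q2)).
by move=> r s t; move: (_ / p) (_ / p) (_ / p) => a b c; lra.
Qed.

End quadratic_form.

Section weighted_energy.
Context d (T : measurableType d) (R : realType) (mu : {measure set T -> \bar R}).
Variables (D : set T) (mD : measurable D) (p : R).
Hypotheses (p12 : 1 < p <= 2).
Local Notation L f := (mu.-integrable D (EFin \o f)).
Local Notation I f := (Rintegral mu D f).
Local Notation LP := (vLp mu D p).
Local Notation EN := (energy mu D p).

Let p1 : 1 < p. Proof. by case/andP: p12. Qed.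

Lemma measurable_wsqr n (F G : T -> 'rV[R]_n) :
  (forall j, measurable_fun D (fun x => F x ord0 j)) ->
  (forall j, measurable_fun D (fun x => G x ord0 j)) ->
  measurable_fun D (fun x => wsqr p (F x) (G x)).
Proof.
move=> mF mG; apply: measurable_funM.
  apply: measurable_powR_comp; apply: measurable_funD; exact: measurable_enorm.
apply: measurable_funX; apply: measurable_enorm => j.
by under eq_fun do rewrite !mxE; exact: measurable_funB.
Qed.

Lemma vLp_wsqr n (F G : T -> 'rV[R]_n) : LP F -> LP G ->
  [/\ L (fun x => (enorm (F x) + enorm (G x)) `^ p),
      I (fun x => (enorm (F x) + enorm (G x)) `^ p) <= 4 * (EN F + EN G),
      L (fun x => wsqr p (F x) (G x)) &
      forall s, 0 < s -> EN (fun x => F x - G x) <=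
        s `^ p * I (fun x => (enorm (F x) + enorm (G x)) `^ p)
        + s `^ (p - 2) * I (fun x => wsqr p (F x) (G x))].
Proof.
move=> LF LG; have [[mF LF'] [mG LG']] := (LF, LG).
have Lg := integrableZ_EFin mD 4 (integrableD_EFin mD LF' LG').
have le x : (enorm (F x) + enorm (G x)) `^ p <= 4 * (enorm (F x) `^ p + enorm (G x) `^ p).
  exact: (powR_addl p12 (enorm_ge0 _) (enorm_ge0 _)).
have LK : L (fun x => (enorm (F x) + enorm (G x)) `^ p).
  apply: (integrable_le mD _ Lg) => [|x _].
    by apply: measurable_powR_comp; apply: measurable_funD; exact: measurable_enorm.
  by rewrite ger0_norm ?powR_ge0.
have LW : L (fun x => wsqr p (F x) (G x)).
  apply: (integrable_le mD (measurable_wsqr mF mG) LK) => x _.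
  by rewrite ger0_norm ?wsqr_ge0//; exact: wsqr_le.
split => //.
  rewrite /energy -(RintegralD mD LF' LG').
  rewrite -(@RintegralZl _ _ _ mu D _ 4 mD (integrableD_EFin mD LF' LG')).
  by apply: (le_Rintegral mD LK Lg) => x _.
move=> s s0; have L1 := integrableZ_EFin mD (s `^ p) LK.
have L2 := integrableZ_EFin mD (s `^ (p - 2)) LW.
have [[_ LB] _] := vLpB mD p12 LF LG.
rewrite -(@RintegralZl _ _ _ mu D _ (s `^ p) mD LK).
rewrite -(@RintegralZl _ _ _ mu D _ (s `^ (p - 2)) mD LW) -(RintegralD mD L1 L2).
apply: (le_Rintegral mD LB (integrableD_EFin mD L1 L2)) => x _.
by apply: (powR_split_p p12 s0); rewrite enorm_ge0; exact: enormB.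
Qed.

End weighted_energy.

Section le_Rintegral_lin.
Context d (T : measurableType d) (R : realType) (mu : {measure set T -> \bar R}).
Variables (D : set T) (mD : measurable D).
Local Notation L f := (mu.-integrable D (EFin \o f)).
Local Notation I f := (Rintegral mu D f).

Lemma le_Rintegral_lin (f w g h : T -> R) (a b : R) : L f -> L w -> L g -> L h ->
  (forall x, f x + a * w x <= b * (g x + h x)) -> I f + a * I w <= b * (I g + I h).
Proof.
move=> Lf Lw Lg Lh le; have Law := integrableZ_EFin mD a Lw.
have Lgh := integrableD_EFin mD Lg Lh; have Lb := integrableZ_EFin mD b Lgh.
rewrite -(@RintegralZl _ _ _ mu D _ a mD Lw) -(RintegralD mD Lf Law) -(RintegralD mD Lg Lh).
rewrite -(@RintegralZl _ _ _ mu D _ b mD Lgh).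
exact: (le_Rintegral mD (integrableD_EFin mD Lf Law) Lb).
Qed.

End le_Rintegral_lin.

Section existence.
Context {R : realType} {N : nat}.
Local Notation E := 'rV[R]_N.
Local Notation leb := (lebesgue_rV R N).
Variables (Om : set E) (p : R).
Hypotheses (N0 : (0 < N)%N) (oOm : open Om) (bOm : bounded_set Om) (p12 : 1 < p <= 2).
Implicit Types (u v : E -> R) (G V : E -> E).
Local Notation L f := (leb.-integrable Om (EFin \o f)).
Local Notation I f := (Rintegral leb Om f).
Local Notation LP := (vLp leb Om p).
Local Notation EN := (energy leb Om p).
Local Notation TC := (test_closure Om p).

Let mOm : measurable Om. Proof. exact: open_measurable_rV. Qed.
Let finOm : (leb Om < +oo)%E. Proof. exact: lebesgue_rV_bounded. Qed.
Let p1 : 1 < p. Proof. by case/andP: p12. Qed.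
Let p0 : 0 < p. Proof. exact: lt_trans p1. Qed.

Lemma test_closure_vLp u G : TC u G -> LP G.
Proof. by move=> [/(vLp_jetP oOm p12)[]]. Qed.

Lemma test_closure_norm1 u G (t : R) : TC u G -> 0 < t ->
  I (fun x => `|u x|) <= t * fine (leb Om) + t `^ (1 - p) * EN (jet u G).
Proof.
move=> cu t0; have [L1 _] := test_closure_integrable oOm bOm p12 cu.
have [LJ] := vLp_integrable mOm finOm p12 t0 cu.1; apply: le_trans.
apply: (le_Rintegral mOm (integrable_norm_EFin L1) LJ) => x _.
exact: norm_le_enorm_row_mx.
Qed.

Lemma energy_div G : LP G -> L (fun x => enorm (G x) `^ p / p) /\
  EN G / p = I (fun x => enorm (G x) `^ p / p).
Proof.
move=> [_ LG]; have LGp := integrableZ_EFin mOm p^-1 LG.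
have e : (fun x => p^-1 * enorm (G x) `^ p) = fun x => enorm (G x) `^ p / p.
  by apply/funext => x; rewrite mulrC.
rewrite e in LGp; split => //.
by rewrite /energy mulrC -(@RintegralZl _ _ _ leb Om _ p^-1 mOm LG) e.
Qed.

Let coercive_sum (b B i a y : R) : a <= i -> i <= y -> y <= B + b ->
  b - B <= b + b - a.
Proof. lra. Qed.

Let energy_sum (a n i b c d : R) : a <= n -> n <= i -> i <= b + d -> d <= a / 2 ->
  b <= c -> a <= 2 * c.
Proof. lra. Qed.

Let midpoint_sum (z z' w g g' v v' a b : R) : z = z' -> g = g' -> v = v' ->
  z' + w <= 2^-1 * (g' + v') -> w <= (g - a + (v - b)) / 2 - (z - 2^-1 * (a + b)).
Proof. move=> -> -> ->; lra. Qed.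

Let half_sum (w a b m j e : R) : w <= (a + b) / 2 - m -> a <= j + e -> b <= j + e -> j <= m ->
  w <= e.
Proof. lra. Qed.

Let minimizer_sum (M' h g a b j i r : R) : h <= g + r -> b - a <= M' * r -> g - b <= j + i ->
  i <= r -> h - a <= j + (M' + 2) * r.
Proof. lra. Qed.

Let variation_sum (g g' z z' a b w s : R) : 0 < s -> g = g' -> z = z' ->
  g - a <= z - (a + s * b) -> z' + - s * w <= 1 * (g' + 0) -> b <= w.
Proof. by move=> s0 -> -> h1 h2; rewrite -(ler_pM2l s0); lra. Qed.

Let flux_sum (a b c v e : R) : a <= b -> b - c <= (e * v + e * v) * 3 -> a <= c + 6 * v * e.
Proof. lra. Qed.

Definition weak_sol f u G := TC u G /\ forall v V, TC v V ->
  I (fun x => dot (p_flux p (G x)) (V x)) = I (fun x => f x * v x).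

(** Convexity bounds the energy of G by that of V plus the flux of G tested with G - V. Closeness in
    energy is enough, because the minimising sequence will converge strongly. *)
Lemma energy_lower_semicontinuous G (e : R) : LP G -> 0 < e -> exists2 dl : R, 0 < dl &
  forall V, LP V -> EN (fun x => G x - V x) <= dl -> EN G / p <= EN V / p + e.
Proof.
move=> LG e0; pose a := EN G; have a0 : 0 <= a by exact: energy_ge0.
pose t := 6 * (a + 1) / e; have t0 : 0 < t by rewrite !mulr_gt0 ?invr_gt0// ltr_wpDl.
have tp : 0 < t `^ (p - 1) by exact: powR_gt0.
exists (e / (6 * t `^ (p - 1))); first by rewrite divr_gt0// mulr_gt0.
move=> V LV GV; have [LD _] := vLpB mOm p12 LG LV.
have Lf := vLp_flux_integrable mOm p12 LG LD.
have [Lz _] := vLpZ mOm 0 LG.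
have := vLp_flux_diff mOm p12 t0 LG Lz LD.
rewrite (_ : I (fun x => dot (p_flux p (0 *: G x)) _) = 0); last first.
  rewrite (_ : (fun x => _) = cst 0) ?Rintegral_cst ?mul0r//.
  by apply/funext => x; rewrite scale0r p_flux0 dot0l.
rewrite subr0 (_ : (fun x => G x - 0 *: G x) = G); last first.
  by apply/funext => x; rewrite scale0r subr0.
rewrite -/a => hf; have h1 : t^-1 * a <= e / 6.
  rewrite /t invf_div mulrAC ler_pdivrMr ?mulr_gt0 ?ltr_wpDl//.
  rewrite (_ : e / 6 * (6 * (a + 1)) = e * (a + 1)); last by field.
  by apply: ler_wpM2l; [exact: ltW|rewrite lerDl].
have h2 : t `^ (p - 1) * EN (fun x => G x - V x) <= e / 6.
  apply: le_trans (ler_wpM2l (ltW tp) GV) _; rewrite le_eqVlt; apply/orP; left; apply/eqP.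
  by field; rewrite gt_eqF.
have h3 : I (fun x => dot (p_flux p (G x)) (G x - V x)) <= e.
  by apply: le_trans (ler_norm _) (le_trans hf _); move: h1 h2; move: (_ * a) (_ * EN _) => r s; lra.
apply: le_trans (_ : _ <= EN V / p + I (fun x => dot (p_flux p (G x)) (G x - V x))) _; last first.
  by rewrite lerD2l.
have [LGp eG] := energy_div LG; have [LVp eV] := energy_div LV.
rewrite [X in X <= _]eG [X in X + _]eV.
rewrite -(RintegralD mOm LVp Lf).
apply: (le_Rintegral mOm LGp (integrableD_EFin mOm LVp Lf)) => x _.
have := enorm_strong_convex (V x) (G x) p12.
have : 0 <= (p - 1) / 2 * (enorm (V x) + enorm (G x)) `^ (p - 2) * enorm (V x - G x) ^+ 2.
  have p12' : 0 <= (p - 1) / 2 by rewrite divr_ge0// subr_ge0 ltW.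
  exact: mulr_ge0 (mulr_ge0 p12' (powR_ge0 _ _)) (sqr_ge0 _).
rewrite -(opprB (G x) (V x)) [dot _ (- _)]dotC dotNl [dot (G x - V x) _]dotC.
by move=> q0 h; rewrite -lerBlDr; apply: le_trans h; rewrite lerDl.
Qed.

Lemma norm1_absorb (M : R) : 0 <= M -> exists B : R, forall u G, TC u G ->
  M * I (fun x => `|u x|) <= B + EN G / (2 * p).
Proof.
move=> M0; have [C C0 HC] := test_closure_poincare oOm bOm p12 N0.
(* With t^(1-p) = 1 / A and Poincare's inequality, the energy term is at most M C / A times the
   energy, which is below 1 / (2 p) of it. *)
pose A := 2 * p * M * C + 1.
have A0 : 0 < A by rewrite ltr_wpDl// !mulr_ge0// ltW.
pose t := A `^ (p - 1)^-1; have t0 : 0 < t by exact: powR_gt0.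
have p10 : 0 < p - 1 by rewrite subr_gt0.
have tA : t `^ (1 - p) = A^-1.
  rewrite /t -powRrM -[1 - p]opprB mulrN mulVf ?gt_eqF// powR_inv1//; exact: ltW.
exists (M * (t * fine (leb Om))) => u G cu.
have h2 : M * (t `^ (1 - p) * EN (jet u G)) <= EN G / (2 * p).
  rewrite tA; apply: le_trans (_ : _ <= M * (A^-1 * (C * EN G))) _.
    have A1 : 0 <= A^-1 by rewrite invr_ge0 ltW.
    exact: (ler_wpM2l M0 (ler_wpM2l A1 (HC _ _ cu))).
  rewrite ler_pdivlMr ?mulr_gt0// !mulrA (_ : _ * p = (2 * p * M * C) / A * EN G); last by ring.
  by rewrite ler_piMl ?energy_ge0// ler_pdivrMr// mul1r /A lerDl ler01.
have h3 := ler_wpM2l M0 (test_closure_norm1 cu t0); rewrite mulrDr in h3.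
by apply: le_trans h3 _; rewrite lerD2l.
Qed.

(** Tested with u itself, the equation equates the energy with the integral of f u, and
    [norm1_absorb] returns at most half of the energy. The bound depends on f through M only, which
    is what makes all later constants uniform. *)
Lemma weak_sol_energy (M : R) : 0 <= M -> exists2 B : R, 0 <= B & forall (f : E -> R) u G,
  measurable_fun Om f -> (forall x, `|f x| <= M) -> weak_sol f u G -> EN G <= B.
Proof.
move=> M0; have [B HB] := norm1_absorb M0; exists (2 * `|B|); first by rewrite mulr_ge0.
move=> f u G mf fM [cu /(_ _ _ cu)].
rewrite (_ : I (fun x => dot _ _) = EN G); last first.
  by apply: eq_Rintegral => x _; rewrite dot_p_flux.
move=> e; have [L1 _] := test_closure_integrable oOm bOm p12 cu.
have [_] := integrable_mul_bounded oOm L1 mf fM.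
rewrite (_ : (fun x => u x * f x) = fun x => f x * u x); last by apply/funext => x; rewrite mulrC.
rewrite -e => h1; have h2 := HB _ _ cu.
have h3 : EN G / (2 * p) <= EN G / 2.
  apply: ler_wpM2l; first exact: energy_ge0.
  by rewrite lef_pV2 ?posrE ?mulr_gt0// ler_peMr// ltW.
exact: energy_sum (ler_norm _) h1 h2 h3 (ler_norm _).
Qed.

Section minimization.
Variables (f : E -> R) (M : R).
Hypotheses (mf : measurable_fun Om f) (fM : forall x, `|f x| <= M).

Let M0 : 0 <= M. Proof. exact: le_trans (normr_ge0 _) (fM 0). Qed.

Definition functional u G : R := EN G / p - I (fun x => f x * u x).
Local Notation J := functional.

Lemma integrable_mulf u G : TC u G -> L (fun x => f x * u x) /\
  `|I (fun x => f x * u x)| <= M * I (fun x => `|u x|).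
Proof.
move=> cu; have [L1 _] := test_closure_integrable oOm bOm p12 cu.
have [] := integrable_mul_bounded oOm L1 mf fM.
by rewrite (_ : (fun x => u x * f x) = fun x => f x * u x)//; apply/funext => x; rewrite mulrC.
Qed.

Lemma functional_coercive : exists B : R, forall u G, TC u G -> EN G / (2 * p) - B <= J u G.
Proof.
have [B HB] := norm1_absorb M0; exists B => u G cu; rewrite /functional.
have [_ hI] := integrable_mulf cu.
have e2 : EN G / p = EN G / (2 * p) + EN G / (2 * p) by field; rewrite gt_eqF.
by rewrite e2; exact: coercive_sum (ler_norm _) hI (HB _ _ cu).
Qed.

Lemma functional_inf : exists j0 : R, (forall u G, TC u G -> j0 <= J u G) /\
  forall e, 0 < e -> exists u G, TC u G /\ J u G < j0 + e.
Proof.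
have [B HB] := functional_coercive; pose S := [set r | exists u G, TC u G /\ r = J u G].
have infS : has_inf S.
  split.
    have c0 := test_closure_test oOm bOm p12 (test_function0 Om).
    by exists (J (cst 0) (grad (cst 0))), (cst 0), (grad (cst 0)).
  exists (- B) => _ [u [G [cu ->]]]; apply: le_trans (HB _ _ cu).
  by rewrite lerDr divr_ge0 ?energy_ge0// mulr_ge0// ltW.
exists (inf S); split=> [u G cu|e e0].
  by apply: ge_inf; [exact: infS.2|exists u, G].
by have [_ [u [G [cu ->]]] h] := inf_adherent e0 infS; exists u, G.
Qed.

(** The term with f is linear in u, so the midpoint gap of the functional is that of the energy. *)
Lemma functional_midpoint u G v V : TC u G -> TC v V ->
  TC (fun x => 2^-1 * (u x + v x)) (fun x => 2^-1 *: (G x + V x)) /\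
  (p - 1) / 16 * I (fun x => wsqr p (G x) (V x)) <=
  (J u G + J v V) / 2 - J (fun x => 2^-1 * (u x + v x)) (fun x => 2^-1 *: (G x + V x)).
Proof.
move=> cu cv; set m := (fun x => 2^-1 * _); set Z := (fun x => 2^-1 *: _).
have cm : TC m Z by apply: (test_closureZ oOm bOm p12); exact: test_closureD.
split => //; rewrite /functional.
have [Lu _] := integrable_mulf cu; have [Lv _] := integrable_mulf cv.
have -> : I (fun x => f x * m x) = 2^-1 * (I (fun x => f x * u x) + I (fun x => f x * v x)).
  rewrite -(RintegralD mOm Lu Lv).
  rewrite -(@RintegralZl _ _ _ leb Om _ 2^-1 mOm (integrableD_EFin mOm Lu Lv)).
  by apply: eq_Rintegral => x _; rewrite /m; ring.
have LG := test_closure_vLp cu; have LV := test_closure_vLp cv; have LZ := test_closure_vLp cm.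
have [LG' eG] := energy_div LG; have [LV' eV] := energy_div LV; have [LZ' eZ] := energy_div LZ.
have [_ _ LW _] := vLp_wsqr mOm p12 LG LV.
have key x : enorm (Z x) `^ p / p + (p - 1) / 16 * wsqr p (G x) (V x) <=
    2^-1 * (enorm (G x) `^ p / p + enorm (V x) `^ p / p).
  by rewrite [leRHS]mulrC; exact: enorm_midpoint.
exact: midpoint_sum eZ eG eV (le_Rintegral_lin mOm LZ' LW LG' LV' key).
Qed.

(** The midpoint of two near-minimisers cannot go below j0, so the weighted square of their
    gradients is small; coercivity bounds their energies, which allows the weight to be removed by
    [vLp_wsqr]. *)
Lemma functional_cauchy (j0 eta : R) : (forall u G, TC u G -> j0 <= J u G) -> 0 < eta ->
  exists2 e : R, 0 < e & forall u G v V, TC u G -> TC v V -> J u G <= j0 + e -> J v V <= j0 + e ->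
    EN (fun x => jet u G x - jet v V x) <= eta.
Proof.
move=> Hj0 eta0; have [B HB] := functional_coercive.
have [C C0 HC] := test_closure_poincare oOm bOm p12 N0.
have C1 : 0 < C + 1 by rewrite ltr_wpDl.
have p10 : 0 < p - 1 by rewrite subr_gt0.
pose K0 := 2 * p * (`|j0| + 1 + `|B|).
have K00 : 0 <= K0 by rewrite !mulr_ge0 ?addr_ge0// ltW.
(* Each term of [vLp_wsqr] is to be at most et: s makes s^p 8 K0 small enough, then e1 limits the
   weighted square. Their sum is eta / (C + 1), and Poincare's inequality costs the factor C. *)
pose et := eta / (C + 1) / 2; have et0 : 0 < et by rewrite !divr_gt0.
have K1 : 0 < 8 * K0 + 1 by rewrite ltr_wpDl// mulr_ge0.
pose s := (et / (8 * K0 + 1)) `^ p^-1; have s0 : 0 < s by rewrite powR_gt0 ?divr_gt0.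
have sp : s `^ p = et / (8 * K0 + 1).
  by rewrite /s -powRrM mulVf ?gt_eqF// powRr1// divr_ge0// ltW.
have sp2 : 0 < s `^ (p - 2) by exact: powR_gt0.
pose e1 := (p - 1) / 16 * (et / s `^ (p - 2)).
have e10 : 0 < e1 by rewrite mulr_gt0 ?divr_gt0.
exists (Num.min 1 e1) => [|u G v V cu cv Ju Jv]; first by rewrite lt_min ltr01.
have bound w H : TC w H -> J w H <= j0 + Num.min 1 e1 -> EN H <= K0.
  move=> cw Jw; have h1 : Num.min 1 e1 <= 1 by rewrite ge_min lexx.
  have := le_trans (HB _ _ cw) (le_trans Jw (lerD (ler_norm j0) h1)).
  rewrite lerBlDr => h; have h' := le_trans h (lerD (lexx _) (ler_norm B)).
  by rewrite ler_pdivrMr ?mulr_gt0// mulrC in h'.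
have [cm hm] := functional_midpoint cu cv.
have W : I (fun x => wsqr p (G x) (V x)) <= et / s `^ (p - 2).
  have h1 : Num.min 1 e1 <= e1 by rewrite ge_min lexx orbT.
  have := half_sum hm (le_trans Ju (lerD (lexx _) h1)) (le_trans Jv (lerD (lexx _) h1)) (Hj0 _ _ cm).
  by rewrite /e1 ler_pM2l// divr_gt0.
have [_ hK _ hs] := vLp_wsqr mOm p12 (test_closure_vLp cu) (test_closure_vLp cv).
have hK' : I (fun x => (enorm (G x) + enorm (V x)) `^ p) <= 8 * K0.
  apply: le_trans hK _; rewrite (_ : 8 * K0 = 4 * (K0 + K0)); last by ring.
  by apply: ler_wpM2l => //; exact: lerD (bound _ _ cu Ju) (bound _ _ cv Jv).
have EGV : EN (fun x => G x - V x) <= et + et.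
  apply: le_trans (hs _ s0) _; apply: lerD.
    rewrite sp mulrAC ler_pdivrMr// ler_wpM2l ?(ltW et0)//.
    by apply: le_trans hK' _; rewrite lerDl.
  by apply: le_trans (ler_wpM2l (ltW sp2) W) _; rewrite mulrCA divff ?mulr1// gt_eqF.
have cB := test_closureB oOm bOm p12 cu cv.
rewrite jetB; apply: le_trans (HC _ _ cB) _.
apply: le_trans (ler_wpM2l C0 EGV) _; rewrite -[et + et]splitr.
by rewrite mulrCA ler_piMr ?(ltW eta0)// ler_pdivrMr// mul1r lerDl.
Qed.

Lemma test_closure_complete (u : nat -> E -> R) (G : nat -> E -> E) :
  (forall k, TC (u k) (G k)) ->
  (forall k l, (k <= l)%N -> EN (fun x => jet (u l) (G l) x - jet (u k) (G k) x) <= 4^-1 ^+ k) ->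
  exists w H, TC w H /\ forall k, EN (fun x => jet w H x - jet (u k) (G k) x) <= 4^-1 ^+ k.
Proof.
move=> cu hu; have [F LF EF] := vLp_complete mOm finOm p12 (fun k => (cu k).1) hu.
pose w x := F x ord0 (lshift N ord0); pose H x : E := rsubmx (F x).
have FE : F = jet w H.
  apply/funext => x; rewrite /jet -[LHS]hsubmxK; congr row_mx.
  by rewrite [LHS]mx11_scalar; congr (_%:M); rewrite mxE.
rewrite FE in LF EF; exists w, H; split => //.
apply: (test_closure_closed oOm bOm p12 LF) => e e0.
have : (4^-1 ^+ k @[k --> \oo] --> (0 : R)).
  by apply: cvg_expr; rewrite ger0_norm ?invr_ge0// invf_lt1// ltr1n.
move=> /cvgr0Pnorm_lt/(_ _ e0)[k _ /(_ k (leqnn k))].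
rewrite ger0_norm ?exprn_ge0 ?invr_ge0// => h.
by exists (u k), (G k); split => //; exact: le_lt_trans (EF k) h.
Qed.

Lemma functional_minimizer : exists u G, TC u G /\ forall v V, TC v V -> J u G <= J v V.
Proof.
have [j0 [Hj0 Hinf]] := functional_inf.
have q0 k : 0 < 4^-1 ^+ k :> R by rewrite exprn_gt0// invr_gt0.
have /choice[e he] : forall k : nat, exists e : R, 0 < e /\ forall u G v V, TC u G -> TC v V ->
    J u G <= j0 + e -> J v V <= j0 + e -> EN (fun x => jet u G x - jet v V x) <= 4^-1 ^+ k.
  by move=> k; have [e e0 h] := functional_cauchy Hj0 (q0 k); exists e.
(* The l-th function must meet the tolerances e 0, ..., e l at once, so that the Cauchy estimate
   with index k holds for all later functions. *)
have small l : exists2 d : R, 0 < d & d <= l.+1%:R^-1 /\ forall i, (i <= l)%N -> d <= e i.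
  elim: l => [|l [d d0 [dl di]]].
    exists (Num.min 1 (e 0%N)); first by rewrite lt_min ltr01 (he 0%N).1.
    by split=> [|[]// _]; rewrite ge_min ?invr1 ?lexx// orbT.
  exists (Num.min (Num.min d l.+2%:R^-1) (e l.+1)).
    by rewrite !lt_min d0 invr_gt0 ltr0n (he l.+1).1.
  split=> [|i]; first by rewrite !ge_min lexx orbT.
  rewrite leq_eqVlt => /predU1P[->|il]; first by rewrite ge_min lexx orbT.
  by rewrite !ge_min di.
have /choice[z hz] : forall l : nat, exists z : (E -> R) * (E -> E), TC z.1 z.2 /\
    J z.1 z.2 <= j0 + l.+1%:R^-1 /\ forall i, (i <= l)%N -> J z.1 z.2 <= j0 + e i.
  move=> l; have [d d0 [dl di]] := small l; have [u [G [cu Ju]]] := Hinf _ d0.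
  exists (u, G); split => //; split; first by apply: le_trans (ltW Ju) _; rewrite lerD2l.
  by move=> i il; apply: le_trans (ltW Ju) _; rewrite lerD2l di.
have hE k l : (k <= l)%N -> EN (fun x => jet (z l).1 (z l).2 x - jet (z k).1 (z k).2 x) <= 4^-1 ^+ k.
  by move=> kl; apply: (he k).2; [exact: (hz l).1|exact: (hz k).1|exact: (hz l).2.2|exact: (hz k).2.2].
have [w [H [cw hw]]] := test_closure_complete (fun k => (hz k).1) hE.
exists w, H; split=> // v V cv; apply: le_trans (Hj0 _ _ cv).
(* One r for lower semicontinuity, M r for the term with f, and one r for the distance of the k-th
   function from the infimum. *)
apply: (@ler_add_eps _ _ _ (M + 2)) => r r0.
have [d1 d10 H1] := energy_lower_semicontinuous (test_closure_vLp cw) r0.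
have [d2 d20 H2] := vLp_L1_small mOm finOm p12 r0.
have cq : 4^-1 ^+ k @[k --> \oo] --> (0 : R).
  by apply: cvg_expr; rewrite ger0_norm ?invr_ge0// invf_lt1// ltr1n.
have [k [k1 k2 k3]] : exists k : nat, [/\ 4^-1 ^+ k <= d1, 4^-1 ^+ k < d2 & k.+1%:R^-1 <= r].
  have n1 : \forall k \near \oo, `|4^-1 ^+ k : R| < d1 by exact: cvgr0_norm_lt.
  have n2 : \forall k \near \oo, `|4^-1 ^+ k : R| < d2 by exact: cvgr0_norm_lt.
  have n3 : \forall k \near \oo, (k.+1%:R^-1 : R) < r by exact: near_infty_natSinv_lt (PosNum r0).
  have [k0 _ hk] := filterI n1 (filterI n2 n3); have [/= a1 [a2 a3]] := hk k0 (leqnn k0).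
  by exists k0; split; [apply: ltW (le_lt_trans (ler_norm _) a1)|
    exact: le_lt_trans (ler_norm _) a2|exact: ltW].
have [ck [Jk _]] := hz k; set u := (z k).1 in ck Jk; set G := (z k).2 in ck Jk.
have cB := test_closureB oOm bOm p12 cw ck; have hk := hw k; rewrite -/u -/G jetB in hk.
have [_ EB _] := energy_jet oOm p12 cB.1.
have s1 := H1 _ (test_closure_vLp ck) (le_trans EB (le_trans hk k1)).
have s2 := H2 _ _ cB.1 (le_lt_trans hk k2).
have [LB _] := test_closure_integrable oOm bOm p12 cB.
have [LJ _] := vLp_integrable mOm finOm p12 ltr01 cB.1.
have s3 : I (fun x => `|w x - u x|) <= r.
  apply: le_trans (ltW s2); apply: (le_Rintegral mOm (integrable_norm_EFin LB) LJ) => x _.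
  exact: norm_le_enorm_row_mx.
have [LfB hB] := integrable_mulf cB.
have [Lfw _] := integrable_mulf cw; have [Lfu _] := integrable_mulf ck.
have s4 : I (fun x => f x * u x) - I (fun x => f x * w x) <= M * r.
  rewrite -(RintegralB mOm Lfu Lfw); apply: le_trans (ler_norm _) _.
  rewrite (_ : (fun x => f x * u x - f x * w x) = fun x => -1 * (f x * (w x - u x))).
    rewrite (@RintegralZl _ _ _ leb Om _ (-1) mOm LfB) mulN1r normrN.
    by apply: le_trans hB _; exact: ler_wpM2l.
  by apply/funext => x; ring.
exact: minimizer_sum s1 s4 Jk k3.
Qed.

(** Compare u with u + s v. Convexity with base point G + s V bounds the integral of f v by the flux
    of G + s V tested with V, without differentiating the energy; Hoelder continuity of the flux
    then lets s tend to 0. The reverse inequality is this one for - v. *)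
Lemma minimizer_weak_sol u G : TC u G -> (forall v V, TC v V -> J u G <= J v V) ->
  weak_sol f u G.
Proof.
move=> cu Ju; have LG := test_closure_vLp cu.
suff half v V : TC v V -> I (fun x => f x * v x) <= I (fun x => dot (p_flux p (G x)) (V x)).
  split=> // v V cv; apply/eqP; rewrite eq_le half// andbT.
  have := half _ _ (test_closureZ oOm bOm p12 (-1) cv).
  have Lf := vLp_flux_integrable mOm p12 LG (test_closure_vLp cv).
  have [Lv _] := integrable_mulf cv.
  rewrite (_ : (fun x => f x * _) = fun x => -1 * (f x * v x)); last by apply/funext => x; ring.
  rewrite (_ : (fun x => dot _ (-1 *: _)) = fun x => -1 * dot (p_flux p (G x)) (V x)); last first.
    by apply/funext => x; rewrite dotZr.
  rewrite (@RintegralZl _ _ _ leb Om _ (-1) mOm Lv) (@RintegralZl _ _ _ leb Om _ (-1) mOm Lf).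
  by rewrite !mulN1r lerN2.
move=> cv; have LV := test_closure_vLp cv; have p10 : 0 < p - 1 by rewrite subr_gt0.
apply: (@ler_add_eps _ _ _ (6 * EN V)) => e e0.
(* So s^(p-1) = e, and both terms of [vLp_flux_diff] with t = s equal e times the energy of V. *)
pose s := e `^ (p - 1)^-1; have s0 : 0 < s by exact: powR_gt0.
have se : s `^ (p - 1) = e by rewrite /s -powRrM mulVf ?gt_eqF// powRr1// ltW.
have csv := test_closureZ oOm bOm p12 s cv; have cs := test_closureD oOm bOm p12 cu csv.
have LS := test_closure_vLp cs; have [LsV EsV] := vLpZ mOm s LV.
have [LS' eS] := energy_div LS; have [LG' eG] := energy_div LG.
have [Lv _] := integrable_mulf cv; have [Lu _] := integrable_mulf cu.
have LF := vLp_flux_integrable mOm p12 LS LV.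
have Js := Ju _ _ cs.
have L0 : L (cst 0 : E -> R) by exact: integrable_cst_EFin.
have key x : enorm (G x + s *: V x) `^ p / p + - s * dot (p_flux p (G x + s *: V x)) (V x) <=
    1 * (enorm (G x) `^ p / p + 0).
  rewrite addr0 mul1r; apply: le_trans (enorm_strong_convex (G x) (G x + s *: V x) p12).
  have p12' : 0 <= (p - 1) / 2 by rewrite divr_ge0// ltW.
  have := mulr_ge0 (mulr_ge0 p12' (powR_ge0 (enorm (G x) + enorm (G x + s *: V x)) (p - 2)))
    (sqr_ge0 (enorm (G x - (G x + s *: V x)))).
  move=> q0; rewrite -[leLHS]addr0; apply: lerD => //.
  by rewrite lerD2l opprD addrA subrr add0r -scaleNr dotZr.
have cvx := le_Rintegral_lin mOm LS' LF LG' L0 key.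
rewrite [I (cst 0)]Rintegral_cst// mul0r in cvx.
have If : I (fun x => f x * (u x + s * v x)) = I (fun x => f x * u x) + s * I (fun x => f x * v x).
  rewrite -(@RintegralZl _ _ _ leb Om _ s mOm Lv) -(RintegralD mOm Lu (integrableZ_EFin mOm s Lv)).
  by apply: eq_Rintegral => x _; ring.
have k1 : I (fun x => f x * v x) <= I (fun x => dot (p_flux p (G x + s *: V x)) (V x)).
  by rewrite /functional If in Js; exact: variation_sum s0 eG eS Js cvx.
have := vLp_flux_diff mOm p12 s0 LS LG LV.
rewrite (_ : (fun x => G x + s *: V x - G x) = fun x => s *: V x); last first.
  by apply/funext => x; rewrite addrAC subrr add0r.
rewrite EsV (ger0_norm (ltW s0)) mulrA mulrC.
have -> : s^-1 * s `^ p = e.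
  by rewrite (powRS (ltW s0) p0) mulrCA mulVf ?mulr1 ?gt_eqF.
rewrite se => k2; have k3 := le_trans (ler_norm _) k2.
exact: flux_sum k1 k3.
Qed.

Lemma weak_sol_exists : exists u G, weak_sol f u G.
Proof.
by have [u [G [cu Ju]]] := functional_minimizer; exists u, G; exact: minimizer_weak_sol.
Qed.

End minimization.
End existence.

(** * Sup-norm estimate by level sets *)

Section stampacchia.
Context {R : realType}.

(* The levels k_n = D (1 - 2^-n) increase to D; the ratio q solves q^(b-1) = 1/2. *)
Lemma stampacchia (m : R -> R) (c b m0 : R) : 1 < b -> 0 < c -> 0 < m0 ->
  (forall k, 0 <= m k) -> (forall k h, k <= h -> m h <= m k) -> m 0 <= m0 ->
  (forall k h, 0 <= k < h -> (h - k) / 2 * m h <= c * m k `^ b) ->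
  m (4 * c * m0 `^ (b - 1) / 2^-1 `^ (b - 1)^-1) = 0.
Proof.
move=> b1 c0 m00 mge0 mdec m0le hm; set q := 2^-1 `^ (b - 1)^-1.
set D := 4 * c * m0 `^ (b - 1) / q.
have b10 : 0 < b - 1 by rewrite subr_gt0.
have q0 : 0 < q by rewrite powR_gt0 ?invr_gt0.
have mb0 : 0 < m0 `^ (b - 1) by exact: powR_gt0.
have D0 : 0 < D by rewrite divr_gt0// !mulr_gt0.
have qb : q `^ (b - 1) = 2^-1 by rewrite /q -powRrM mulVf ?gt_eqF// powRr1// invr_ge0.
have q1 : q < 1.
  rewrite ltNge; apply/negP => q1.
  have : 1 `^ (b - 1) <= q `^ (b - 1).
    by apply: ge0_ler_powR => //; rewrite ?nnegrE ?ler01 ?(ltW q0) ?(ltW b10).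
  by rewrite qb powR1 leNgt invf_lt1// ltr1n.
pose k n := D * (1 - 2^-1 ^+ n).
have k0 n : 0 <= k n.
  by rewrite mulr_ge0 ?(ltW D0)// subr_ge0 exprn_ile1 ?invr_ge0// invf_le1// ler1n.
have kS n : k n.+1 - k n = D * 2^-1 ^+ n.+1.
  by rewrite /k exprS; field.
have e2 n : 0 < 2^-1 ^+ n :> R by rewrite exprn_gt0// invr_gt0.
(* By the choice of q, (q^n)^b = q^n 2^-n. The factor 2^-n compensates the shrinking gap D 2^-(n+1)
   between the levels, and D is chosen so that exactly one factor q remains. *)
have step n : m (k n) <= m0 * q ^+ n.
  elim: n => [|n IH]; first by rewrite /k expr0 subrr mulr0 mulr1.
  have kk : 0 <= k n < k n.+1 by rewrite k0 -subr_gt0 kS mulr_gt0.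
  have := hm _ _ kk; rewrite kS => h.
  have h1 : m (k n) `^ b <= m0 * m0 `^ (b - 1) * (q ^+ n * 2^-1 ^+ n).
    apply: le_trans (_ : _ <= (m0 * q ^+ n) `^ b) _.
      apply: ge0_ler_powR; rewrite ?nnegrE// ?mulr_ge0 ?exprn_ge0 ?(ltW q0) ?(ltW m00)//.
      exact: ltW (lt_trans ltr01 b1).
    have b0 : 0 < b by exact: lt_trans b1.
    rewrite (powRM _ (ltW m00) (exprn_ge0 _ (ltW q0))) (powRS (ltW m00) b0).
    rewrite (powRS (exprn_ge0 n (ltW q0)) b0).
    have -> : (q ^+ n) `^ (b - 1) = 2^-1 ^+ n.
      by rewrite -(powR_mulrn _ (ltW q0)) -powRrM mulrC powRrM qb powR_mulrn// invr_ge0.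
    by rewrite [m0 * _]mulrC [q ^+ n * _]mulrC.
  pose P := c * m0 `^ (b - 1) * 2^-1 ^+ n; have P0 : 0 < P by rewrite !mulr_gt0.
  have : P / q * m (k n.+1) <= P * (m0 * q ^+ n).
    rewrite (_ : P / q = D * 2^-1 ^+ n.+1 / 2); last first.
      by rewrite /P /D exprS; field; rewrite gt_eqF.
    apply: le_trans h _; rewrite (_ : P * _ = c * (m0 * m0 `^ (b - 1) * (q ^+ n * 2^-1 ^+ n))).
      by apply: ler_wpM2l; [exact: ltW|exact: h1].
    by rewrite /P; ring.
  by rewrite -mulrA ler_pM2l// mulrC ler_pdivrMr// exprSr mulrA.
have q0cvg : m0 * q ^+ n @[n --> \oo] --> (0 : R).
  rewrite -[X in _ --> X](mulr0 m0); apply: cvgMr; apply: cvg_expr.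
  by rewrite ger0_norm// ltW.
apply/eqP; rewrite eq_le mge0 andbT -(cvg_lim _ q0cvg)//; apply: limr_ge.
  by apply/cvg_ex; exists 0.
apply: nearW => n; apply: le_trans (step n); apply: mdec.
by rewrite /k ler_piMr ?(ltW D0)// gerBl ltW.
Qed.

End stampacchia.

Section ae_le_Rintegral.
Context d (T : measurableType d) (R : realType) (mu : {measure set T -> \bar R}).

Lemma ae_le_Rintegral (D : set T) (f g : T -> R) : measurable D ->
  mu.-integrable D (EFin \o f) -> mu.-integrable D (EFin \o g) ->
  {ae mu, forall x, D x -> f x <= g x} -> Rintegral mu D f <= Rintegral mu D g.
Proof.
move=> mD Lf Lg fg; pose h x := Num.min (f x) (g x).
have mf := integrable_measurable Lf; have mg := integrable_measurable Lg.
have mh : measurable_fun D h by exact: measurable_minr.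
have Lfg := integrableD_EFin mD (integrable_norm_EFin Lf) (integrable_norm_EFin Lg).
have Lh : mu.-integrable D (EFin \o h).
  apply: (integrable_le mD mh Lfg) => x _.
  by rewrite /h; case: (leP (f x) (g x)) => _; rewrite ?lerDl ?lerDr.
rewrite (_ : Rintegral mu D f = Rintegral mu D h).
  by apply: (le_Rintegral mD Lh Lg) => x _; rewrite ge_min lexx orbT.
apply: (ae_eq_Rintegral mD mf mh); apply: filterS fg => x fgx Dx.
by rewrite /h min_l// fgx.
Qed.

End ae_le_Rintegral.

Section level_sets.
Context {R : realType} {N : nat}.
Local Notation E := 'rV[R]_N.
Local Notation leb := (lebesgue_rV R N).
Variables (Om : set E) (p : R).
Hypotheses (N0 : (0 < N)%N) (oOm : open Om) (bOm : bounded_set Om) (p12 : 1 < p <= 2).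
Implicit Types (u v : E -> R) (G V : E -> E).
Local Notation L f := (leb.-integrable Om (EFin \o f)).
Local Notation I f := (Rintegral leb Om f).
Local Notation EN := (energy leb Om p).
Local Notation TC := (test_closure Om p).

Let mOm : measurable Om. Proof. exact: open_measurable_rV. Qed.
Let finOm : (leb Om < +oo)%E. Proof. exact: lebesgue_rV_bounded. Qed.
Let p1 : 1 < p. Proof. by case/andP: p12. Qed.
Let p0 : 0 < p. Proof. exact: lt_trans p1. Qed.

Variables (f1 f2 u1 u2 : E -> R) (G1 G2 : E -> E) (M dl B : R).
Hypotheses (mf1 : measurable_fun Om f1) (mf2 : measurable_fun Om f2)
  (f1M : forall x, `|f1 x| <= M) (f2M : forall x, `|f2 x| <= M)
  (s1 : weak_sol Om p f1 u1 G1) (s2 : weak_sol Om p f2 u2 G2)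
  (f12 : {ae leb, forall x, Om x -> `|f1 x - f2 x| <= dl})
  (KB : I (fun x => (enorm (G1 x) + enorm (G2 x)) `^ p) <= B).

Let w x := u1 x - u2 x.
Let D x := G1 x - G2 x.
Let Q x := wsqr p (G1 x) (G2 x).
Let cw : TC w D. Proof. exact: (test_closureB oOm bOm p12 s1.1 s2.1). Qed.
Let LG1 := test_closure_vLp oOm p12 s1.1.
Let LG2 := test_closure_vLp oOm p12 s2.1.
Let mw : measurable_fun Om w. Proof. by case: ((vLp_jetP oOm p12 w D).1 cw.1) => _ []. Qed.

Definition level_measure k : R := fine (leb (Om `&` [set x | k < u1 x - u2 x])).

Lemma difference_test v V : TC v V ->
  L (fun x => dot (p_flux p (G1 x) - p_flux p (G2 x)) (V x)) /\
  I (fun x => dot (p_flux p (G1 x) - p_flux p (G2 x)) (V x)) <= dl * I (fun x => `|v x|).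
Proof.
move=> cv; have LV := test_closure_vLp oOm p12 cv.
have L1 := vLp_flux_integrable mOm p12 LG1 LV; have L2 := vLp_flux_integrable mOm p12 LG2 LV.
have e : (fun x => dot (p_flux p (G1 x) - p_flux p (G2 x)) (V x)) =
    fun x => dot (p_flux p (G1 x)) (V x) - dot (p_flux p (G2 x)) (V x).
  by apply/funext => x; rewrite dotBl.
rewrite e; split; first exact: integrableB_EFin.
have [Lv _] := test_closure_integrable oOm bOm p12 cv.
have [Lf1 _] := integrable_mulf oOm bOm p12 mf1 f1M cv.
have [Lf2 _] := integrable_mulf oOm bOm p12 mf2 f2M cv.
have LB := integrableB_EFin mOm Lf1 Lf2; have Ld := integrableZ_EFin mOm dl (integrable_norm_EFin Lv).
rewrite (RintegralB mOm L1 L2) (s1.2 _ _ cv) (s2.2 _ _ cv) -(RintegralB mOm Lf1 Lf2).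
rewrite -(@RintegralZl _ _ _ leb Om _ dl mOm (integrable_norm_EFin Lv)).
apply: le_trans (ler_norm _) (le_trans (le_normr_Rintegral mOm LB) _).
apply: (ae_le_Rintegral mOm (integrable_norm_EFin LB) Ld).
apply: filterS f12 => x h Ox; rewrite -mulrBl normrM; apply: ler_wpM2r => //; exact: h.
Qed.

(** The test function is w itself. Once |w| is bounded by a multiple of dl, the right-hand side is
    of order dl^2, as the gradient estimate requires. *)
Lemma wsqr_difference : (p - 1) * I Q <= dl * I (fun x => `|w x|).
Proof.
have [LF hF] := difference_test cw; apply: le_trans hF.
have [_ _ LQ _] := vLp_wsqr mOm p12 LG1 LG2.
rewrite -(@RintegralZl _ _ _ leb Om _ (p - 1) mOm LQ).
apply: (le_Rintegral mOm (integrableZ_EFin mOm (p - 1) LQ) LF) => x _.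
exact: p_flux_monotone.
Qed.

Section truncation.
Variables (k e : R).
Hypotheses (k0 : 0 <= k) (e0 : 0 < e).
Let th x := trunc k e 0 (w x).
Let th1 x := trunc k e 1 (w x).
Let cth : TC th (fun x => th1 x *: D x). Proof. exact: test_closure_trunc. Qed.
Let Lth : L th. Proof. by have [] := test_closure_integrable oOm bOm p12 cth. Qed.

Let th1_itv x : 0 <= th1 x <= 1. Proof. exact: trunc1_itv. Qed.

Let LQ1 : L (fun x => th1 x * Q x).
Proof.
have [_ _ LQ _] := vLp_wsqr mOm p12 LG1 LG2.
have mth1 : measurable_fun Om th1.
  apply: measurableT_comp mw; apply: continuous_measurable_fun => s.
  apply: differentiable_continuous; apply/derivable1_diffP.
  by case: (is_derive_trunc k e 1 s).
apply: (integrable_le mOm _ LQ) => [|x _].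
  by apply: measurable_funM => //; exact: integrable_measurable LQ.
have /andP[t0 t1] := th1_itv x.
rewrite (ger0_norm (mulr_ge0 t0 (wsqr_ge0 p (G1 x) (G2 x)))).
exact: (ler_piMl (wsqr_ge0 p (G1 x) (G2 x)) t1).
Qed.

(** The test function is the truncation of w, with gradient [th1 x *: D x]; the factor [th1] is a
    smooth substitute for the indicator of {w > k}. *)
Lemma wsqr_truncation : (p - 1) * I (fun x => th1 x * Q x) <= dl * I (fun x => `|th x|).
Proof.
have [LF hF] := difference_test cth; apply: le_trans hF.
rewrite -(@RintegralZl _ _ _ leb Om _ (p - 1) mOm LQ1).
apply: (le_Rintegral mOm (integrableZ_EFin mOm (p - 1) LQ1) LF) => x _.
have /andP[t0 _] := th1_itv x.
by rewrite dotZr mulrCA; apply: ler_wpM2l => //; exact: p_flux_monotone.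
Qed.

Let A := Om `&` [set x | k < w x].
Let mA : measurable A.
Proof.
rewrite (_ : A = Om `&` w @^-1` `]k, +oo[); first exact: mw.
by apply/seteqP; split=> x [Ox]; rewrite /= in_itv/= andbT.
Qed.
Let AO : A `<=` Om. Proof. by move=> x []. Qed.
Let finA : (leb A < +oo)%E.
Proof. by apply: le_lt_trans finOm; apply: le_measure; rewrite ?inE. Qed.
Let a := level_measure k.

Let gt0_out x : Om x -> ~ A x -> (w x <= k).
Proof. by move=> Ox nA; rewrite leNgt; apply/negP => kw; apply: nA. Qed.

Lemma grad_truncation (s : R) : 0 < a -> 0 < s ->
  I (fun x => enorm (th1 x *: D x)) <=
  s * ((1 + B) * a `^ (2 - 2 / p)) + (4 * s)^-1 * I (fun x => th1 x * Q x).
Proof.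
move=> a0 s0; pose t := a `^ (- p^-1); have t0 : 0 < t by exact: powR_gt0.
have [LK _ _ _] := vLp_wsqr mOm p12 LG1 LG2.
have [_ Lg] := test_closure_integrable oOm bOm p12 cth.
have L1 : L (fun x => \1_A x).
  apply: (integrable_le mOm _ (integrable_cst_EFin mOm 1 finOm)) => [|x _].
    exact: measurable_indic.
  by rewrite indicE; case: (x \in A); rewrite ?normr1 ?normr0.
have I1 : I (\1_A) = a.
  rewrite /Rintegral (_ : (\int[leb]_(x in Om) (\1_A x)%:E)%E = leb A)//.
  by rewrite integral_indic// setIidl.
have La := integrableZ_EFin mOm (t `^ (2 - p)) L1.
have Lb := integrableZ_EFin mOm (t `^ (2 - 2 * p)) LK.
have Lab := integrableD_EFin mOm La Lb.
apply: le_trans (_ : _ <= s * I (fun x => t `^ (2 - p) * \1_A x +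
    t `^ (2 - 2 * p) * (enorm (G1 x) + enorm (G2 x)) `^ p) + (4 * s)^-1 * I (fun x => th1 x * Q x)) _.
  rewrite -(@RintegralZl _ _ _ leb Om _ s mOm Lab) -(@RintegralZl _ _ _ leb Om _ (4 * s)^-1 mOm LQ1).
  rewrite -(RintegralD mOm (integrableZ_EFin mOm s Lab) (integrableZ_EFin mOm (4 * s)^-1 LQ1)).
  apply: (le_Rintegral mOm Lg (integrableD_EFin mOm (integrableZ_EFin mOm s Lab)
    (integrableZ_EFin mOm (4 * s)^-1 LQ1))) => x Ox.
  have /andP[t10 t11] := th1_itv x.
  set K := enorm (G1 x) + enorm (G2 x).
  have K0 : 0 <= K by rewrite addr_ge0 ?enorm_ge0.
  have Q0 : 0 <= th1 x * Q x := mulr_ge0 t10 (wsqr_ge0 _ _ _).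
  have ind0 : 0 <= \1_A x :> R by rewrite indicE ler0n.
  have X0 : 0 <= t `^ (2 - p) * \1_A x + t `^ (2 - 2 * p) * K `^ p.
    exact: addr_ge0 (mulr_ge0 (powR_ge0 _ _) ind0) (mulr_ge0 (powR_ge0 _ _) (powR_ge0 _ _)).
  have s40 : 0 <= (4 * s)^-1 by rewrite invr_ge0 mulr_ge0// ltW.
  have rhs0 := addr_ge0 (mulr_ge0 (ltW s0) X0) (mulr_ge0 s40 Q0).
  rewrite enormZ ger0_norm//; have [Ax|/(gt0_out Ox) wk] := pselect (A x); last first.
    have th0 : th1 x = 0 by rewrite /th1 trunc1E// ltNge wk.
    by rewrite [X in X * enorm _]th0 mul0r.
  have ind1 : \1_A x = 1 :> R by rewrite indicE mem_set.
  rewrite ind1 mulr1 in X0 *.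
  have h1 : enorm (D x) <= s * K `^ (2 - p) + K `^ (p - 2) * enorm (D x) ^+ 2 / (4 * s).
    by apply: (powR_split_1 p12 s0); rewrite enorm_ge0; exact: enormB.
  have h2 := powR_split_2p p12 t0 K0.
  have h3 := ler_wpM2l t10 (le_trans h1 (lerD (ler_wpM2l (ltW s0) h2) (lexx _))).
  apply: le_trans h3 _; rewrite mulrDr; apply: lerD.
    exact: (ler_piMl (mulr_ge0 (ltW s0) X0) t11).
  by rewrite (mulrA (th1 x)) [leRHS]mulrC; exact: lexx.
rewrite lerD2r; apply: ler_wpM2l; first exact: ltW.
rewrite (RintegralD mOm La Lb) (@RintegralZl _ _ _ leb Om _ (t `^ (2 - p)) mOm L1).
rewrite (@RintegralZl _ _ _ leb Om _ (t `^ (2 - 2 * p)) mOm LK) I1 (mulrDl 1 B) mul1r.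
apply: lerD.
  rewrite le_eqVlt; apply/orP; left; apply/eqP.
  rewrite /t -powRrM -{2}[a]powRr1 ?(ltW a0)// -powRD; last by rewrite (gt_eqF a0) implybT.
  by congr (_ `^ _); field; rewrite gt_eqF.
rewrite mulrC; apply: ler_pM => //.
- by apply: Rintegral_ge0 => x _; exact: powR_ge0.
- exact: powR_ge0.
rewrite le_eqVlt; apply/orP; left; apply/eqP; rewrite /t -powRrM.
by congr (_ `^ _); field; rewrite gt_eqF.
Qed.

(** The cube side e' = (2 a)^(1/N) makes the last Faber-Krahn term half of the L^1 norm of th, and s
    makes the weighted square contribute another quarter. Absorbing three quarters leaves the factor
    4, and the product of e'^2 and a^(2 - 2/p) gives the exponent of a. *)
Lemma norm1_truncation : 0 < dl -> 0 < a ->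
  I (fun x => `|th x|) <=
  4 * N%:R ^+ 2 * (1 + B) * 2 `^ (2 / N%:R) / (p - 1) * dl * a `^ (2 / N%:R + 2 - 2 / p).
Proof.
move=> dl0 a0; have p10 : 0 < p - 1 by rewrite subr_gt0.
have N0' : 0 < N%:R :> R by rewrite ltr0n.
pose e' := (2 * a) `^ N%:R^-1; have e'0 : 0 < e' by rewrite powR_gt0 ?mulr_gt0.
have e'N : e' ^- N * a = 2^-1.
  rewrite /e' -powR_mulrn ?powR_ge0// -powRrM mulVf ?gt_eqF// powRr1 ?mulr_ge0 ?(ltW a0)//.
  by field; rewrite gt_eqF.
have e'2 : e' ^+ 2 = 2 `^ (2 / N%:R) * a `^ (2 / N%:R).
  rewrite /e' -powR_mulrn ?powR_ge0// -powRrM (powRM _ _ (ltW a0))//.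
  by rewrite [N%:R^-1 * _]mulrC.
pose s := N%:R * e' * dl / (p - 1); have s0 : 0 < s by rewrite divr_gt0 ?mulr_gt0.
have fk := test_closure_faber_krahn oOm bOm p12 cth mA AO e'0.
have thA : \int[leb]_(x in A) `|th x| = I (fun x => `|th x|).
  rewrite /Rintegral integral_mkcond [in RHS]integral_mkcond; congr fine.
  apply: eq_integral => x _; rewrite !patchE.
  case: ifPn => [/set_mem Ax|Ax]; first by rewrite mem_set//; exact: AO.
  case: ifPn => // /set_mem Ox.
  have wk : w x <= k by apply: gt0_out => // h; rewrite mem_set in Ax.
  by rewrite /= /th trunc0E// ltNge wk /= normr0.
rewrite thA -[fine (leb A)]/a e'N in fk.
have hg := grad_truncation a0 s0; have hQ := wsqr_truncation.
set n := I (fun x => `|th x|) in fk hQ *.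
set q := I (fun x => th1 x * Q x) in hg hQ.
set g := I (fun x => enorm _) in fk hg.
have q1 : (4 * s)^-1 * q <= n / (4 * N%:R * e').
  have s40 : 0 < 4 * s by rewrite mulr_gt0.
  rewrite mulrC (ler_pdivrMr _ _ s40).
  rewrite (_ : n / (4 * N%:R * e') * (4 * s) = (p - 1)^-1 * (dl * n)); last first.
    by rewrite /s; field; rewrite ?gt_eqF ?e'0 ?N0' ?p10.
  by rewrite (ler_pdivlMl _ _ p10).
have h1 : g <= s * ((1 + B) * a `^ (2 - 2 / p)) + n / (4 * N%:R * e').
  apply: le_trans hg _; apply: lerD; [exact: lexx|exact: q1].
have Ne : 0 <= N%:R * e' by rewrite mulr_ge0// ltW.
have := le_trans fk (lerD (ler_wpM2l Ne h1) (lexx _)).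
rewrite (_ : N%:R * e' * (_ + _) + _ = N%:R * e' * s * ((1 + B) * a `^ (2 - 2 / p)) + 3 / 4 * n); last first.
  by field; rewrite !gt_eqF.
have -> : 4 * N%:R ^+ 2 * (1 + B) * 2 `^ (2 / N%:R) / (p - 1) * dl * a `^ (2 / N%:R + 2 - 2 / p) =
    4 * (N%:R * e' * s * ((1 + B) * a `^ (2 - 2 / p))).
  rewrite -addrA powRD; last by rewrite (gt_eqF a0) implybT.
  rewrite (_ : N%:R * e' * s = N%:R ^+ 2 * (dl / (p - 1)) * e' ^+ 2); last first.
    by rewrite /s; field; rewrite gt_eqF.
  by rewrite e'2; ring.
move: (N%:R * e' * s * _) => y; lra.
Qed.

(** Where w > h, the truncation at k with e = (h - k) / 2 is at least h - k - e = e. *)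
Lemma level_le_norm1 (h : R) : e = (h - k) / 2 -> (h - k) / 2 * level_measure h <= I (fun x => `|th x|).
Proof.
move=> eE; set Ah := Om `&` [set x | h < w x].
have mAh : measurable Ah.
  rewrite (_ : Ah = Om `&` w @^-1` `]h, +oo[); first exact: mw.
  by apply/seteqP; split=> x [Ox]; rewrite /= in_itv/= andbT.
have L1 : L (fun x => \1_Ah x).
  apply: (integrable_le mOm _ (integrable_cst_EFin mOm 1 finOm)) => [|x _].
    exact: measurable_indic.
  by rewrite indicE; case: (x \in Ah); rewrite ?normr1 ?normr0.
have -> : level_measure h = I (\1_Ah).
  rewrite /Rintegral (_ : (\int[leb]_(x in Om) (\1_Ah x)%:E)%E = leb Ah)//.
  by rewrite integral_indic// setIidl// => x [].
rewrite -(@RintegralZl _ _ _ leb Om _ ((h - k) / 2) mOm L1).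
apply: (le_Rintegral mOm (integrableZ_EFin mOm _ L1) (integrable_norm_EFin Lth)) => x _.
rewrite indicE; have [/set_mem[_ /= hw]|_] := boolP (x \in Ah); last by rewrite mulr0.
rewrite mulr1; apply: le_trans (ler_norm _); apply: le_trans (trunc0_ge k (w x) e0).
by rewrite eE; move: hw; lra.
Qed.

End truncation.
End level_sets.

Section sup_estimate.
Context {R : realType} {N : nat}.
Local Notation E := 'rV[R]_N.
Local Notation leb := (lebesgue_rV R N).
Variables (Om : set E) (p : R).
Hypotheses (N0 : (0 < N)%N) (oOm : open Om) (bOm : bounded_set Om) (p12 : 1 < p <= 2).
Hypothesis p_range : 2 * N%:R / (N%:R + 2) < p.
Local Notation I f := (Rintegral leb Om f).
Local Notation EN := (energy leb Om p).

Let mOm : measurable Om. Proof. exact: open_measurable_rV. Qed.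
Let finOm : (leb Om < +oo)%E. Proof. exact: lebesgue_rV_bounded. Qed.
Let p1 : 1 < p. Proof. by case/andP: p12. Qed.
Let p0 : 0 < p. Proof. exact: lt_trans p1. Qed.

(** Here the lower bound 2N / (N + 2) on p enters: it says that 2 / p < 2 / N + 1. *)
Lemma level_exponent_gt1 : 1 < 2 / N%:R + 2 - 2 / p.
Proof.
have N0' : 0 < N%:R :> R by rewrite ltr0n.
have : 2 / p < 2 / N%:R + 1.
  rewrite ltr_pdivrMr//; move: p_range; rewrite ltr_pdivrMr ?addr_gt0// => h.
  rewrite (_ : (2 / N%:R + 1) * p = p * (N%:R + 2) / N%:R).
    by rewrite ltr_pdivlMr.
  by field; rewrite gt_eqF.
lra.
Qed.

(** The level reached by Stampacchia's iteration is proportional to its constant, here c dl, while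
    b, c and m0 depend on the data and M only. This proportionality is the Lipschitz estimate. *)
Lemma weak_sol_upper_estimate (M : R) : 0 <= M -> exists2 C : R, 0 < C &
  forall (f1 f2 u1 u2 : E -> R) (G1 G2 : E -> E) (dl : R),
  measurable_fun Om f1 -> measurable_fun Om f2 ->
  (forall x, `|f1 x| <= M) -> (forall x, `|f2 x| <= M) ->
  weak_sol Om p f1 u1 G1 -> weak_sol Om p f2 u2 G2 -> 0 < dl ->
  {ae leb, forall x, Om x -> `|f1 x - f2 x| <= dl} ->
  {ae leb, forall x, Om x -> u1 x - u2 x <= C * dl}.
Proof.
move=> M0; have [B B0 HB] := weak_sol_energy N0 oOm bOm p12 M0.
have p10 : 0 < p - 1 by rewrite subr_gt0.
have N0' : 0 < N%:R :> R by rewrite ltr0n.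
set b := 2 / N%:R + 2 - 2 / p; have b1 : 1 < b by exact: level_exponent_gt1.
pose c := 4 * N%:R ^+ 2 * (1 + 8 * B) * 2 `^ (2 / N%:R) / (p - 1).
have c0 : 0 < c.
  have h : 0 < 1 + 8 * B by rewrite ltr_pwDl// mulr_ge0.
  by rewrite divr_gt0// !mulr_gt0 ?exprn_gt0 ?powR_gt0.
(* The added 1 keeps m0 positive when Om has measure 0. *)
pose m0 := fine (leb Om) + 1; have m00 : 0 < m0 by rewrite ltr_wpDl// fine_ge0.
pose q : R := 2^-1 `^ (b - 1)^-1; have q0 : 0 < q by rewrite powR_gt0 ?invr_gt0.
have f4 : (0 : R) < 4 by [].
exists (4 * c * m0 `^ (b - 1) / q).
  exact: divr_gt0 (mulr_gt0 (mulr_gt0 f4 c0) (powR_gt0 (b - 1) m00)) q0.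
move=> f1 f2 u1 u2 G1 G2 dl mf1 mf2 f1M f2M s1 s2 dl0 f12.
have LG1 := test_closure_vLp oOm p12 s1.1; have LG2 := test_closure_vLp oOm p12 s2.1.
have KB : I (fun x => (enorm (G1 x) + enorm (G2 x)) `^ p) <= 8 * B.
  have [_ h _ _] := vLp_wsqr mOm p12 LG1 LG2; apply: le_trans h _.
  have := lerD (HB _ _ _ mf1 f1M s1) (HB _ _ _ mf2 f2M s2).
  by move=> h; rewrite (_ : 8 * B = 4 * (B + B)); [exact: (ler_wpM2l (ler0n _ 4) h)|ring].
pose m := level_measure Om u1 u2.
have cw := test_closureB oOm bOm p12 s1.1 s2.1.
have mw : measurable_fun Om (fun x => u1 x - u2 x).
  by case: ((vLp_jetP oOm p12 _ _).1 cw.1) => _ [].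
pose A k : set E := Om `&` [set x | k < u1 x - u2 x].
have mA k : measurable (A k).
  rewrite (_ : A k = Om `&` (fun x => u1 x - u2 x) @^-1` `]k, +oo[); first exact: mw.
  by apply/seteqP; split=> x [Ox]; rewrite /= in_itv/= andbT.
have finA k : (leb (A k) < +oo)%E.
  by apply: le_lt_trans finOm; apply: le_measure; rewrite ?inE// => x [].
have fnA k : leb (A k) \is a fin_num by rewrite ge0_fin_numE.
have mge0 k : 0 <= m k by exact: fine_ge0.
have mdec k h : k <= h -> m h <= m k.
  move=> kh; apply: (fine_le (fnA h) (fnA k)).
  apply: le_measure; rewrite ?inE// => x [Ox hx].
  by split => //; exact: le_lt_trans hx.
have m0le : m 0 <= m0.
  apply: le_trans (_ : _ <= fine (leb Om)) _; last by rewrite lerDl.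
  have fOm : leb Om \is a fin_num by rewrite ge0_fin_numE.
  by apply: (fine_le (fnA 0) fOm); apply: le_measure; rewrite ?inE// => x [].
have step k h : 0 <= k < h -> (h - k) / 2 * m h <= (c * dl) * m k `^ b.
  move=> /andP[k0 kh]; have e0 : 0 < (h - k) / 2 by rewrite divr_gt0// subr_gt0.
  (* If the level set at k is null, so is the one at h; [norm1_truncation] needs positive measure,
     because it takes a negative power of it. *)
  have := mge0 k; rewrite le_eqVlt => /predU1P[mk0|mk0].
    have -> : m h = 0 by apply/eqP; rewrite eq_le mge0 andbT mk0 mdec// ltW.
    by rewrite mulr0; exact: mulr_ge0 (ltW (mulr_gt0 c0 dl0)) (powR_ge0 _ _).
  apply: le_trans (level_le_norm1 oOm bOm p12 s1 s2 k0 e0 erefl) _.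
  exact: (norm1_truncation N0 oOm bOm p12 mf1 mf2 f1M f2M s1 s2 f12 KB k0 e0 dl0 mk0).
have := stampacchia b1 (mulr_gt0 c0 dl0) m00 mge0 mdec m0le step.
rewrite (_ : 4 * (c * dl) * _ / _ = 4 * c * m0 `^ (b - 1) / q * dl); last first.
  by rewrite -/q; ring.
set K := _ * dl => mK; exists (A K); split => //.
  by rewrite -[LHS]fineK// -[fine _]/(m K) mK.
move=> x /= /not_implyP[Ox /negP]; rewrite -ltNge => ?.
by split.
Qed.

Lemma weak_sol_estimate (M : R) : 0 <= M -> exists2 C : R, 1 <= C &
  forall (f1 f2 u1 u2 : E -> R) (G1 G2 : E -> E) (dl : R),
  measurable_fun Om f1 -> measurable_fun Om f2 ->
  (forall x, `|f1 x| <= M) -> (forall x, `|f2 x| <= M) ->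
  weak_sol Om p f1 u1 G1 -> weak_sol Om p f2 u2 G2 -> 0 < dl ->
  {ae leb, forall x, Om x -> `|f1 x - f2 x| <= dl} ->
  {ae leb, forall x, Om x -> `|u1 x - u2 x| <= C * dl} /\
  EN (jet (fun x => u1 x - u2 x) (fun x => G1 x - G2 x)) <= C * dl `^ p.
Proof.
move=> M0; have [B B0 HB] := weak_sol_energy N0 oOm bOm p12 M0.
have [C1 C10 H1] := weak_sol_upper_estimate M0.
have [C2 C20 H2] := test_closure_poincare oOm bOm p12 N0.
have p10 : 0 < p - 1 by rewrite subr_gt0.
set m := fine (leb Om); have m0 : 0 <= m by exact: fine_ge0.
pose C3 := 8 * B + C1 * m / (p - 1).
have C30 : 0 <= C3 by rewrite addr_ge0 ?mulr_ge0 ?invr_ge0 ?(ltW C10) ?(ltW p10).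
have C230 : 0 <= C2 * C3 by rewrite mulr_ge0.
exists (1 + C1 + C2 * C3); first by rewrite -addrA lerDl addr_ge0// ltW.
move=> f1 f2 u1 u2 G1 G2 dl mf1 mf2 f1M f2M s1 s2 dl0 f12.
have f21 : {ae leb, forall x, Om x -> `|f2 x - f1 x| <= dl}.
  by apply: filterS f12 => x h Ox; rewrite distrC h.
have w1 : {ae leb, forall x, Om x -> `|u1 x - u2 x| <= C1 * dl}.
  have := H1 _ _ _ _ _ _ _ mf1 mf2 f1M f2M s1 s2 dl0 f12.
  have := H1 _ _ _ _ _ _ _ mf2 mf1 f2M f1M s2 s1 dl0 f21.
  by apply: filterS2 => x h2 h1 Ox; rewrite ler_norml h1// andbT lerNl opprB h2.
split.
  apply: filterS w1 => x h Ox; apply: le_trans (h Ox) _; apply: ler_wpM2r; first exact: ltW.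
  by rewrite addrAC lerDr addr_ge0.
have cw := test_closureB oOm bOm p12 s1.1 s2.1.
apply: le_trans (H2 _ _ cw) _.
have LG1 := test_closure_vLp oOm p12 s1.1; have LG2 := test_closure_vLp oOm p12 s2.1.
have [LK hK LQ hs] := vLp_wsqr mOm p12 LG1 LG2.
have KB : I (fun x => (enorm (G1 x) + enorm (G2 x)) `^ p) <= 8 * B.
  apply: le_trans hK _.
  have h := lerD (HB _ _ _ mf1 f1M s1) (HB _ _ _ mf2 f2M s2).
  by rewrite (_ : 8 * B = 4 * (B + B)); [exact: (ler_wpM2l (ler0n _ 4) h)|ring].
have [Lw _] := test_closure_integrable oOm bOm p12 cw.
have Iw : I (fun x => `|u1 x - u2 x|) <= C1 * dl * m.
  have -> : C1 * dl * m = I (cst (C1 * dl)) by rewrite Rintegral_cst.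
  exact: (ae_le_Rintegral mOm (integrable_norm_EFin Lw) (integrable_cst_EFin mOm _ finOm) w1).
have IQ : I (fun x => wsqr p (G1 x) (G2 x)) <= dl ^+ 2 * (C1 * m / (p - 1)).
  have := wsqr_difference oOm bOm p12 mf1 mf2 f1M f2M s1 s2 f12.
  move=> /le_trans/(_ (ler_wpM2l (ltW dl0) Iw)); rewrite -ler_pdivlMl// => /le_trans; apply.
  by rewrite le_eqVlt; apply/orP; left; apply/eqP; field; rewrite gt_eqF.
have ED : EN (fun x => G1 x - G2 x) <= C3 * dl `^ p.
  (* Taking s = dl, both terms are of order dl^p, since the weighted square is of order dl^2. *)
  apply: le_trans (hs _ dl0) _; rewrite /C3 [leRHS]mulrDl; apply: lerD.
    by rewrite [leRHS]mulrC; apply: ler_wpM2l => //; exact: powR_ge0.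
  apply: le_trans (ler_wpM2l (powR_ge0 _ _) IQ) _.
  rewrite le_eqVlt; apply/orP; left; apply/eqP.
  have e := powRS2 (ltW dl0) p1; move: e; move: (dl `^ p) (dl `^ (p - 2)) => r s ->.
  by move: (C1 * m / (p - 1)) => X; ring.
apply: le_trans (ler_wpM2l C20 ED) _; rewrite mulrA; apply: ler_wpM2r; first exact: powR_ge0.
by rewrite lerDr addr_ge0// ltW.
Qed.

End sup_estimate.

(** * The nonlinearity *)

Section locally_lipschitz.
Context {R : realType} {d : nat}.
Local Notation F := 'rV[R]_d.
Implicit Types (y z : F) (g : F -> F).

Lemma rV_norm_le y (c : R) : 0 <= c -> (forall i, `|y ord0 i| <= c) -> `|y| <= c.
Proof.
move=> c0 yc; have [->|y0] := eqVneq `|y| 0; first by [].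
by have [[i j] /= yij] := mx_norm_neq0 y0; rewrite /Num.norm/= yij (ord1 i).
Qed.

Lemma locally_lipschitz_near g y : locally_lipschitz g -> exists2 U, nbhs y U &
  exists2 C : R, 0 < C & forall y' z', U y' -> U z' -> `|g y' - g z'| <= C * `|y' - z'|.
Proof.
move=> /(_ y)[U yU lipU]; exists U => //.
have [C [C0 h]] : exists C : R, 0 < C /\
    forall yz : F * F, (U `*` U) yz -> `|g yz.1 - g yz.2| <= C * `|yz.1 - yz.2|.
  near (pinfty_nbhs R) => C; exists C; split; first by near: C; exact: nbhs_pinfty_gt.
  by near: C; exact: lipU.
by exists C => // y' z' Uy Uz; exact: (h (y', z')).
Unshelve. all: by end_near. Qed.

Lemma locally_lipschitz_continuous g i : locally_lipschitz g ->
  continuous (fun y : F => g y ord0 i).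
Proof.
move=> lg y; have [U yU [C C0 hC]] := locally_lipschitz_near y lg.
move=> A /nbhs_ballP[e /= e0 eA]; have eC : 0 < e / C by exact: divr_gt0.
have nB := @filterI _ _ (nbhs_filter (y : F)) _ _ yU (nbhsx_ballx (y : F) (e / C) eC).
suff sub : U `&` ball (y : F) (e / C) `<=` (fun y' : F => g y' ord0 i) @^-1` A.
  exact: (@filterS _ _ (nbhs_filter (y : F)) _ _ sub nB).
move=> y' [Uy']; rewrite mx_norm_ball /ball_/= => h; apply: eA; rewrite /ball/=.
apply: le_lt_trans (_ : _ <= `|g y - g y'|) _.
  by have := entry_le_norm (g y - g y') i; rewrite !mxE.
apply: le_lt_trans (hC _ _ (nbhs_singleton yU) Uy') _.
by rewrite mulrC -ltr_pdivlMr.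
Qed.

Definition unit_box : set F := [set y | forall i, `|y ord0 i| <= 1].

(** Compactness of the product of the box with itself. Near a diagonal point the local Lipschitz
    constant serves; near a pair y <> z the numerator is bounded and the denominator stays away from
    0. *)
Lemma locally_lipschitz_unit_box g : locally_lipschitz g ->
  exists2 C : R, 0 < C & forall y z, unit_box y -> unit_box z ->
    `|g y - g z| <= C * `|y - z|.
Proof.
move=> lg.
have cK : compact unit_box.
  have := @box_closed_compact R d (const_mx (-1)) (const_mx 1).
  congr compact; apply/seteqP; split=> y h i; have := h i.
    by rewrite !mxE in_itv/= ler_norml.
  by rewrite !mxE in_itv/= ler_norml.
pose P (C : R) (yz : F * F) : Prop := `|g yz.1 - g yz.2| <= C * `|yz.1 - yz.2|.
have /compact_near_coveringP/(_ R (pinfty_nbhs R) P) := compact_setX cK cK.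
move=> /(_ _)[[y z] _ /=|C0 [C0r hC]]; last first.
  exists (Num.max 1 (C0 + 1)); first by rewrite lt_max ltr01.
  move=> y z Ky Kz; apply: (hC (Num.max 1 (C0 + 1)) _ (y, z)) => //.
  by rewrite lt_max ltrDl ltr01 orbT.
have [U yU [C1 C10 h1]] := locally_lipschitz_near y lg.
have [V zV [C2 C20 h2]] := locally_lipschitz_near z lg.
have [yz|yz] := eqVneq y z.
  exists (U `*` U, [set C | C1 < C]).
    split; last by exists C1; split; [exact: num_real|].
    by exists (U, U) => //; split => //; rewrite -yz.
  move=> [[y' z'] C] /= [[Uy Uz] C1C]; rewrite /P/=.
  by apply: le_trans (h1 _ _ Uy Uz) _; apply: ler_wpM2r => //; exact: ltW.
have r0 : 0 < `|y - z| by rewrite normr_gt0 subr_eq0.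
set r := `|y - z| in r0.
have r4 : 0 < r / 4 by rewrite divr_gt0.
(* On balls of radius r / 4 the difference of the values is at most this numerator, while the points
   keep a distance of at least r / 2. *)
pose C3 := (C1 * (r / 4) + C2 * (r / 4) + `|g y - g z|) / (r / 2).
exists ((U `&` ball y (r / 4)) `*` (V `&` ball z (r / 4)), [set C | C3 < C]).
  split; last by exists C3; split; [exact: num_real|].
  exists (U `&` ball y (r / 4), V `&` ball z (r / 4)) => //; split.
    exact: (@filterI _ _ (nbhs_filter y) _ _ yU (nbhsx_ballx y (r / 4) r4)).
  exact: (@filterI _ _ (nbhs_filter z) _ _ zV (nbhsx_ballx z (r / 4) r4)).
move=> [[y' z'] C] /= [[[Uy by'] [Vz bz']] C3C]; rewrite /P/=.
rewrite mx_norm_ball /ball_/= in by' bz'.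
have ky := h1 _ _ (nbhs_singleton yU) Uy; have kz := h2 _ _ (nbhs_singleton zV) Vz.
have k1 : `|g y' - g z'| <= C1 * (r / 4) + C2 * (r / 4) + `|g y - g z|.
  rewrite (_ : g y' - g z' = - (g y - g y') + (g z - g z') + (g y - g z)); last first.
    by rewrite opprB; apply/rowP => i; rewrite !mxE; ring.
  apply: le_trans (ler_normD _ _) _; rewrite lerD2r.
  apply: le_trans (ler_normD _ _) _; rewrite normrN; apply: lerD.
    by apply: le_trans ky _; rewrite ler_pM2l// ltW.
  by apply: le_trans kz _; rewrite ler_pM2l// ltW.
have k2 : r / 2 <= `|y' - z'|.
  have : r <= `|y - y'| + `|y' - z'| + `|z - z'|.
    rewrite /r (_ : y - z = (y - y') + (y' - z') + (z' - z)); last first.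
      by apply/rowP => i; rewrite !mxE; ring.
    rewrite [`|z - z'|]distrC; apply: le_trans (ler_normD _ _) _; rewrite lerD2r.
    exact: ler_normD.
  move: by' bz'; move: `|y - y'| `|z - z'| `|y' - z'| => ? ? ?; lra.
have r2 : 0 < r / 2 by rewrite divr_gt0.
have C30 : 0 <= C3.
  by rewrite /C3 divr_ge0 ?(ltW r2)// !addr_ge0// mulr_ge0 ?ltW.
apply: le_trans k1 _; have -> : C1 * (r / 4) + C2 * (r / 4) + `|g y - g z| = C3 * (r / 2).
  by rewrite /C3 divfK// gt_eqF.
by apply: ler_pM => //; exact: ltW.
Qed.

Definition clip y : F := \row_i Num.max (-1) (Num.min 1 (y ord0 i)).

Lemma clip_unit_box y : unit_box (clip y).
Proof.
have h : -1 <= 1 :> R by lra.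
by move=> i; rewrite mxE ler_norml le_max lexx/= ge_max h ge_min lexx.
Qed.

Lemma clip_id y : `|y| <= 1 -> clip y = y.
Proof.
move=> y1; apply/rowP => i; rewrite mxE.
have := le_trans (entry_le_norm y i) y1; rewrite ler_norml => /andP[h1 h2].
by rewrite min_r// max_r.
Qed.

Lemma clip_lipschitz y z : `|clip y - clip z| <= `|y - z|.
Proof.
apply: rV_norm_le => // i; apply: le_trans (_ : _ <= `|(y - z) ord0 i|) _; last exact: entry_le_norm.
rewrite !mxE; move: (y ord0 i) (z ord0 i) => s t.
rewrite ler_norml; apply/andP; split.
  rewrite /Num.max /Num.min; have := ler_norm (s - t); have := lerNnormlW (lexx `|s - t|).
  by repeat case: ifPn; rewrite -?leNgt; lra.
rewrite /Num.max /Num.min; have := ler_norm (s - t); have := lerNnormlW (lexx `|s - t|).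
by repeat case: ifPn; rewrite -?leNgt; lra.
Qed.

(** One constant is made to serve both as Lipschitz constant and as bound: clipped points are at
    distance at most 2 from [clip 0]. *)
Lemma clip_comp_lipschitz g : locally_lipschitz g -> exists2 C : R, 0 < C &
  (forall y z, `|g (clip y) - g (clip z)| <= C * `|y - z|) /\ forall y, `|g (clip y)| <= C.
Proof.
move=> /locally_lipschitz_unit_box[C C0 hC].
exists (C + `|g (clip 0)| + C); first by rewrite -addrA ltr_pwDl// addr_ge0// ltW.
have le y z : `|g (clip y) - g (clip z)| <= C * `|clip y - clip z|.
  by apply: hC; exact: clip_unit_box.
split=> [y z|y].
  apply: le_trans (le y z) _; apply: ler_pM => //; first exact: ltW.
    by rewrite -addrA lerDl addr_ge0// ltW.
  exact: clip_lipschitz.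
rewrite -(subrK (g (clip 0)) (g (clip y))); apply: le_trans (ler_normD _ _) _.
have : `|clip y - clip 0| <= 2.
  apply: rV_norm_le => // i; rewrite [X in `|X|]mxE [X in _ + X]mxE.
  have := clip_unit_box y i; have := clip_unit_box 0 i.
  by rewrite !ler_norml => /andP[? ?] /andP[? ?]; apply/andP; split; lra.
move=> h; have := le_trans (le y 0) (ler_wpM2l (ltW C0) h).
rewrite addrAC => k; apply: lerD => //; apply: le_trans k _; lra.
Qed.

End locally_lipschitz.

(** * Solutions of the system *)

Section sup_norm.
Context {R : realType} {N : nat}.
Local Notation E := 'rV[R]_N.
Local Notation leb := (lebesgue_rV R N).
Variables (Om : set E) (mOm : measurable Om).

Lemma Lp_infty_norm_le (f : E -> R) (c : R) : 0 <= c ->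
  {ae leb, forall x, Om x -> `|f x| <= c} -> (Lp_norm Om +oo f <= c%:E)%E.
Proof.
move=> c0 fc; rewrite /Lp_norm unlock; case: ifPn => // _; apply/ess_supP.
apply: filterS fc => x h; rewrite /= patchE; case: ifPn => [/set_mem/h|_]; first by rewrite lee_fin.
by rewrite (_ : point = 0 :> R)// normr0 lee_fin.
Qed.

Lemma Lp_infty_norm_ae (f : E -> R) (c : \bar R) : (Lp_norm Om +oo f <= c)%E ->
  {ae leb, forall x, Om x -> (`|f x|%:E <= c)%E}.
Proof.
rewrite /Lp_norm unlock; case: ifPn => [_ /ess_supP|].
  apply: filterS => x h Ox; apply: le_trans h; rewrite /= patchE mem_set//.
(* Here the whole space has measure 0, so every property holds almost everywhere. *)
rewrite -leNgt => leb0 _; exists setT; split => //.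
by apply/eqP; rewrite eq_le leb0/= measure_ge0.
Qed.

Lemma Lp_inftyP (f : E -> R) : Lp Om +oo f <-> measurable_fun Om f /\
  exists2 c : R, 0 <= c & {ae leb, forall x, Om x -> `|f x| <= c}.
Proof.
split=> [/andP[]|[mf [c c0 fc]]].
  rewrite !inE /= => /(measurable_restrictT _ mOm) mf.
  rewrite /finite_norm -/(Lp_norm Om +oo f) => h; split=> //.
  have n0 : (0 <= Lp_norm Om +oo f)%E by exact: Lnorm_ge0.
  exists (fine (Lp_norm Om +oo f)); first exact: fine_ge0.
  apply: filterS (Lp_infty_norm_ae (lexx (Lp_norm Om +oo f))) => x hx Ox.
  by rewrite -lee_fin fineK ?ge0_fin_numE// hx.
apply/andP; rewrite !inE /=; split; first exact/(measurable_restrictT _ mOm).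
by rewrite /finite_norm -/(Lp_norm Om +oo f); apply: le_lt_trans (Lp_infty_norm_le c0 fc) (ltry _).
Qed.

Lemma measurable_rV_on n (f : E -> 'rV[R]_n) :
  (forall i, measurable_fun Om (fun x => f x ord0 i)) -> measurable_fun Om f.
Proof.
move=> mf; pose h x : 'rV[R]_n := \row_i ((fun x => f x ord0 i) \_ Om) x.
have mh : measurable_fun setT h.
  apply/measurable_rVP => i; under eq_fun do rewrite mxE.
  exact/(measurable_restrictT _ mOm).
apply: (eq_measurable_fun h); last exact: measurable_funTS.
by move=> x Ox; apply/rowP => i; rewrite mxE patchE Ox.
Qed.

End sup_norm.

Section weak_sol_solution.
Context {R : realType} {N : nat}.
Local Notation E := 'rV[R]_N.
Local Notation leb := (lebesgue_rV R N).
Variables (Om : set E) (p : R).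
Hypotheses (oOm : open Om) (bOm : bounded_set Om) (p12 : 1 < p <= 2).
Local Notation L f := (leb.-integrable Om (EFin \o f)).
Local Notation I f := (Rintegral leb Om f).

Let mOm : measurable Om. Proof. exact: open_measurable_rV. Qed.
Let finOm : (leb Om < +oo)%E. Proof. exact: lebesgue_rV_bounded. Qed.
Let p1 : 1 < p. Proof. by case/andP: p12. Qed.
Let p0 : 0 < p. Proof. exact: lt_trans p1. Qed.

Lemma test_closure_measurable u G : test_closure Om p u G -> measurable_fun Om u.
Proof. by move=> cu; case: ((vLp_jetP oOm p12 u G).1 cu.1) => _ []. Qed.

Lemma weak_sol_eq (f h : E -> R) u G : measurable_fun Om f -> measurable_fun Om h ->
  {ae leb, forall x, Om x -> f x = h x} -> weak_sol Om p f u G -> weak_sol Om p h u G.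
Proof.
move=> mf mh fh [cu su]; split=> // v V cv; rewrite (su _ _ cv).
have mv := test_closure_measurable cv.
apply: (ae_eq_Rintegral mOm (measurable_funM mf mv) (measurable_funM mh mv)).
by apply: filterS fh => x h' Ox; rewrite /= h'.
Qed.

(** Passage between explicit gradients and the chosen [weak_gradient]: the two agree almost
    everywhere, hence so do the flux integrals, and the spaces of test functions coincide. *)
Lemma weak_solP f u : (exists G, weak_sol Om p f u G) <-> W1p0 Om p u /\
  forall v, W1p0 Om p v ->
    I (fun x => dot (p_flux p (weak_gradient Om u x)) (weak_gradient Om v x)) =
    I (fun x => f x * v x).
Proof.
split=> [[G [cu su]]|[Wu su]]; last first.
  have cu := W1p0_test_closure oOm bOm p12 Wu.
  exists (weak_gradient Om u); split=> // v V cv.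
  have Wv := test_closure_W1p0 oOm bOm p12 cv; rewrite -(su _ Wv).
  have cv' := W1p0_test_closure oOm bOm p12 Wv.
  have LU := test_closure_vLp oOm p12 cu.
  have L1 := vLp_flux_integrable mOm p12 LU (test_closure_vLp oOm p12 cv).
  have L2 := vLp_flux_integrable mOm p12 LU (test_closure_vLp oOm p12 cv').
  apply: (ae_eq_Rintegral mOm (integrable_measurable L1) (integrable_measurable L2)).
  have [_ h] := weak_gradientP oOm (test_closure_weak_gradient oOm bOm p12 cv).
  by apply: filterS h => x hx Ox; rewrite /= hx.
split=> [|v Wv]; first exact: (test_closure_W1p0 oOm bOm p12 cu).
have cv := W1p0_test_closure oOm bOm p12 Wv; rewrite -(su _ _ cv).
have cu' := W1p0_test_closure oOm bOm p12 (test_closure_W1p0 oOm bOm p12 cu).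
have LV := test_closure_vLp oOm p12 cv.
have L1 := vLp_flux_integrable mOm p12 (test_closure_vLp oOm p12 cu) LV.
have L2 := vLp_flux_integrable mOm p12 (test_closure_vLp oOm p12 cu') LV.
apply: (ae_eq_Rintegral mOm (integrable_measurable L2) (integrable_measurable L1)).
have [_ h] := weak_gradientP oOm (test_closure_weak_gradient oOm bOm p12 cu).
by apply: filterS h => x hx Ox; rewrite /= hx.
Qed.

(** Since C >= 1, C dl^p <= (C dl)^p, so each of the two p-th roots in the norm is at most C dl. *)
Lemma W1p_norm_le u G (C dl : R) : 1 <= C -> 0 < dl -> test_closure Om p u G ->
  energy leb Om p (jet u G) <= C * dl `^ p -> (W1p_norm Om p u <= (2 * C * dl)%:E)%E.
Proof.
move=> C1 dl0 cu h; rewrite (W1p_normE oOm bOm p12 cu) lee_fin.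
have [h1 h2 _] := energy_jet oOm p12 cu.1; have C0 : 0 <= C by exact: le_trans C1.
have root (a : R) : 0 <= a -> a <= C * dl `^ p -> a `^ p^-1 <= C * dl.
  move=> a0 ae; have CC : C * dl `^ p <= (C * dl) `^ p.
    rewrite (powRM _ C0 (ltW dl0)); apply: ler_wpM2r; first exact: powR_ge0.
    by rewrite -[leLHS]powRr1//; apply: ler_powR => //; exact: ltW.
  have -> : C * dl = ((C * dl) `^ p) `^ p^-1.
    by rewrite -powRrM divff ?gt_eqF// powRr1// mulr_ge0// ltW.
  apply: ge0_ler_powR; rewrite ?nnegrE ?invr_ge0 ?powR_ge0 ?(ltW p0)//.
  exact: le_trans ae CC.
rewrite -mulrA mulr_natl mulr2n; apply: lerD; apply: root.
- by apply: Rintegral_ge0 => x _; exact: powR_ge0.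
- exact: le_trans h1 h.
- exact: energy_ge0.
- exact: le_trans h2 h.
Qed.

(** Hoelder's inequality on a set of measure m, with the constant m + 1. It results from [le_powR_p]
    with t the L^p norm of u, plus e to make it positive. *)
Lemma W1p0_norm1 u : W1p0 Om p u -> L u /\
  ((I (fun x => `|u x|))%:E <= (fine (leb Om) + 1)%:E * W1p_norm Om p u)%E.
Proof.
move=> Wu; have cu := W1p0_test_closure oOm bOm p12 Wu.
have [Lu _] := test_closure_integrable oOm bOm p12 cu; split => //.
rewrite (W1p_normE oOm bOm p12 cu) -EFinM lee_fin.
have [_ [mu Lpu]] := (vLp_jetP oOm p12 _ _).1 cu.1.
set m := fine (leb Om); have m0 : 0 <= m by exact: fine_ge0.
set A := I (fun x => `|u x| `^ p); have A0 : 0 <= A.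
  by apply: Rintegral_ge0 => x _; exact: powR_ge0.
apply: le_trans (_ : _ <= (m + 1) * A `^ p^-1) _; last first.
  by apply: ler_wpM2l; [exact: addr_ge0|rewrite lerDl powR_ge0].
apply: (@ler_add_eps _ _ _ (m + 1)) => e e0; set t := A `^ p^-1 + e.
have t0 : 0 < t by rewrite ltr_wpDl// powR_ge0.
have At : A <= t `^ p.
  rewrite -[leLHS]powRr1// -(mulVf (lt0r_neq0 p0)) powRrM.
  by apply: ge0_ler_powR; rewrite ?nnegrE ?powR_ge0 ?(ltW p0) ?(ltW t0) ?lerDl ?(ltW e0).
have Lg := integrableD_EFin mOm (integrable_cst_EFin mOm t finOm) (integrableZ_EFin mOm (t `^ (1 - p)) Lpu).
have : I (fun x => `|u x|) <= I (fun x => t + t `^ (1 - p) * `|u x| `^ p).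
  apply: (le_Rintegral mOm (integrable_norm_EFin Lu) Lg) => x _.
  exact: le_powR_p.
rewrite (RintegralD mOm (integrable_cst_EFin mOm t finOm) (integrableZ_EFin mOm (t `^ (1 - p)) Lpu)).
rewrite (@RintegralZl _ _ _ leb Om _ (t `^ (1 - p)) mOm Lpu) Rintegral_cst// -/m -/A.
move=> /le_trans; apply; rewrite -mulrDr -/t (mulrDl m 1) mul1r [m * t]mulrC lerD2l.
apply: le_trans (ler_wpM2l (powR_ge0 _ _) At) _; rewrite -powRD; last by rewrite (gt_eqF t0) implybT.
by rewrite subrK powRr1// ltW.
Qed.

Lemma pairing_W1p0_dual (h : E -> R) : Lp Om +oo h -> W1p0_dual Om p (pairing Om h).
Proof.
move=> /(Lp_inftyP mOm)[mh [c c0 hc]].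
have Lh v : W1p0 Om p v -> L (fun x => h x * v x) /\
    `|pairing Om h v| <= c * I (fun x => `|v x|).
  move=> Wv; have [Lv _] := W1p0_norm1 Wv; have mv := integrable_measurable Lv.
  (* The bound on h holds almost everywhere; h' agrees with h there and is bounded at every point,
     as [integrable_mul_bounded] requires. *)
  pose h' x := if `|h x| <= c then h x else 0.
  have mh' : measurable_fun Om h'.
    apply: measurable_fun_if => //; last exact: measurable_funS mh.
    by apply: measurable_fun_ler => //; exact: measurableT_comp.
  have h'c x : `|h' x| <= c by rewrite /h'; case: ifPn => // _; rewrite normr0.
  have [L1 h1] := integrable_mul_bounded oOm Lv mh' h'c.
  have hh' : {ae leb, forall x, Om x -> v x * h' x = h x * v x}.
    by apply: filterS hc => x hx Ox; rewrite /h' hx// mulrC.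
  have mhv : measurable_fun Om (fun x => h x * v x) by exact: measurable_funM.
  have eI := ae_eq_Rintegral mOm (integrable_measurable L1) mhv hh'.
  rewrite /pairing -eI; split => //.
  have Lcv := integrableZ_EFin mOm c (integrable_norm_EFin Lv).
  have mEhv : measurable_fun Om (EFin \o (fun x => h x * v x)) by exact/measurable_EFinP.
  apply/integrableP; split; first exact: mEhv.
  apply: (@le_lt_trans _ _ (\int[leb]_(x in Om) (c * `|v x|)%:E)%E); last first.
    by rewrite -(EFin_Rintegral mOm Lcv) ltry.
  apply: (ae_ge0_le_integral mOm) => //.
  - exact: measurableT_comp.
  - by move=> x _; rewrite lee_fin mulr_ge0.
  - by have /integrableP[mcv _] := Lcv; exact: mcv.
  by apply: filterS hc => x hx Ox; rewrite lee_fin normrM ler_wpM2r// hx.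
split=> [a u v Wu Wv|].
  have [Lu _] := Lh _ Wu; have [Lv _] := Lh _ Wv; rewrite /pairing.
  rewrite -(@RintegralZl _ _ _ leb Om _ a mOm Lu) -(RintegralD mOm (integrableZ_EFin mOm a Lu) Lv).
  by apply: eq_Rintegral => x _ /=; ring.
exists (c * (fine (leb Om) + 1)) => v Wv; have [_ h1] := Lh _ Wv; have [_ h2] := W1p0_norm1 Wv.
apply: le_trans (_ : _ <= c%:E * (I (fun x => `|v x|))%:E)%E _; first by rewrite -EFinM lee_fin.
by rewrite EFinM -muleA; apply: lee_wpmul2l; rewrite ?lee_fin.
Qed.

End weak_sol_solution.

(** * Contraction and dependence on the parameter *)

Section fixed_point.
Context {R : realType} {N d : nat}.
Local Notation E := 'rV[R]_N.
Local Notation F := 'rV[R]_d.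
Local Notation leb := (lebesgue_rV R N).
Variables (Om : set E) (p : 'I_d -> R).
Hypotheses (N0 : (0 < N)%N) (oOm : open Om) (bOm : bounded_set Om).
Hypotheses (p12 : forall i, 1 < p i <= 2)
  (p_range : forall i, 2 * N%:R / (N%:R + 2) < p i).
Variables (h : F -> F) (K : R).
Hypotheses (K0 : 0 < K) (hlip : forall y z, `|h y - h z| <= K * `|y - z|)
  (hK : forall y, `|h y| <= K).
Implicit Types (f u v : E -> F).

Let mOm : measurable Om. Proof. exact: open_measurable_rV. Qed.

Lemma le_geometric (a b c : R) : 0 <= c -> (forall n, a <= b + c * 2^-1 ^+ n) -> a <= b.
Proof.
move=> c0 abc; have cv : b + c * 2^-1 ^+ n @[n --> \oo] --> b.
  rewrite -[X in _ --> X]addr0 -[X in _ --> _ + X](mulr0 c).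
  apply: cvgD; first exact: cvg_cst.
  apply: cvgMr; apply: cvg_expr.
  by rewrite ger0_norm ?invr_ge0// invf_lt1// ltr1n.
rewrite -(cvg_lim _ cv)//; apply: limr_ge; first by apply/cvg_ex; exists b.
exact: nearW.
Qed.

Definition mvec f := forall i, measurable_fun Om (component f i).

Definition vec_weak_sol f u := forall i, exists G,
  weak_sol Om (p i) (component f i) (component u i) G.

Lemma vec_weak_sol_measurable f u : vec_weak_sol f u -> mvec u.
Proof. by move=> su i; have [G [cu _]] := su i; exact: (test_closure_measurable oOm (p12 i) cu). Qed.

Lemma vec_weak_sol_exists f : mvec f -> (forall x, `|f x| <= K) -> exists u, vec_weak_sol f u.
Proof.
move=> mf fK; have /choice[u hu] : forall i, exists u : E -> R, exists G,
    weak_sol Om (p i) (component f i) u G.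
  move=> i; apply: (weak_sol_exists N0 oOm bOm (p12 i) (mf i) (M := K)) => x.
  exact: le_trans (entry_le_norm _ _) (fK x).
exists (fun x => \row_i u i x) => i; have [G hG] := hu i; exists G.
by rewrite [X in weak_sol _ _ _ X _](_ : _ = u i)//; apply/funext => x; rewrite /component mxE.
Qed.

Lemma vec_weak_sol0 : vec_weak_sol (cst 0) (cst 0).
Proof.
move=> i; exists (grad (cst 0)).
have e0 : component (cst 0 : E -> F) i = cst 0 by apply/funext => x; rewrite /component mxE.
have cz := test_closure_test oOm bOm (p12 i) (test_function0 Om).
rewrite e0; split=> // v V cv.
rewrite (_ : (fun x => dot _ _) = fun x => 0 * v x)//; apply/funext => x.
rewrite (_ : grad (cst 0) x = 0) ?p_flux0 ?dot0l ?mul0r//.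
by apply/rowP => j; rewrite !mxE partial_cst.
Qed.

Lemma vec_weak_sol_estimate : exists2 C : R, 1 <= C & forall f1 f2 u1 u2 (dl : R),
  mvec f1 -> mvec f2 -> (forall x, `|f1 x| <= K) -> (forall x, `|f2 x| <= K) ->
  vec_weak_sol f1 u1 -> vec_weak_sol f2 u2 -> 0 < dl ->
  {ae leb, forall x, Om x -> `|f1 x - f2 x| <= dl} ->
  {ae leb, forall x, Om x -> `|u1 x - u2 x| <= C * dl} /\
  (W1p0_vec_norm Om p (u1 \- u2)%R <= (C * dl)%:E)%E.
Proof.
have /choice[C hC] := fun i => let: ex_intro2 C C1 H :=
  weak_sol_estimate N0 oOm bOm (p12 i) (p_range i) (ltW K0) in ex_intro (fun C : R => _ /\ _) C (conj C1 H).
have C0 i : 0 <= 2 * C i by rewrite mulr_ge0// (le_trans ler01 (hC i).1).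
exists (1 + \sum_i 2 * C i); first by rewrite lerDl sumr_ge0.
move=> f1 f2 u1 u2 dl mf1 mf2 f1K f2K s1 s2 dl0 f12.
have est i : {ae leb, forall x, Om x -> `|u1 x ord0 i - u2 x ord0 i| <= C i * dl} /\
    (W1p_norm Om (p i) (component (u1 \- u2)%R i) <= (2 * C i * dl)%:E)%E.
  have [G1 w1] := s1 i; have [G2 w2] := s2 i; have [C1 H] := hC i.
  have f1i x : `|component f1 i x| <= K by exact: le_trans (entry_le_norm _ _) (f1K x).
  have f2i x : `|component f2 i x| <= K by exact: le_trans (entry_le_norm _ _) (f2K x).
  have fi : {ae leb, forall x, Om x -> `|component f1 i x - component f2 i x| <= dl}.
    apply: filterS f12 => x hx Ox; apply: le_trans (hx Ox).
    by have := entry_le_norm (f1 x - f2 x) i; rewrite !mxE.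
  have [h1 h2] := H _ _ _ _ _ _ _ (mf1 i) (mf2 i) f1i f2i w1 w2 dl0 fi; split=> //.
  rewrite (_ : component (u1 \- u2)%R i = fun x => component u1 i x - component u2 i x).
    apply: (W1p_norm_le oOm bOm (p12 i) C1 dl0 _ h2).
    exact: (test_closureB oOm bOm (p12 i) w1.1 w2.1).
  by apply/funext => x; rewrite /component !mxE.
split.
  have : {ae leb, forall x i, Om x -> `|u1 x ord0 i - u2 x ord0 i| <= C i * dl}.
    by apply: filter_forall => i; exact: (est i).1.
  apply: filterS => x hx Ox; apply: rV_norm_le => [|i].
    by rewrite mulr_ge0 ?(ltW dl0)// addr_ge0// sumr_ge0.
  rewrite !mxE; apply: le_trans (hx i Ox) _; apply: ler_wpM2r; first exact: ltW.
  rewrite (bigD1 i)//= addrCA; have := (hC i).1.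
  have : 0 <= \sum_(j < d | j != i) 2 * C j by exact: sumr_ge0.
  by move: (\sum_(_ < _ | _) _) (C i) => s c; lra.
apply: (@le_trans _ _ (\sum_(i < d) (2 * C i * dl)%:E)%E).
  by apply: lee_sum => i _; exact: (est i).2.
by rewrite sumEFin lee_fin -mulr_suml; apply: ler_wpM2r; [exact: ltW|rewrite lerDr].
Qed.

Definition fixed_point (lam : R) u := vec_weak_sol (fun x => lam *: h (u x)) u.

Lemma mvec_nonlinearity lam u : mvec u -> mvec (fun x => lam *: h (u x)).
Proof.
move=> mu i; rewrite (_ : component _ i = fun x => lam * h (u x) ord0 i); last first.
  by apply/funext => x; rewrite /component mxE.
apply: measurable_funM => //.
have ch : continuous (fun y : F => h y ord0 i).
  apply: locally_lipschitz_continuous => y; exists setT; first exact: filterT.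
  exists K; split; first exact: num_real.
  move=> M KM yz _ /=; apply: le_trans (hlip _ _) _.
  by apply: ler_wpM2r => //; exact: ltW.
exact: (measurableT_comp (continuous_measurable_rV ch) (measurable_rV_on mOm mu)).
Qed.

Section small_parameter.
Variables (C : R).
Hypotheses (C1 : 1 <= C) (est : forall f1 f2 u1 u2 (dl : R),
  mvec f1 -> mvec f2 -> (forall x, `|f1 x| <= K) -> (forall x, `|f2 x| <= K) ->
  vec_weak_sol f1 u1 -> vec_weak_sol f2 u2 -> 0 < dl ->
  {ae leb, forall x, Om x -> `|f1 x - f2 x| <= dl} ->
  {ae leb, forall x, Om x -> `|u1 x - u2 x| <= C * dl} /\
  (W1p0_vec_norm Om p (u1 \- u2)%R <= (C * dl)%:E)%E).

Let arith1 (a b c : R) : 0 < a -> b <= 1 / 4 -> c <= 1 / 4 -> b + c <= 2 * a + 1.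
Proof. lra. Qed.

Let arith2 (a q : R) : 0 < a -> 0 <= q -> a + (2 * a + 1 * q) / 4 <= 2 * a + 1 * (2^-1 * q).
Proof. lra. Qed.

Let arith3 (a : R) : 0 < a -> a + 2 * a / 4 <= 2 * a.
Proof. lra. Qed.

(** Chosen so that C lam0 K <= 1/4: this bounds both the contraction factor of the solution operator
    applied to [lam *: h (u x)] and the size of its values. *)
Definition lambda0 : R := (4 * C * (K + 1))^-1.
Local Notation lam0 := lambda0.

Let C0 : 0 < C. Proof. exact: lt_le_trans C1. Qed.
Let K1 : 0 < K + 1. Proof. by rewrite addr_gt0. Qed.

Lemma lambda0_gt0 : 0 < lam0. Proof. by rewrite invr_gt0 !mulr_gt0. Qed.

Let lam0K : 0 < lam0 * K. Proof. exact: mulr_gt0 lambda0_gt0 K0. Qed.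

Let lam0_le1 : lam0 <= 1.
Proof.
rewrite invf_le1 ?mulr_gt0//; have := mulr_ge0 (ltW C0) (ltW K0); move: C1; rewrite mulrDr; lra.
Qed.

Let CK : C * (lam0 * K) <= 1 / 4.
Proof.
rewrite (_ : C * (lam0 * K) = (K / (K + 1)) / 4); last by rewrite /lam0; field; rewrite !gt_eqF.
by apply: ler_wpM2r; [rewrite invr_ge0|rewrite ler_pdivrMr// mul1r lerDl].
Qed.

Let bnd lam u x : `|lam| < lam0 -> `|lam *: h (u x)| <= lam0 * K.
Proof. by move=> /ltW l; rewrite normrZ; apply: ler_pM. Qed.

Let bndK lam u x : `|lam| < lam0 -> `|lam *: h (u x)| <= K.
Proof. by move=> l; apply: le_trans (bnd u x l) _; rewrite ler_piMl// ltW. Qed.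

Let nonlinearity_diff lam mu u v x (D r : R) : `|mu| < lam0 -> `|lam - mu| <= D ->
  `|u x - v x| <= r -> `|lam *: h (u x) - mu *: h (v x)| <= K * D + lam0 * K * r.
Proof.
move=> lm lmD uvr.
rewrite (_ : _ - _ = (lam - mu) *: h (u x) + mu *: (h (u x) - h (v x))); last first.
  by rewrite scalerBl scalerBr addrA subrK.
apply: le_trans (ler_normD _ _) _; rewrite !normrZ; apply: lerD.
  by rewrite mulrC; apply: ler_pM.
rewrite -mulrA; apply: ler_pM => //; first exact: ltW.
by apply: le_trans (hlip _ _) _; apply: ler_wpM2l => //; exact: ltW.
Qed.

(** Comparison with the solution 0 for the right-hand side 0, which is within lam0 K of the given
    one. The bound 1/4 lies inside the box where clipping is the identity. *)
Lemma fixed_point_bound lam u : `|lam| < lam0 -> fixed_point lam u ->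
  {ae leb, forall x, Om x -> `|u x| <= 1 / 4}.
Proof.
move=> l su; have mu := vec_weak_sol_measurable su.
have m0 : mvec (cst 0) by exact: vec_weak_sol_measurable vec_weak_sol0.
have f0K x : `|cst (0 : F) (x : E)| <= K by rewrite normr0 ltW.
have [] := est (mvec_nonlinearity lam mu) m0 (fun x => bndK u x l) f0K su vec_weak_sol0 lam0K.
  by apply: aeW => x Ox; rewrite subr0 bnd.
by move=> e _; apply: filterS e => x hx Ox; apply: le_trans CK; have := hx Ox; rewrite subr0.
Qed.

(** A bound r on |u - v| improves to A + r / 4; starting from 1/4 + 1/4 and iterating, it falls to 2
    A. The number D > 0 replaces |lam - mu| because [est] asks for a positive distance, also when
    lam = mu. *)
Lemma fixed_point_lipschitz_eps lam mu u v (D : R) : `|lam| < lam0 -> `|mu| < lam0 ->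
  0 < D -> `|lam - mu| <= D -> fixed_point lam u -> fixed_point mu v ->
  {ae leb, forall x, Om x -> `|u x - v x| <= 2 * C * K * D} /\
  (W1p0_vec_norm Om p (u \- v)%R <= (2 * C * K * D)%:E)%E.
Proof.
move=> ll lm D0 lmD su sv.
have mu' := vec_weak_sol_measurable su; have mv := vec_weak_sol_measurable sv.
set A := C * K * D; have A0 : 0 < A by rewrite !mulr_gt0.
have A2 : 2 * C * K * D = 2 * A by rewrite /A; ring.
have step (r : R) : 0 <= r -> {ae leb, forall x, Om x -> `|u x - v x| <= r} ->
    {ae leb, forall x, Om x -> `|u x - v x| <= A + r / 4} /\
    (W1p0_vec_norm Om p (u \- v)%R <= (A + r / 4)%:E)%E.
  move=> r0 uvr; have dl0 : 0 < K * D + lam0 * K * r.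
    by rewrite ltr_pwDl ?mulr_gt0// mulr_ge0// ltW.
  have [] := est (mvec_nonlinearity lam mu') (mvec_nonlinearity mu mv)
    (fun x => bndK u x ll) (fun x => bndK v x lm) su sv dl0.
    by apply: filterS uvr => x hx Ox; apply: nonlinearity_diff => //; exact: hx.
  have le : C * (K * D + lam0 * K * r) <= A + r / 4.
    rewrite mulrDr mulrA -/A lerD2l mulrA; apply: le_trans (ler_wpM2r r0 CK) _.
    by rewrite mul1r mulrC.
  move=> e1 e2; split.
    by apply: filterS e1 => x hx Ox; exact: le_trans (hx Ox) le.
  by apply: le_trans e2 _; rewrite lee_fin.
have q0 n : 0 <= 2^-1 ^+ n :> R by rewrite exprn_ge0// invr_ge0.
have iter n : {ae leb, forall x, Om x -> `|u x - v x| <= 2 * A + 1 * 2^-1 ^+ n}.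
  elim: n => [|n IH].
    have := fixed_point_bound ll su; have := fixed_point_bound lm sv.
    apply: filterS2 => x hv hu Ox; rewrite expr0 mulr1.
    apply: le_trans (ler_normB _ _) _; exact: arith1 A0 (hu Ox) (hv Ox).
  have r0 : 0 <= 2 * A + 1 * 2^-1 ^+ n by rewrite mul1r addr_ge0// mulr_ge0// ltW.
  have [e _] := step _ r0 IH; apply: filterS e => x hx Ox; apply: le_trans (hx Ox) _.
  by rewrite exprS; exact: arith2.
have uv : {ae leb, forall x, Om x -> `|u x - v x| <= 2 * A}.
  have : {ae leb, forall x n, Om x -> `|u x - v x| <= 2 * A + 1 * 2^-1 ^+ n}.
    by apply: ae_foralln => n; exact: iter.
  by apply: filterS => x hx Ox; apply: (@le_geometric _ _ 1) => // n; exact: hx.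
rewrite A2; split=> //; have A20 : 0 <= 2 * A by rewrite mulr_ge0// ltW.
have [_ e] := step _ A20 uv; apply: le_trans e _; rewrite lee_fin.
exact: arith3.
Qed.

Lemma fixed_point_lipschitz lam mu u v : `|lam| < lam0 -> `|mu| < lam0 ->
  fixed_point lam u -> fixed_point mu v ->
  {ae leb, forall x, Om x -> `|u x - v x| <= 2 * C * K * `|lam - mu|} /\
  (W1p0_vec_norm Om p (u \- v)%R <= (2 * C * K * `|lam - mu|)%:E)%E.
Proof.
move=> ll lm su sv; have CK0 : 0 < 2 * C * K by rewrite !mulr_gt0.
have Deps (e : R) : 0 < e -> 0 < `|lam - mu| + e by move=> e0; rewrite ltr_wpDl.
have Dle (e : R) : 0 < e -> `|lam - mu| <= `|lam - mu| + e by move=> e0; rewrite lerDl ltW.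
split.
  have q0 n : 0 < 2^-1 ^+ n :> R by rewrite exprn_gt0// invr_gt0.
  have : {ae leb, forall x n, Om x ->
      `|u x - v x| <= 2 * C * K * `|lam - mu| + 2 * C * K * 2^-1 ^+ n}.
    apply: ae_foralln => n; rewrite -mulrDr.
    by have [] := fixed_point_lipschitz_eps ll lm (Deps _ (q0 n)) (Dle _ (q0 n)) su sv.
  by apply: filterS => x hx Ox; apply: (@le_geometric _ _ (2 * C * K)) => [|n]; [exact: ltW|exact: hx].
apply/lee_addgt0Pr => e e0; have e1 : 0 < e / (2 * C * K) by exact: divr_gt0.
have [_ le] := fixed_point_lipschitz_eps ll lm (Deps _ e1) (Dle _ e1) su sv.
by apply: le_trans le _; rewrite -EFinD lee_fin mulrDr mulrCA divff ?mulr1 ?gt_eqF.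
Qed.

Lemma vec_weak_sol_eq f1 f2 u : mvec f1 -> mvec f2 ->
  {ae leb, forall x, Om x -> f1 x = f2 x} -> vec_weak_sol f1 u -> vec_weak_sol f2 u.
Proof.
move=> m1 m2 f12 s i; have [G hG] := s i; exists G.
apply: (weak_sol_eq oOm (p12 i) (m1 i) (m2 i) _ hG).
by apply: filterS f12 => x hx Ox; rewrite /component hx.
Qed.

(* Picard iteration for the solution operator of the decoupled system. *)
Lemma fixed_point_exists lam : `|lam| < lam0 -> exists u, fixed_point lam u.
Proof.
(* S is the solution operator; the implication makes it total on functions that may fail to be
   measurable. *)
move=> ll; have /choice[S hS] : forall u, exists v, mvec u ->
    vec_weak_sol (fun x => lam *: h (u x)) v.
  move=> u; have [mu|nmu] := pselect (mvec u); last by exists u => /nmu.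
  by have [v hv] := vec_weak_sol_exists (mvec_nonlinearity lam mu) (fun x => bndK u x ll); exists v.
pose w n := iter n S (cst 0 : E -> F).
have m0 : mvec (cst 0) by exact: vec_weak_sol_measurable vec_weak_sol0.
have mw n : mvec (w n).
  by elim: n => [|n IH]; [exact: m0|exact: vec_weak_sol_measurable (hS _ IH)].
have q0 n : 0 < 2^-1 ^+ n :> R by rewrite exprn_gt0// invr_gt0.
have ll0 : `|lam - lam| <= 0 by rewrite subrr normr0.
have S_lip u v (r : R) : mvec u -> mvec v -> 0 < r ->
    {ae leb, forall x, Om x -> `|u x - v x| <= r} ->
    {ae leb, forall x, Om x -> `|S u x - S v x| <= r / 4}.
  move=> mu mv r0 uv; have dl0 : 0 < lam0 * K * r by exact: mulr_gt0.
  have [] := est (mvec_nonlinearity lam mu) (mvec_nonlinearity lam mv)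
    (fun x => bndK u x ll) (fun x => bndK v x ll) (hS _ mu) (hS _ mv) dl0.
    apply: filterS uv => x hx Ox; rewrite -[leRHS]add0r -(mulr0 K).
    by apply: nonlinearity_diff => //; exact: hx.
  move=> e _; apply: filterS e => x hx Ox; apply: le_trans (hx Ox) _.
  by rewrite mulrA; apply: le_trans (ler_wpM2r (ltW r0) CK) _; rewrite mul1r mulrC.
have inc n : {ae leb, forall x, Om x -> `|w n.+1 x - w n x| <= 2^-1 ^+ n}.
  elim: n => [|n IH].
    have f0K x : `|cst (0 : F) (x : E)| <= K by rewrite normr0 ltW.
    have [] := est (mvec_nonlinearity lam m0) m0 (fun x => bndK (cst 0) x ll) f0K
      (hS _ m0) vec_weak_sol0 lam0K.
      by apply: aeW => x Ox; rewrite subr0 bnd.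
    move=> e _; apply: filterS e => x hx Ox; rewrite expr0.
    by apply: le_trans (hx Ox) (le_trans CK _); rewrite mul1r invf_le1// ler1n.
  have e := S_lip _ _ _ (mw n.+1) (mw n) (q0 n) IH.
  apply: filterS e => x hx Ox; apply: le_trans (hx Ox) _; rewrite exprS.
  by have := q0 n; move: (2^-1 ^+ n) => q; lra.
have inc_all : {ae leb, forall x n, Om x -> `|w n.+1 x - w n x| <= 2^-1 ^+ n}.
  by apply: ae_foralln => n; exact: inc.
have dist x n m : (forall n, `|w n.+1 x - w n x| <= 2^-1 ^+ n) ->
    `|w (m + n)%N x - w n x| <= 2 * 2^-1 ^+ n - 2 * 2^-1 ^+ (m + n).
  move=> hx; elim: m => [|m IH]; first by rewrite !add0n !subrr normr0.
  rewrite -(subrK (w (m + n)%N x) (w (m.+1 + n)%N x)) -addrA.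
  apply: le_trans (ler_normD _ _) _; have := hx (m + n)%N; rewrite addSn => h1.
  apply: le_trans (lerD h1 IH) _; rewrite exprS.
  by move: (2^-1 ^+ n) (2^-1 ^+ (m + n)) => a b; lra.
have /choice[z hz] : forall i, exists z : E -> R, measurable_fun Om z /\
    {ae leb, forall x, Om x -> w n x ord0 i @[n --> \oo] --> z x}.
  move=> i; have cv : {ae leb, forall x, Om x -> cvgn (fun n => w n x ord0 i)}.
    apply: filterS inc_all => x hx Ox; apply: (@summable_cvgn _ _ 2) => n.
    apply: le_trans (_ : _ <= \sum_(k < n) 2^-1 ^+ k) _.
      apply: ler_sum => k _; apply: le_trans (hx k Ox).
      by have := entry_le_norm (w k.+1 x - w k x) i; rewrite !mxE.
    elim: n => [|n IH]; first by rewrite big_ord0.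
    rewrite big_ord_recl expr0; under eq_bigr do rewrite exprS.
    by rewrite -mulr_sumr; move: IH; move: (\sum_(_ < _) _) => s; lra.
  by have [z mz cz] := ae_cvgn_measurable mOm (fun n => mw n i) cv; exists z.
pose u0 x : F := \row_i z i x.
have mu0 : mvec u0.
  by move=> i; rewrite (_ : component u0 i = z i); [exact: (hz i).1|
    apply/funext => x; rewrite /component mxE].
have lim_dist : {ae leb, forall x n, Om x -> `|u0 x - w n x| <= 2 * 2^-1 ^+ n}.
  have cz : {ae leb, forall x i, Om x -> w n x ord0 i @[n --> \oo] --> z i x}.
    by apply: filter_forall => i; exact: (hz i).2.
  move: inc_all cz; apply: filterS2 => x hx hzx n Ox.
  apply: rV_norm_le => [|i]; first by rewrite mulr_ge0// ltW.
  rewrite !mxE; have cv : `|w k x ord0 i - w n x ord0 i| @[k --> \oo] --> `|z i x - w n x ord0 i|.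
    by apply: cvg_norm; apply: cvgB; [exact: hzx|exact: cvg_cst].
  rewrite -(cvg_lim _ cv)//; apply: limr_le; first by apply/cvg_ex; eexists; exact: cv.
  near=> k; have nk : (n <= k)%N by near: k; exact: nbhs_infty_ge.
  apply: le_trans (_ : _ <= `|w k x - w n x|) _.
    by have := entry_le_norm (w k x - w n x) i; rewrite !mxE.
  have := dist x n (k - n)%N (fun m => hx m Ox); rewrite subnK// => /le_trans; apply.
  by rewrite gerBl mulr_ge0// ltW.
have lim_dist_n n : {ae leb, forall x, Om x -> `|u0 x - w n x| <= 2 * 2^-1 ^+ n}.
  by apply: filterS lim_dist => x hx Ox; exact: hx.
have eq_u0 : {ae leb, forall x, Om x -> S u0 x = u0 x}.
  have : {ae leb, forall x n, Om x -> `|S u0 x - u0 x| <= 2 * 2^-1 ^+ n}.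
    apply: ae_foralln => n; have r0 : 0 < 2 * 2^-1 ^+ n :> R by rewrite mulr_gt0.
    have h1 := S_lip _ _ _ mu0 (mw n) r0 (lim_dist_n n); have h2 := lim_dist_n n.+1.
    move: h1 h2; apply: filterS2 => x hx hy Ox.
    rewrite -(subrK (w n.+1 x) (S u0 x)) -addrA; apply: le_trans (ler_normD _ _) _.
    rewrite [X in _ + X]distrC; apply: le_trans (lerD (hx Ox) (hy Ox)) _.
    by rewrite exprS; have := q0 n; move: (2^-1 ^+ n) => q; lra.
  apply: filterS => x hx Ox; apply/eqP; rewrite -subr_eq0 -normr_le0.
  by apply: (@le_geometric _ 0 2) => // n; rewrite add0r; exact: hx.
(* The fixed point is S u0 and not its almost everywhere equal copy u0: S u0 is known to solve an
   equation, whose right-hand side may be changed on a null set. *)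
have sol := hS _ mu0; exists (S u0); apply: (vec_weak_sol_eq _ _ _ sol).
- exact: mvec_nonlinearity.
- by apply: mvec_nonlinearity; exact: vec_weak_sol_measurable sol.
by apply: filterS eq_u0 => x hx Ox; rewrite hx.
Unshelve. all: by end_near. Qed.

End small_parameter.
End fixed_point.

Section bounded_solutions.
Context {R : realType} {N d : nat}.
Local Notation E := 'rV[R]_N.
Local Notation F := 'rV[R]_d.
Local Notation leb := (lebesgue_rV R N).
Variables (Om : set E) (p : 'I_d -> R) (g : F -> F).
Hypotheses (oOm : open Om) (bOm : bounded_set Om) (p12 : forall i, 1 < p i <= 2)
  (g_lip : locally_lipschitz g).
Implicit Types (u w : E -> F).

Let mOm : measurable Om. Proof. exact: open_measurable_rV. Qed.

Lemma measurable_comp_locally_lipschitz w i : mvec Om w ->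
  measurable_fun Om (component (g \o w) i).
Proof.
move=> mw; have cg := locally_lipschitz_continuous (i := i) g_lip.
exact: (measurableT_comp (continuous_measurable_rV cg) (measurable_rV_on mOm mw)).
Qed.

Lemma Linfty_vecP w (c : R) : 0 <= c -> mvec Om w ->
  {ae leb, forall x, Om x -> `|w x| <= c} -> Linfty_vec Om w.
Proof.
move=> c0 mw wc i; apply/(Lp_inftyP mOm); split; first exact: mw.
by exists c => //; apply: filterS wc => x hx Ox; apply: le_trans (hx Ox); exact: entry_le_norm.
Qed.

Lemma W1p0_vec_measurable w : W1p0_vec Om p w -> mvec Om w.
Proof.
move=> Ww i.
exact: (test_closure_measurable oOm (p12 i) (W1p0_test_closure oOm bOm (p12 i) (Ww i))).
Qed.

Let rhs_eq lam w i (v : E -> R) : mvec Om w -> {ae leb, forall x, Om x -> `|w x| <= 1} ->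
  measurable_fun Om v -> measurable_fun Om (component (fun x => lam *: g (clip (w x))) i) ->
  \int[leb]_(x in Om) (lam * component (g \o w) i x * v x) =
  \int[leb]_(x in Om) (component (fun x => lam *: g (clip (w x))) i x * v x).
Proof.
move=> mw w1 mv mh; have mg := measurable_comp_locally_lipschitz i mw.
apply: (ae_eq_Rintegral mOm) => //.
- by apply: measurable_funM => //; exact: measurable_funM.
- exact: measurable_funM.
by apply: filterS w1 => x hx Ox; rewrite /component mxE /= clip_id// hx.
Qed.

(** Where |w| <= 1 the clipping is the identity, so the right-hand sides of the original and the
    clipped system agree almost everywhere. *)
Lemma solution_fixed_point lam w : (forall i, measurable_fun Om
    (component (fun x => lam *: g (clip (w x))) i)) ->
  {ae leb, forall x, Om x -> `|w x| <= 1} ->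
  solution Om p g lam w <-> mvec Om w /\ fixed_point Om p (g \o clip) lam w.
Proof.
move=> mh w1; split=> [[Ww _ sw]|[mw fw]].
  have mw := W1p0_vec_measurable Ww; split=> // i; apply/(weak_solP oOm bOm (p12 i)).
  split=> [|v Wv]; first exact: Ww.
  have mv := test_closure_measurable oOm (p12 i) (W1p0_test_closure oOm bOm (p12 i) Wv).
  by rewrite sw//; exact: rhs_eq.
have Ww i := (weak_solP oOm bOm (p12 i) _ _).1 (fw i).
split=> [i||i v Wv]; [exact: (Ww i).1|exact: Linfty_vecP ler01 mw w1|].
have mv := test_closure_measurable oOm (p12 i) (W1p0_test_closure oOm bOm (p12 i) Wv).
by rewrite (Ww i).2//; apply/esym; exact: rhs_eq.
Qed.

End bounded_solutions.

Unset Implicit Arguments.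

Theorem theorem5p1 (R : realType) (N d : nat) (N_gt0 : (0 < N)%N)
  (Om : set 'rV[R]_N) (Om_open : open Om) (Om_bounded : bounded_set Om)
  (p : 'I_d -> R)
  (p_range : forall i, 2 * N%:R / (N%:R + 2) < p i <= 2)
  (p_gt1 : forall i, 1 < p i)
  (g : 'rV[R]_d -> 'rV[R]_d) (g_lip : locally_lipschitz g) :
  exists (lam0 : R) (u : R -> 'rV[R]_N -> 'rV[R]_d),
    [/\ 0 < lam0 /\
        (forall lam, `|lam| < lam0 ->
          W1p0_vec Om p (u lam) /\ Linfty_vec Om (u lam)),
        (forall lam, `|lam| < lam0 ->
          solution Om p g lam (u lam) /\ Linfty_vec Om (g \o u lam)) /\
        (forall h : 'rV[R]_N -> 'rV[R]_d, Linfty_vec Om h ->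
          forall i, W1p0_dual Om (p i) (pairing Om (component h i))),
        exists L : R, forall lam mu, `|lam| < lam0 -> `|mu| < lam0 ->
          (Linfty_vec_norm Om (u lam \- u mu)%R <= (L * `|lam - mu|)%:E)%E /\
          (W1p0_vec_norm Om p (u lam \- u mu)%R <= (L * `|lam - mu|)%:E)%E &
        exists eps lam1 : R, [/\ 0 < eps, 0 < lam1 < lam0 &
          forall lam, `|lam| < lam1 ->
            (Linfty_vec_norm Om (u lam) <= eps%:E)%E /\
            forall w, solution Om p g lam w ->
              (Linfty_vec_norm Om w <= eps%:E)%E ->
              {ae lebesgue_rV R N, forall x, Om x -> w x = u lam x}]].
Proof.
have p12 i : 1 < p i <= 2 by rewrite p_gt1/=; case/andP: (p_range i).
have p_low i : 2 * N%:R / (N%:R + 2) < p i by case/andP: (p_range i).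
have mOm : measurable Om by exact: open_measurable_rV.
have [K K0 [hlip hK]] := clip_comp_lipschitz g_lip; set h := g \o clip.
have [C C1 est] := vec_weak_sol_estimate N_gt0 Om_open Om_bounded p12 p_low K0.
set lam0 := lambda0 K C; have lam00 : 0 < lam0 := lambda0_gt0 K0 C1.
have /choice[u hu] : forall lam, exists u : 'rV[R]_N -> 'rV[R]_d,
    `|lam| < lam0 -> fixed_point Om p h lam u.
  move=> lam; have [ll|nl] := pselect (`|lam| < lam0); last by exists (cst 0) => /nl.
  have [u hu] := fixed_point_exists N_gt0 Om_open Om_bounded p12 K0 hlip hK C1 est ll.
  by exists u.
have mu lam : `|lam| < lam0 -> mvec Om (u lam).
  by move=> /hu; exact: (vec_weak_sol_measurable Om_open p12).
have mh lam w : mvec Om w -> mvec Om (fun x => lam *: h (w x)).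
  exact: (mvec_nonlinearity Om_open hlip).
have bound lam w : `|lam| < lam0 -> fixed_point Om p h lam w ->
    {ae lebesgue_rV R N, forall x, Om x -> `|w x| <= 1}.
  move=> ll fw.
  have := fixed_point_bound Om_open Om_bounded p12 K0 hlip hK C1 est ll fw.
  by apply: filterS => x hx Ox; apply: le_trans (hx Ox) _; rewrite mul1r invf_le1// ler1n.
have sol lam : `|lam| < lam0 -> solution Om p g lam (u lam).
  move=> ll; apply/(solution_fixed_point Om_open Om_bounded p12 g_lip).
  - exact: mh (mu _ ll).
  - exact: bound ll (hu _ ll).
  - by split; [exact: mu|exact: hu].
exists lam0, u; split.
- split=> // lam ll; have [Wu Lu _] := sol _ ll; split=> //.
- split=> [lam ll|w Lw i]; last exact: (pairing_W1p0_dual Om_open Om_bounded (p12 i) (Lw i)).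
  split; first exact: sol.
  apply: (Linfty_vecP Om_open (ltW K0)).
    move=> i; exact: (measurable_comp_locally_lipschitz Om_open g_lip i (mu _ ll)).
  apply: filterS (bound _ _ ll (hu _ ll)) => x hx Ox.
  by rewrite /= -(clip_id (hx Ox)).
- exists (2 * C * K) => lam nu ll ln.
  have [e1 e2] := fixed_point_lipschitz Om_open Om_bounded p12 K0 hlip hK C1 est ll ln
    (hu _ ll) (hu _ ln).
  split=> //; apply: Lp_infty_norm_le => //.
    by rewrite !mulr_ge0// ?ltW// (lt_le_trans ltr01 C1).
  by apply: filterS e1 => x hx Ox; rewrite /= normr_id; exact: hx.
(* Any solution with sup norm at most 1 is a fixed point of the clipped problem, and the Lipschitz
   estimate for two equal parameters identifies it with u lam. The half serves to make lam1 smaller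
   than lam0. *)
exists 1, (lam0 / 2); split=> // [|lam ll].
  by rewrite divr_gt0//= ltr_pdivrMr// mulr_natr mulr2n ltrDl.
have {}ll : `|lam| < lam0.
  by apply: lt_trans ll _; rewrite ltr_pdivrMr// mulr_natr mulr2n ltrDl.
split.
  apply: Lp_infty_norm_le => //.
  by apply: filterS (bound _ _ ll (hu _ ll)) => x hx Ox; rewrite /= normr_id; exact: hx.
move=> w sw nw; have w1 : {ae lebesgue_rV R N, forall x, Om x -> `|w x| <= 1}.
  apply: filterS (Lp_infty_norm_ae nw) => x hx Ox.
  by have := hx Ox; rewrite lee_fin /= normr_id.
have mw : mvec Om w by case: sw => Ww _ _; exact: (W1p0_vec_measurable Om_open Om_bounded p12 Ww).
have [_ fw] := (solution_fixed_point Om_open Om_bounded p12 g_lip (mh lam _ mw) w1).1 sw.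
have [e _] := fixed_point_lipschitz Om_open Om_bounded p12 K0 hlip hK C1 est ll ll fw (hu _ ll).
apply: filterS e => x hx Ox; apply/eqP; rewrite -subr_eq0 -normr_le0.
by have := hx Ox; rewrite subrr normr0 mulr0.
Qed.
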